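(* Assume that there is $p>2$ such that $\tau_p=\mathbb{E}[|\varepsilon_i|^p]<\infty$ for all $i$. Let $\theta>0$ and define the (random) penalty function $$\mathrm{pen}(m)=(1+\theta)\frac{\mathrm{Tr}({}^tP_n\pi_mP_n)}{n}\hat\sigma^2,\qquad m\in\mathcal{M}.$$ For any $0<q\le1$ such that $2(q+1)<p$, the penalized least-squares estimator $\tilde s=\hat s_{\hat m}$ satisfies $$\mathbb{E}[\|s-\tilde s\|_n^{2q}]^{1/q}\le C\left(\inf_{m\in\mathcal{M}}\mathbb{E}[\|s-\hat s_m\|_n^2]+2\|s-\pi s\|_n^2\right)+\rho^2(P_n)\sigma^2\bar R_n(p,q,\theta),$$ where $$\bar R_n(p,q,\theta)=\frac{R_n(p,q,\theta)^{1/q}}{n}+C'\tau_p^{1/q}\kappa_n\left(\frac{\|s\|_n^2}{\rho^2(P_n)\sigma^2}+\tau_p\right)\left(\frac{\rho^{2\alpha_p}(P_n)}{\mathrm{Tr}({}^tP_nP_n)^{\beta_p}}\right)^{1/q-2/p},$$ $$R_n(p,q,\theta)=C'''\tau_p\left[N_0+\sum_{m\in\mathcal{M}:S_m\ne\{0\}}\left(1+\frac{\mathrm{Tr}({}^tP_n\pi_mP_n)}{\rho^2(\pi_mP_n)}\right)\left(\frac{\mathrm{Tr}({}^tP_n\pi_mP_n)}{\rho^2(P_n)}\right)^{q-p/2}\right],$$ $$\alpha_p=(p/2-1)\vee1,\qquad\beta_p=(p/2-1)\wedge1,$$ $C=C(q,\theta)$, $C'=C'(p,q,\theta)$ and $C'''=C'''(p,q,\theta)$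 are positive constants depending only on the indicated quantities, and $(\kappa_n)_{n\in\mathbb{N}}=(\kappa_n(p,q,\theta))_{n\in\mathbb{N}}$ is a sequence of positive numbers that tends to a constant $\kappa=\kappa(p,q,\theta)>0$ as $\mathrm{Tr}({}^tP_nP_n)/\rho^2(P_n)$ increases to infinity.
   Context: For $x\in\mathbb{R}^n$: $\|x\|_n^2=\frac1n\sum_{i=1}^nx_i^2$. For a real $n\times n$ matrix $A$, $\rho(A)=\sup_{x\ne0}\|Ax\|_n/\|x\|_n$ is the spectral norm, and ${}^tA$ is the transpose; $a\vee b=\max(a,b)$, $a\wedge b=\min(a,b)$. One observes $Y=s+\sigma P_n\varepsilon\in\mathbb{R}^n$, where $P_n\ne0$ is a known real $n\times n$ matrix (not necessarily invertible), $s\in\mathrm{Im}(P_n)$ is unknown and deterministic, $\sigma>0$ is unknown, and $\varepsilon=(\varepsilon_1,\dots,\varepsilon_n)'$ is a random vector with i.i.d. centered components of unit variance. $\{S_m,\ m\in\mathcal{M}\}$ is a finite or countable collection of linear subspaces of $\mathrm{Im}(P_n)$; $\pi_m$ is the orthogonal projection onto $S_m$; $\hat s_m=\pi_mY$. $N_0$ is the number of $m\in\mathcal{M}$ with $\dim(S_m)=0$. Given a penalty function $\mathrm{pen}$, $\hat m$ is any minimizer over $m\in\mathcal{M}$ of $\|Y-\hat s_m\|_n^2+\mathrm{pen}(m)$, and $\tilde s=\hat s_{\hat m}$. Variance estimator: $V$ is a linear subspace of $\mathrm{Im}(P_n)$ such that $\mathrm{Tr}({}^tP_n\pi P_n)\le\mathrm{Tr}({}^tP_nP_n)/2$,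 where $\pi$ is the orthogonal projection onto $V$, and $$\hat\sigma^2=\frac{n\|Y-\pi Y\|_n^2}{\mathrm{Tr}({}^tP_n(I_n-\pi)P_n)}.$$ *)

(* Defs.v *)
From HB Require Import structures.
From mathcomp Require Import all_boot all_order all_algebra.
From mathcomp Require Import all_classical all_reals all_analysis.

Set Implicit Arguments.
Unset Strict Implicit.
Unset Printing Implicit Defensive.

Import Order.TTheory GRing.Theory Num.Theory.
Import numFieldNormedType.Exports.

Local Open Scope classical_set_scope.
Local Open Scope ring_scope.

Section LinearAlgebra.
Context {R : realType} {n : nat}.
Implicit Types (A : 'M[R]_n) (x : 'cV[R]_n) (U : {vspace 'cV[R]_n}).

Definition normn x : R := Num.sqrt (n%:R^-1 * \sum_i x i 0 ^+ 2).

Definition specnorm A : R :=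
  sup [set normn (A *m x) / normn x | x in [set x | x != 0]].

Definition imspace A : {vspace 'cV[R]_n} := limg (linfun (mulmx A : 'cV_n -> 'cV_n)).

Definition is_orthogonal_projection U A : Prop :=
  forall x, A *m x \in U /\ forall u, u \in U -> u^T *m (x - A *m x) = 0.

End LinearAlgebra.

Section Independence.
Context d (T : measurableType d) {R : realType} (P : probability T R).

Definition mutually_independent (I : finType) (X : I -> {RV P >-> R}) : Prop :=
  forall (J : {set I}) (B : I -> set R), (forall i, measurable (B i)) ->
    (P (\bigcap_(i in [set` J]) (X i @^-1` B i)) =
     \prod_(i in J) P (X i @^-1` B i))%E.

Definition identically_distributed (I : finType) (X : I -> {RV P >-> R}) : Prop :=
  forall i j (B : set R), measurable B ->
    distribution P (X i) B = distribution P (X j) B.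

Definition iid (I : finType) (X : I -> {RV P >-> R}) : Prop :=
  mutually_independent X /\ identically_distributed X.

End Independence.

Section ModelSelection.
Context {R : realType} {n : nat}.
Implicit Types (Pn pi pim : 'M[R]_n) (s Y e : 'cV[R]_n) (p q theta sigma tau : R).

Definition observation Pn s sigma e : 'cV[R]_n := s + sigma *: (Pn *m e).

(* pi is the projection matrix onto the auxiliary space V *)
Definition sigma2_hat Pn pi Y : R :=
  n%:R * normn (Y - pi *m Y) ^+ 2 / \tr (Pn^T *m (1%:M - pi) *m Pn).

(* pim is the projection matrix onto the model S_m *)
Definition pen Pn pi theta pim Y : R :=
  (1 + theta) * (\tr (Pn^T *m pim *m Pn) / n%:R) * sigma2_hat Pn pi Y.

Definition criterion Pn pi theta pim Y : R :=
  normn (Y - pim *m Y) ^+ 2 + pen Pn pi theta pim Y.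

Definition alpha p : R := Num.max (p / 2 - 1) 1.
Definition beta p : R := Num.min (p / 2 - 1) 1.

Context {M : countType} (S : M -> {vspace 'cV[R]_n}) (pi_ : M -> 'M[R]_n).

Definition N0 : \bar R := counting [set m | \dim (S m) = 0%N].

(* Extended-real valued: N0 and the sum are infinite for some countable
   collections. *)
Definition Rn Pn p q tau (C3 : R) : \bar R :=
  ((C3 * tau)%:E *
   (N0 + \esum_(m in [set m | S m != 0%VS])
     ((1 + \tr (Pn^T *m pi_ m *m Pn) / specnorm (pi_ m *m Pn) ^+ 2) *
      (\tr (Pn^T *m pi_ m *m Pn) / specnorm Pn ^+ 2) `^ (q - p / 2))%:E))%E.

Definition Rn_bar Pn s p q sigma tau (C' C3 kappa_n : R) : \bar R :=
  (Rn Pn p q tau C3 `^ q^-1 * (n%:R^-1)%:E +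
   (C' * tau `^ q^-1 * kappa_n *
    (normn s ^+ 2 / (specnorm Pn ^+ 2 * sigma ^+ 2) + tau) *
    (specnorm Pn `^ (2 * alpha p) / \tr (Pn^T *m Pn) `^ beta p)
      `^ (q^-1 - 2 / p))%:E)%E.

End ModelSelection.

(* Main.v *)
Require Import Defs.
From HB Require Import structures.
From mathcomp Require Import all_boot all_order all_algebra.
From mathcomp Require Import all_classical all_reals all_analysis.
From mathcomp Require Import measurable_realfun ring lra.

Set Implicit Arguments.
Unset Strict Implicit.
Unset Printing Implicit Defensive.

Import Order.TTheory GRing.Theory Num.Theory.
Import numFieldNormedType.Exports.

Local Open Scope classical_set_scope.
Local Open Scope ring_scope.

(* Comparing the criterion at the selected model and at a model [m] bounds the loss
   by the bias and expected noise of [m], its random penalty, and the excess of the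
   quadratic forms |pi_l P e|^2 over their means, as long as the variance estimator
   is not much smaller than [sigma ^+ 2]. The excess is summed over all models [l]:
   each quadratic form is split into an off-diagonal chaos, decoupled by averaging
   over random bipartitions of the coordinates and estimated by Rosenthal's
   inequality applied twice, and a diagonal sum, which is truncated at its mean; only
   moments of order [p] are used and the result is the weight appearing in [Rn].
   The event that the variance estimator is too small is rare, by the lower
   deviations of a quadratic form, and the [q]-th moment of the total noise on it is
   bounded by a constant. That constant is dominated by the weight of a model with
   small expected noise if there is one, and by the oracle risk otherwise. *)

(** * Independent blocks of coordinates *)

(** The obstacle is integrability: [p] may be barely above 2, so a square [X i ^+ 2] is only known
    to have moments up to [p / 2], whereas a product [X i * X j] of independent factors has them up
    to [p]. This is why the diagonal is cut off and the chaos is not. Write [gam = p / 2 - 1], and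
    let the scale [K] be [tau] to the power [1 / gam]. For a model with normalised expected noise
    [t >= K], a deviation of the quadratic form by a fixed fraction of [t] costs a constant times
    [(K / t) ^ gam], and the identity [tau * t ^ (q - p / 2) * t = t ^ q * (K / t) ^ gam] turns this
    cost into the weight. For [t < K] the weight already exceeds what a first moment gives, and no
    deviation inequality is needed. The same exponent settles the rare event: with total noise of
    order [t] its probability is of order [(K / t) ^ gam], the [q]-th moment of the noise is of
    order [t ^ q], and [q <= gam] leaves [K ^ q]. Rosenthal's inequality is used for even integer
    orders only, where it follows from expanding powers of a squared norm. *)

Section RectangleMeasure.
Context (R : realType) (n : nat).

Definition rect (B : 'I_n -> set R) : set (n.-tuple R) :=
  [set x | forall i, B i (tnth x i)].

Definition rects : set (set (n.-tuple R)) :=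
  [set rect B | B in [set B | forall i, measurable (B i)]].

Lemma rect_measurable (B : 'I_n -> set R) :
  (forall i, measurable (B i)) -> measurable (rect B).
Proof.
move=> mB.
have -> : rect B = \bigcap_(i in [set: 'I_n]) ((@tnth _ R ^~ i) @^-1` B i).
  by apply/seteqP; split=> [x hx i _|x hx i]; [exact: hx|exact: (hx i I)].
apply: fin_bigcap_measurable => [|i _]; first exact: finite_finset.
by rewrite -[X in measurable X]setTI; exact: measurable_tnth.
Qed.

Lemma measurable_rects : (@measurable _ (n.-tuple R)) = <<s rects >>.
Proof.
apply/seteqP; split.
- apply: smallest_sub; first exact: smallest_sigma_algebra.
  move=> A; rewrite -bigcup_seq => -[i _ /= [B mB <-]].
  apply: sub_sigma_algebra; exists (fun j => if j == i then B else setT).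
    by move=> j; case: ifP.
  apply/seteqP; split=> [x /(_ i)|x [_ /= Bx] j]; first by rewrite eqxx.
  by case: eqP => // ->.
- apply: smallest_sub; first exact: (@sigma_algebra_measurable _ (n.-tuple R)).
  by move=> A [B mB <-]; exact: rect_measurable.
Qed.

(** Rectangles are stable under intersection and generate the product sigma-algebra, so measures of
    finite mass are determined by them. *)
Lemma tuple_measure_unique (m1 m2 : {measure set (n.-tuple R) -> \bar R}) :
  (forall B, (forall i, measurable (B i)) -> m1 (rect B) = m2 (rect B)) ->
  (m1 setT < +oo)%E -> forall A, measurable A -> m1 A = m2 A.
Proof.
move=> m12 m1oo A mA.
apply: (measure_unique rects (fun=> setT)) => //.
- exact: measurable_rects.
- move=> _ _ [B mB <-] [C mC <-]; exists (fun i => B i `&` C i).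
    by move=> i; exact: measurableI.
  apply/seteqP; split=> [x h|x [h1 h2] i]; last by split.
  by split=> i; case: (h i).
- move=> _; exists (fun=> setT) => //.
  by apply/seteqP; split.
- by rewrite bigcup_const //; exists 0%N.
- by move=> _ [B mB <-]; exact: m12.
Qed.

End RectangleMeasure.

Section BlockIndependence.
Context d (T : measurableType d) (R : realType) (P : probability T R).
Context (n : nat) (X : 'I_n -> {RV P >-> R}).

(** Coordinates outside [J] are set to 0 instead of being dropped: blocks of all index sets then
    share one type, and a single Fubini statement serves every split. *)
Definition block (J : {set 'I_n}) (w : T) : n.-tuple R :=
  [tuple if i \in J then X i w else 0 | i < n].

Lemma tnth_block J w i : tnth (block J w) i = if i \in J then X i w else 0.
Proof. by rewrite tnth_mktuple. Qed.

Lemma measurable_block J : measurable_fun setT (block J).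
Proof.
apply/measurable_fun_tnthP => i.
rewrite (_ : _ \o _ = fun w => if i \in J then X i w else 0); last first.
  by apply/funext => w /=; rewrite tnth_block.
by case: (i \in J).
Qed.

Hypothesis indep : mutually_independent X.

Lemma prob_all (C : 'I_n -> set R) : (forall i, measurable (C i)) ->
  P [set w | forall i, C i (X i w)] = (\prod_i P (X i @^-1` C i))%E.
Proof.
move=> mC; have := indep [set: 'I_n]%SET mC.
rewrite (eq_bigl predT); last by move=> i; rewrite inE.
move=> <-; congr (P _); apply/seteqP; split=> [w h i _|w h i]; first exact: h.
by apply: h; rewrite /= inE.
Qed.

(** Pulls a condition on a coordinate of the block back to [X i]. Off [J] the coordinate is the
    constant 0, and the condition is either void or impossible. *)
Let sec (J : {set 'I_n}) (B : 'I_n -> set R) i : set R :=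
  [set x | B i (if i \in J then x else 0)].

Let sec_notin (J : {set 'I_n}) B i : i \notin J ->
  sec J B i = setT \/ sec J B i = set0.
Proof.
move=> /negbTE iJ; rewrite /sec iJ.
have [B0|B0] := pselect (B i 0); [left|right].
  by apply/seteqP; split.
by apply/seteqP; split.
Qed.

Let measurable_sec J B i : measurable (B i) -> measurable (sec J B i).
Proof.
move=> mB; have [iJ|/sec_notin-/(_ B)[]->//] := boolP (i \in J).
by rewrite /sec iJ.
Qed.

Lemma block_rects (J I : {set 'I_n}) (B C : 'I_n -> set R) :
  (forall i, i \in J -> i \notin I) ->
  (forall i, measurable (B i)) -> (forall i, measurable (C i)) ->
  P (block J @^-1` rect B `&` block I @^-1` rect C) =
  (P (block J @^-1` rect B) * P (block I @^-1` rect C))%E.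
Proof.
move=> dJI mB mC.
have E K (D : 'I_n -> set R) :
    block K @^-1` rect D = [set w | forall i, sec K D i (X i w)].
  by apply/seteqP; split=> w /= h i; have := h i; rewrite tnth_block.
have -> : block J @^-1` rect B `&` block I @^-1` rect C =
    [set w | forall i, (sec J B i `&` sec I C i) (X i w)].
  rewrite !E; apply/seteqP; split=> w /=; first by move=> [h1 h2] i; split.
  by move=> h; split=> i; case: (h i).
rewrite !E (@prob_all (fun i => sec J B i `&` sec I C i)) ?prob_all;
  try by move=> i; do ?apply: measurableI; exact: measurable_sec.
(* By disjointness, at each index one of the two sections is trivial, so the factorisation holds
   coordinate by coordinate. *)
rewrite -big_split /=; apply: eq_bigr => i _.
have [iJ|iJ] := boolP (i \in J).
  have iI := dJI i iJ.
  case: (sec_notin C iI) => ->; rewrite ?setIT ?setI0.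
    by rewrite preimage_setT probability_setT mule1.
  by rewrite preimage_set0 measure0 mule0.
case: (sec_notin B iJ) => ->; rewrite ?setTI ?set0I.
  by rewrite preimage_setT probability_setT mul1e.
by rewrite preimage_set0 measure0 mul0e.
Qed.

(** Independence is extended from rectangles to measurable sets in one factor at a time: with the
    other event fixed, both sides are finite measures in the free one. *)
Lemma block_indep (J I : {set 'I_n}) (A B : set (n.-tuple R)) :
  (forall i, i \in J -> i \notin I) -> measurable A -> measurable B ->
  P (block J @^-1` A `&` block I @^-1` B) =
  (P (block J @^-1` A) * P (block I @^-1` B))%E.
Proof.
move=> dJI mA mB.
have mpre K D : measurable D -> measurable (block K @^-1` D).
  by move=> mD; rewrite -[X in measurable X]setTI; exact: measurable_block.
have fP D : measurable D -> P D \is a fin_num by move=> mD; exact: fin_num_measure.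
have stepA C : (forall i, measurable (C i)) ->
  P (block J @^-1` A `&` block I @^-1` rect C) =
  (P (block J @^-1` A) * P (block I @^-1` rect C))%E.
  move=> mC.
  have mD : measurable (block I @^-1` rect C) by apply: mpre; exact: rect_measurable.
  pose k := NngNum (fine_ge0 (measure_ge0 P (block I @^-1` rect C))).
  pose mJ := isMeasurableFun.Build _ _ _ _ _ (measurable_block J).
  pose bJ : {mfun T >-> n.-tuple R} := HB.pack (block J) mJ.
  have := @tuple_measure_unique R n
    (pushforward (mrestr P mD) bJ) (mscale k (pushforward P bJ)) _ _ A mA.
  rewrite /= /mscale /pushforward /mrestr /= fineK ?fP // muleC.
  apply; try exact: measurable_block.
  - by move=> E mE; rewrite muleC; exact: block_rects.
  - by rewrite preimage_setT setTI ltey_eq fP.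
have mD : measurable (block J @^-1` A) by exact: mpre.
pose k := NngNum (fine_ge0 (measure_ge0 P (block J @^-1` A))).
pose mI := isMeasurableFun.Build _ _ _ _ _ (measurable_block I).
pose bI : {mfun T >-> n.-tuple R} := HB.pack (block I) mI.
have := @tuple_measure_unique R n
  (pushforward (mrestr P mD) bI) (mscale k (pushforward P bI)) _ _ B mB.
rewrite /= /mscale /pushforward /mrestr /= fineK ?fP // => H; rewrite setIC.
apply: H; try exact: measurable_block.
- by move=> E mE; rewrite setIC; exact: stepA.
- by rewrite preimage_setT setTI ltey_eq fP.
Qed.

(** The joint law of disjoint blocks is the product of their laws, and both laws are pulled back to
    the same space: freezing one block amounts to integrating the other over an independent copy of
    [w]. *)
Lemma block_fubini (J I : {set 'I_n}) (f : n.-tuple R * n.-tuple R -> \bar R) :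
  (forall i, i \in J -> i \notin I) -> measurable_fun setT f -> (forall z, 0 <= f z)%E ->
  (\int[P]_w f (block J w, block I w) =
   \int[P]_w \int[P]_w' f (block J w, block I w'))%E.
Proof.
move=> dJI mf f0.
pose mJ := isMeasurableFun.Build _ _ _ _ _ (measurable_block J).
pose bJ : {mfun T >-> n.-tuple R} := HB.pack (block J) mJ.
pose mI := isMeasurableFun.Build _ _ _ _ _ (measurable_block I).
pose bI : {mfun T >-> n.-tuple R} := HB.pack (block I) mI.
have mJI : measurable_fun setT (fun w => (block J w, block I w)).
  by apply/measurable_fun_pair; exact: measurable_block.
pose bJI : {mfun T >-> (n.-tuple R * n.-tuple R)%type} :=
  HB.pack (fun w => (block J w, block I w)) (isMeasurableFun.Build _ _ _ _ _ mJI).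
pose nuJ : probability _ R := distribution P bJ.
pose nuI : probability _ R := distribution P bI.
transitivity (\int[pushforward P bJI]_z f z)%E.
  by rewrite ge0_integral_pushforward.
transitivity (\int[(nuJ \x nuI)%E]_z f z)%E.
  apply: eq_measure_integral => A mA _; apply/esym.
  apply: (@product_measure_unique _ _ _ _ R nuJ nuI (pushforward P bJI)) => //.
  move=> B C mB mC; exact: block_indep.
rewrite fubini_tonelli1 //.
rewrite ge0_integral_pushforward //=.
- apply: eq_integral => w _; rewrite /= /fubini_F ge0_integral_pushforward //=.
    exact: measurable_block.
  exact: (measurableT_comp mf (pair1_measurable (block J w))).
- exact: measurable_block.
- exact: measurable_fun_fubini_tonelli_F.
- by move=> y _; exact: integral_ge0.
Qed.

End BlockIndependence.

(** * Measurability, squared norms and expectations of non-negative functions *)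

Lemma measurable_sum_cond d (T : measurableType d) (R : realType) (I : Type)
    (r : seq I) (Q : pred I) (h : I -> T -> R) :
  (forall i, measurable_fun setT (h i)) ->
  measurable_fun setT (fun w => \sum_(i <- r | Q i) h i w).
Proof.
by move=> mh; under eq_fun do rewrite -big_filter; exact: measurable_sum.
Qed.

Definition nsq (R : realType) (m : nat) (v : 'I_m -> R) : R := \sum_c v c ^+ 2.

Lemma nsq_ge0 (R : realType) m (v : 'I_m -> R) : 0 <= nsq v.
Proof. by apply: sumr_ge0 => c _; exact: sqr_ge0. Qed.

Lemma measurable_nsq d (T : measurableType d) (R : realType) m
    (f : T -> 'I_m -> R) : (forall c, measurable_fun setT (fun w => f w c)) ->
  measurable_fun setT (fun w => nsq (f w)).
Proof.
by move=> mf; apply: measurable_sum => c; exact: measurable_funX.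
Qed.

Ltac meas :=
  repeat match goal with
    | |- measurable_fun _ _ => solve [trivial]
    | |- measurable_fun _ (fun=> ?c) => exact: measurable_cst
    | |- measurable_fun _ (fun w => (@?f w)%:E) => apply/measurable_EFinP
    | |- measurable_fun _ (EFin \o _) => apply/measurable_EFinP
    | |- measurable_fun _ (fun w => @?f w + - @?g w) => apply: measurable_funB
    | |- measurable_fun _ (fun w => @?f w + @?g w) => apply: measurable_funD
    | |- measurable_fun _ (fun w => @?f w * @?g w) => apply: measurable_funM
    | |- measurable_fun _ (fun w => @?f w ^+ _) => apply: measurable_funX
    | |- measurable_fun _ (fun w => \sum_(i <- _) _) =>
        apply: measurable_sum => ?
    | |- measurable_fun _ (fun w => \sum_(i <- _ | _) _) =>
        apply: measurable_sum_cond => ?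
    | |- measurable_fun _ (fun w => nsq _) => apply: measurable_nsq => ?
    | |- measurable_fun _ (fun w => tnth w _) => exact: measurable_tnth
  end.

Ltac nonneg :=
  repeat match goal with
    | |- is_true (0 <= _)%R => solve [trivial]
    | H : is_true (0 < ?x)%R |- is_true (0 <= ?x)%R => exact: (ltW H)
    | |- is_true (0 <= _ + _)%R => apply: addr_ge0
    | |- is_true (0 <= _ ^+ 2)%R => exact: sqr_ge0
    | |- is_true (0 <= _ ^+ _)%R => apply: exprn_ge0
    | |- is_true (0 <= _ * _)%R => apply: mulr_ge0
    | |- is_true (0 <= \sum_(i <- _ | _) _)%R => apply: sumr_ge0 => ? _
    | |- is_true (0 <= _ `^ _)%R => exact: powR_ge0
    | |- is_true (0 <= `|_|)%R => exact: normr_ge0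
    | |- is_true (0 <= _%:R)%R => exact: ler0n
    | |- is_true (0 <= nsq _)%R => exact: nsq_ge0
    | |- is_true (0 <= _^-1)%R => rewrite invr_ge0
  end.

Ltac side := intros; first [done | solve [meas] | solve [nonneg]].

Lemma eq_ler (R : realType) (x y : R) : x = y -> x <= y.
Proof. by move=> ->. Qed.

Section Expectation.
Context d (T : measurableType d) (R : realType) (P : probability T R).
Implicit Types f g h : T -> R.

(** Values stay in the extended reals: for non-negative measurable functions, additivity and
    monotonicity then need no integrability, and finiteness is recovered only where it matters. *)
Definition Ex f : \bar R := (\int[P]_w (f w)%:E)%E.

Lemma Ex_ge0 f : (forall w, 0 <= f w) -> (0 <= Ex f)%E.
Proof. by move=> f0; apply: integral_ge0 => w _; rewrite lee_fin. Qed.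

Lemma eq_Ex f g : (forall w, f w = g w) -> Ex f = Ex g.
Proof. by move=> fg; apply: eq_integral => w _; rewrite fg. Qed.

Lemma le_Ex f g : measurable_fun setT f -> measurable_fun setT g ->
  (forall w, 0 <= f w) -> (forall w, f w <= g w) -> (Ex f <= Ex g)%E.
Proof.
move=> mf mg f0 fg; apply: ge0_le_integral => //; try exact/measurable_EFinP.
- by move=> w _; rewrite lee_fin.
- by move=> w _; rewrite lee_fin.
Qed.

Lemma Ex_cst (c : R) : Ex (fun=> c) = c%:E.
Proof. by rewrite /Ex integral_cst //= probability_setT mule1. Qed.

Lemma ExD f g : measurable_fun setT f -> measurable_fun setT g ->
  (forall w, 0 <= f w) -> (forall w, 0 <= g w) ->
  (Ex (fun w => f w + g w)%R = Ex f + Ex g)%E.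
Proof.
move=> mf mg f0 g0; rewrite /Ex -ge0_integralD //; try exact/measurable_EFinP.
all: by move=> w _; rewrite lee_fin.
Qed.

Lemma ExZ (c : R) f : measurable_fun setT f -> 0 <= c -> (forall w, 0 <= f w) ->
  (Ex (fun w => c * f w)%R = c%:E * Ex f)%E.
Proof.
move=> mf c0 f0; rewrite /Ex -ge0_integralZl //; try exact/measurable_EFinP.
by move=> w _; rewrite lee_fin.
Qed.

Lemma Ex_sum (I : Type) (r : seq I) (Q : pred I) (f : I -> T -> R) :
  (forall i, measurable_fun setT (f i)) -> (forall i w, 0 <= f i w) ->
  (Ex (fun w => \sum_(i <- r | Q i) f i w)%R = \sum_(i <- r | Q i) Ex (f i))%E.
Proof.
move=> mf f0; rewrite -big_filter.
under eq_Ex do rewrite -big_filter.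
rewrite /Ex -ge0_integral_sum //.
- by apply: eq_integral => w _; rewrite sumEFin.
- by move=> i; exact/measurable_EFinP.
- by move=> i w _; rewrite lee_fin.
Qed.

Lemma Ex_leD f g h (a b : R) : measurable_fun setT f ->
  measurable_fun setT g -> measurable_fun setT h ->
  (forall w, 0 <= f w) -> (forall w, 0 <= g w) -> (forall w, 0 <= h w) ->
  (forall w, f w <= g w + h w) -> (Ex g <= a%:E)%E -> (Ex h <= b%:E)%E ->
  (Ex f <= (a + b)%:E)%E.
Proof.
move=> mf mg mh f0 g0 h0 fgh ga hb.
apply: (@le_trans _ _ (Ex (fun w => g w + h w))); first by apply: le_Ex => //; meas.
by rewrite ExD // EFinD leeD.
Qed.

Lemma Ex_leZ (c a : R) f g : measurable_fun setT f -> measurable_fun setT g ->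
  0 <= c -> (forall w, 0 <= f w) -> (forall w, 0 <= g w) ->
  (forall w, f w <= c * g w) -> (Ex g <= a%:E)%E -> (Ex f <= (c * a)%:E)%E.
Proof.
move=> mf mg c0 f0 g0 fg ga.
apply: (@le_trans _ _ (Ex (fun w => c * g w))); first by apply: le_Ex => //; meas.
by rewrite ExZ // EFinM lee_wpmul2l // lee_fin.
Qed.

Lemma Ex_le_sum (I : finType) f (g : I -> T -> R) (b : I -> R) :
  measurable_fun setT f -> (forall i, measurable_fun setT (g i)) ->
  (forall w, 0 <= f w) -> (forall i w, 0 <= g i w) ->
  (forall w, f w <= \sum_i g i w) -> (forall i, Ex (g i) <= (b i)%:E)%E ->
  (Ex f <= (\sum_i b i)%:E)%E.
Proof.
move=> mf mg f0 g0 fg gb.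
apply: (@le_trans _ _ (Ex (fun w => \sum_i g i w))).
  by apply: le_Ex => //; meas.
by rewrite Ex_sum // -sumEFin; apply: lee_sum => i _.
Qed.

Lemma Ex_fineK f g (a : R) : measurable_fun setT f -> measurable_fun setT g ->
  (forall w, 0 <= f w) -> (forall w, f w <= g w) -> (Ex g <= a%:E)%E ->
  ((fine (Ex f))%:E = Ex f) /\ (0 <= fine (Ex f) <= a).
Proof.
move=> mf mg f0 fg ga.
have fa : (Ex f <= a%:E)%E by apply: le_trans ga; exact: le_Ex.
have E : (fine (Ex f))%:E = Ex f.
  by rewrite fineK // ge0_fin_numE ?Ex_ge0 // (le_lt_trans fa) // ltry.
by split=> //; rewrite -!lee_fin E fa Ex_ge0.
Qed.

(** The signed term [l] drops out because it is centered. Integrability of [f] is not assumed: it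
    follows from [f >= 0] and the domination by the right-hand side. *)
Lemma Ex_le_centered f l h (a b : R) : measurable_fun setT f ->
  P.-integrable setT (EFin \o l) -> measurable_fun setT h ->
  (forall w, 0 <= f w) -> (forall w, 0 <= h w) ->
  (\int[P]_w (l w)%:E = 0)%E -> (Ex h <= b%:E)%E ->
  (forall w, f w <= a + l w + h w) -> (Ex f <= (a + b)%:E)%E.
Proof.
move=> mf il mh f0 h0 l0 hb flh.
have ih : P.-integrable setT (EFin \o h).
  apply/integrableP; split; first exact/measurable_EFinP.
  under eq_integral do rewrite /= ger0_norm //.
  by rewrite (le_lt_trans hb) // ltry.
have ia : P.-integrable setT (cst a%:E).
  by apply: finite_measure_integrable_cst.
have ial : P.-integrable setT (cst a%:E \+ (EFin \o l))%E by exact: integrableD.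
have ig : P.-integrable setT ((cst a%:E \+ (EFin \o l)) \+ (EFin \o h))%E.
  exact: integrableD.
have fg w : ((f w)%:E <= ((cst a%:E \+ (EFin \o l)) \+ (EFin \o h)) w)%E.
  by rewrite /= -!EFinD lee_fin.
have if_ : P.-integrable setT (EFin \o f).
  apply: le_integrable ig => //; first exact/measurable_EFinP.
  move=> w _; have fw0 : (0 <= (f w)%:E)%E by rewrite lee_fin.
  have gw0 := le_trans fw0 (fg w).
  by rewrite (gee0_abs fw0) (gee0_abs gw0); exact: fg.
apply: (@le_trans _ _ (\int[P]_w ((cst a%:E \+ (EFin \o l)) \+ (EFin \o h)) w))%E.
  by apply: le_integral => // w _; exact: fg.
rewrite integralD // integralD //= l0 adde0 integral_cst //= probability_setT mule1.
by rewrite EFinD leeD2l.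
Qed.

End Expectation.

(** * Elementary inequalities between integer powers *)

Section PowerStep.
Context {R : realType}.
Implicit Types a c d x y V : R.

(** The recursion records one multiplication by [a + c + d] in [pow_step_le]: 6 for the previous
    remainder, 4 + 2 for the terms in [c ^+ 2] and [c * d], and 1 for the new term in [d]. *)
Fixpoint stepC (k : nat) : R :=
  if k is l.+1 then 6 * stepC l + 6 * l.+1%:R + 1 else 1.

Lemma stepC_gt0 k : 0 < stepC k.
Proof. by elim: k => //= k IH; have := ler0n R k.+1; lra. Qed.

Lemma mixed_pow_le x y i j : 0 <= x -> 0 <= y ->
  x ^+ i * y ^+ j.+1 <= x ^+ (i + j) * y + y ^+ (i + j).+1.
Proof.
move=> x0 y0; have [xy|yx] := leP x y.
  apply: (@le_trans _ _ (y ^+ (i + j).+1)); last first.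
    by rewrite lerDr mulr_ge0 ?exprn_ge0.
  by rewrite -addnS exprD ler_wpM2r ?exprn_ge0 // lerXn2r ?nnegrE.
apply: (@le_trans _ _ (x ^+ (i + j) * y)); last by rewrite lerDl exprn_ge0.
rewrite exprD exprSr -mulrA ler_wpM2l ?exprn_ge0 // mulrC mulrC ler_wpM2r //.
by rewrite lerXn2r ?nnegrE // ltW.
Qed.

(** Meant for [a = |s|^2], [c = 2 <s, x>] and [d = |x|^2], where [a + c + d = |s + x|^2]. The term
    linear in [c] is kept exactly, because it will vanish in expectation; the Cauchy-Schwarz
    condition on [c ^+ 2] lets the remainder contain no [c]. *)
Lemma pow_step_le k a c d : 0 <= a -> 0 <= d -> c ^+ 2 <= 4 * a * d ->
  (a + c + d) ^+ k.+1 <=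
  a ^+ k.+1 + k.+1%:R * a ^+ k * c + stepC k * (a ^+ k * d + d ^+ k.+1).
Proof.
move=> a0 d0 cad.
have cle : `|c| <= a + d.
  rewrite -(@ler_pXn2r _ 2) ?nnegrE ?addr_ge0 // real_normK ?num_real //.
  by apply: (le_trans cad); have := sqr_ge0 (a - d); nra.
have := cle; rewrite ler_norml => /andP[c1 c2].
elim: k => [|k IH]; first by rewrite /= !expr1 !expr0 !mul1r; lra.
set A := a ^+ k; set D := d ^+ k.
have A0 : 0 <= A by exact: exprn_ge0.
have D0 : 0 <= D by exact: exprn_ge0.
have G0 := stepC_gt0 k.
set G := stepC k in IH G0 *.
set K : R := k.+1%:R.
have K0 : 0 <= K by exact: ler0n.
have EK : k.+2%:R = K + 1 :> R by rewrite [in LHS]mulrS addrC.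
have m1 : A * d ^+ 2 <= A * a * d + D * d * d.
  have := @mixed_pow_le a d k 1 a0 d0.
  by rewrite addn1 !exprSr !expr0 !mul1r -/A -/D; lra.
have m2 : a * (D * d) <= A * a * d + D * d * d.
  have := @mixed_pow_le a d 1 k a0 d0.
  by rewrite add1n !exprSr !expr0 !mul1r -/A -/D; lra.
rewrite exprS; apply: le_trans (ler_wpM2l _ IH) _; first lra.
rewrite [stepC _]/= -/G EK !exprSr -/A -/D -/K.
set B := A * a * d + D * d * d in m1 m2 *.
have B0 : 0 <= B by rewrite addr_ge0 ?mulr_ge0.
set E := A * d + D * d.
have E0 : 0 <= E by rewrite addr_ge0 ?mulr_ge0.
have h1 : (a + c + d) * E <= 6 * B.
  apply: (@le_trans _ _ (2 * (a + d) * E)); first by rewrite ler_wpM2r //; lra.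
  by rewrite /E; rewrite /B in m1 m2 *; have := mulr_ge0 (mulr_ge0 D0 d0) d0;
     have := mulr_ge0 (mulr_ge0 A0 a0) d0; lra.
have h2 : A * c ^+ 2 <= 4 * B.
  apply: (@le_trans _ _ (A * (4 * a * d))); first by rewrite ler_wpM2l.
  by rewrite /B; have := mulr_ge0 (mulr_ge0 D0 d0) d0; lra.
have h3 : A * (c * d) <= 2 * B.
  apply: (@le_trans _ _ (A * ((a + d) * d))).
    by rewrite ler_wpM2l // ler_wpM2r.
  by rewrite /B in m1 *; have := mulr_ge0 (mulr_ge0 D0 d0) d0; lra.
have h4 : d * (A * a) <= B.
  by rewrite /B; have := mulr_ge0 (mulr_ge0 D0 d0) d0; lra.
have h1' := ler_wpM2l (ltW G0) h1.
have h2' := ler_wpM2l K0 h2.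
have h3' := ler_wpM2l K0 h3.
have -> : (a + c + d) * (A * a + K * A * c + G * E) =
  A * a * a + (K + 1) * (A * a) * c + d * (A * a) + K * (A * c ^+ 2) +
  K * (A * (c * d)) + G * ((a + c + d) * E) by ring.
by lra.
Qed.

(** A substitute for Young's inequality without fractional exponents: an intermediate moment is
    traded for the lowest and the highest one. *)
Lemma interp_pow_le V x k : 0 <= V -> 0 <= x ->
  V * x ^+ k.+1 <= V ^+ k.+1 * x + x ^+ k.+2.
Proof.
move=> V0 x0.
by have := @mixed_pow_le V x 1 k V0 x0; rewrite add1n expr1.
Qed.

(** A convex power lies above its tangent at [y]; averaged with [y] the mean, this is Jensen's
    inequality. *)
Lemma tangent_pow_le x y k : 0 <= x -> 0 <= y ->
  y ^+ k.+1 + k.+1%:R * y ^+ k * (x - y) <= x ^+ k.+1.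
Proof.
move=> x0 y0; elim: k => [|k IH]; first by rewrite !expr1 expr0; lra.
rewrite [in leRHS]exprS; apply: le_trans (ler_wpM2l x0 IH).
have -> : k.+2%:R = k.+1%:R + 1 :> R by rewrite [in LHS]mulrS addrC.
rewrite -subr_ge0.
have -> : x * (y ^+ k.+1 + k.+1%:R * y ^+ k * (x - y)) -
    (y ^+ k.+2 + (k.+1%:R + 1) * y ^+ k.+1 * (x - y)) =
    k.+1%:R * y ^+ k * (x - y) ^+ 2 by rewrite !exprSr; ring.
by rewrite mulr_ge0 ?sqr_ge0 // mulr_ge0 ?exprn_ge0 // ler0n.
Qed.

End PowerStep.

(** * Rosenthal's inequality *)

Lemma finset_ind_card (I : finType) (Q : {set I} -> Prop) :
  Q finset.set0 -> (forall i (J : {set I}), i \notin J -> Q J -> Q (i |: J)%SET) ->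
  forall J, Q J.
Proof.
move=> Q0 QU J; elim: {J}#|J| {-2}J (erefl #|J|) => [|k IH] J.
  by move/eqP; rewrite cards_eq0 => /eqP ->.
move=> cJ; have /card_gt0P[i iJ] : (0 < #|J|)%N by rewrite cJ.
rewrite -(finset.setD1K iJ); apply: QU; first by rewrite !inE eqxx.
by apply: IH; move: cJ; rewrite (cardsD1 i) iJ => -[].
Qed.

Section Rosenthal.
Context d (T : measurableType d) (R : realType) (P : probability T R).
Context (n : nat) (X : 'I_n -> {RV P >-> R}).
Hypothesis indep : mutually_independent X.

(** The 2 appears because the intermediate moments are themselves bounded by both extreme terms; the
    1 stands for the top moments of the summands. *)
Fixpoint rosC (k : nat) : R :=
  if k is l.+1 then stepC l.+1 * (2 * rosC l + 1) else 1.

Lemma rosC_gt0 k : 0 < rosC k.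
Proof.
elim: k => //= k IH; have := @stepC_gt0 R k; rewrite /= => s0.
by rewrite mulr_gt0 //; have := ler0n R k.+1; lra.
Qed.

Let nsq0 m (v : 'I_m -> R) : 0 <= nsq v := nsq_ge0 v.
#[local] Hint Resolve nsq0 : core.

Lemma cauchy_nsq m (u v : 'I_m -> R) :
  (\sum_c u c * v c) ^+ 2 <= nsq u * nsq v.
Proof.
have expand a b : nsq (fun c => a * v c - b * u c) =
    a ^+ 2 * nsq v - (2 * a * b) * (\sum_c u c * v c) + b ^+ 2 * nsq u.
  rewrite /nsq !mulr_sumr -sumrB -big_split /=.
  by apply: eq_bigr => c _; ring.
set D := \sum_c u c * v c in expand *.
have key : 0 <= nsq u * (nsq u * nsq v - D ^+ 2).
  by have := nsq_ge0 (fun c => nsq u * v c - D * u c); rewrite expand; lra.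
have [u0|u0] := eqVneq (nsq u) 0; last first.
  by rewrite -subr_ge0; rewrite pmulr_rge0 // lt0r u0 nsq_ge0 in key.
have uc c : u c = 0.
  apply/eqP; rewrite -sqrf_eq0; move/eqP: u0; rewrite /nsq psumr_eq0.
    by move/allP => /(_ c); rewrite mem_index_enum => /(_ isT).
  by move=> i _; exact: sqr_ge0.
by rewrite /D big1 ?expr0n ?mulr_ge0 // => c _; rewrite uc mul0r.
Qed.

Lemma nsq_step m k (s x : 'I_m -> R) :
  nsq (fun c => s c + x c) ^+ k.+1 <=
  nsq s ^+ k.+1 + (\sum_c k.+1%:R * nsq s ^+ k * 2 * s c * x c)
  + stepC k * (nsq s ^+ k * nsq x + nsq x ^+ k.+1).
Proof.
have -> : nsq (fun c => s c + x c) =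
    nsq s + 2 * (\sum_c s c * x c) + nsq x.
  rewrite /nsq mulr_sumr -!big_split /=; apply: eq_bigr => c _.
  by rewrite sqrrD -mulr_natl; ring.
apply: le_trans (pow_step_le k (nsq_ge0 s) (nsq_ge0 x) _) _.
  rewrite exprMn -mulrA; have := cauchy_nsq s x.
  by move=> h; rewrite (_ : 2 ^+ 2 = 4) ?ler_wpM2l //; ring.
rewrite (_ : \sum_c k.+1%:R * _ * _ * _ * _ =
  k.+1%:R * nsq s ^+ k * (2 * \sum_c s c * x c)) //.
by rewrite !mulr_sumr; apply: eq_bigr => c _; ring.
Qed.

Context (m : nat) (g : 'I_n -> 'I_m -> R -> R).
Hypothesis mg : forall i c, measurable_fun setT (g i c).
Hypothesis g_centered : forall i c, (\int[P]_w (g i c (X i w))%:E = 0)%E.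

Let x i w c := g i c (X i w).
Let S (J : {set 'I_n}) w c := \sum_(i in J) x i w c.
Let e i k : R := fine (Ex P (fun w => (nsq (x i w) ^+ k)%R)).

Let mx i c : measurable_fun setT (fun w => x i w c).
Proof. exact: (measurableT_comp (mg i c)). Qed.

Let mnx i k : measurable_fun setT (fun w => nsq (x i w) ^+ k).
Proof. by rewrite /nsq; meas. Qed.

Let mS J c : measurable_fun setT (fun w => S J w c).
Proof. by rewrite /S; meas; exact: mx. Qed.

Let mnS J k : measurable_fun setT (fun w => nsq (S J w) ^+ k).
Proof. by rewrite /nsq; meas. Qed.

#[local] Hint Resolve mx mnx mS mnS : core.

Lemma nsq_moment_le i k l : (Ex P (fun w => (nsq (x i w) ^+ k)%R) < +oo)%E ->
  (l <= k)%N -> (Ex P (fun w => (nsq (x i w) ^+ l)%R) < +oo)%E.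
Proof.
move=> fk lk.
apply: (@le_lt_trans _ _ (Ex P (fun w => 1 + nsq (x i w) ^+ k)%R)).
  apply: le_Ex => //; try by meas.
  - by move=> w; rewrite exprn_ge0 ?nsq_ge0.
  - move=> w; have v0 := nsq_ge0 (x i w).
    have [v1|/ltW v1] := leP (nsq (x i w)) 1.
      by rewrite (@le_trans _ _ 1) ?exprn_ile1 // lerDl exprn_ge0.
    by rewrite (@le_trans _ _ (nsq (x i w) ^+ k)) ?ler_weXn2l // lerDr.
rewrite ExD //; try by meas.
- by rewrite Ex_cst lte_add_pinfty // ltry.
- by move=> w; rewrite exprn_ge0 ?nsq_ge0.
Qed.

Lemma linear_centered i (a : 'I_m -> R) :
  (Ex P (fun w => (nsq (x i w) ^+ 1)%R) < +oo)%E ->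
  P.-integrable setT (EFin \o (fun w => \sum_c a c * x i w c)) /\
  (\int[P]_w (\sum_c a c * x i w c)%:E = 0)%E.
Proof.
move=> fin.
have ix c : P.-integrable setT (EFin \o (fun w => x i w c)).
  apply/integrableP; split; first exact/measurable_EFinP.
  apply: (@le_lt_trans _ _ (Ex P (fun w => 1 + nsq (x i w) ^+ 1))).
    apply: ge0_le_integral => //.
    - by apply/measurable_EFinP/measurableT_comp.
    - by apply/measurable_EFinP; meas.
    - move=> w _; rewrite lee_fin expr1.
      apply: (@le_trans _ _ (1 + x i w c ^+ 2)).
        rewrite -real_normK ?num_real //.
        by have := sqr_ge0 (`|x i w c| - 1); nra.
      rewrite lerD2l /nsq (bigD1 c) //= lerDl.
      by apply: sumr_ge0 => c' _; exact: sqr_ge0.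
  rewrite ExD; try by side.
  by rewrite Ex_cst lte_add_pinfty // ltry.
rewrite /index_enum; elim: (Finite.enum _) => [|c r [i1 i2]].
  split.
    rewrite (_ : _ \o _ = cst 0%E); first exact: finite_measure_integrable_cst.
    by apply/funext => w /=; rewrite big_nil.
  by under eq_integral do rewrite big_nil; rewrite integral0.
have iZ : P.-integrable setT (fun w => (a c)%:E * (x i w c)%:E)%E.
  exact: (integrableZl measurableT (a c) (ix c)).
have E w : (\sum_(j <- c :: r) a j * x i w j)%:E =
    ((a c)%:E * (x i w c)%:E + (\sum_(j <- r) a j * x i w j)%:E)%E.
  by rewrite big_cons EFinD EFinM.
split.
  rewrite (_ : _ \o _ = fun w => ((a c)%:E * (x i w c)%:E
      + (\sum_(j <- r) a j * x i w j)%:E)%E); first exact: integrableD.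
  by apply/funext => w; exact: E.
under eq_integral do rewrite E.
rewrite integralD //.
transitivity ((a c)%:E * 0 + 0)%E; last by rewrite mule0 adde0.
congr (_ + _)%E; last exact: i2.
have h : (\int[P]_w (x i w c)%:E = 0)%E by exact: g_centered.
have := @integralZl _ _ _ P _ measurableT _ (ix c) (a c).
by rewrite [X in _ = (_ * X)%E]h.
Qed.

(** Given the earlier summands, the part of the expansion linear in the new one is centered and
    disappears; the rest factorises by independence. *)
Lemma rosenthal_step (J : {set 'I_n}) i k : i \notin J ->
  (Ex P (fun w => (nsq (x i w) ^+ k.+1)%R) < +oo)%E ->
  (Ex P (fun w => (nsq (S (i |: J)%SET w) ^+ k.+1)%R) <=
   Ex P (fun w => (nsq (S J w) ^+ k.+1)%R) +
   (stepC k)%:E * ((e i 1)%:E * Ex P (fun w => (nsq (S J w) ^+ k)%R)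
                   + (e i k.+1)%:E))%E.
Proof.
move=> iJ fin.
have fe l : (l <= k.+1)%N -> ((e i l)%:E = Ex P (fun w => (nsq (x i w) ^+ l)%R))%E.
  move=> lk; rewrite fineK // ge0_fin_numE; first exact: nsq_moment_le fin lk.
  by apply: Ex_ge0 => w; rewrite exprn_ge0 ?nsq_ge0.
have e0 l : 0 <= e i l.
  by apply: fine_ge0; apply: Ex_ge0 => w; rewrite exprn_ge0 ?nsq_ge0.
pose SJ (y : n.-tuple R) c := \sum_(l in J) g l c (tnth y l).
pose f (z : n.-tuple R * n.-tuple R) : R :=
  nsq (fun c => SJ z.1 c + g i c (tnth z.2 i)) ^+ k.+1.
have mf : measurable_fun setT (EFin \o f).
  rewrite /f /nsq /SJ; meas.
    apply: measurableT_comp => //.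
    by apply: (measurableT_comp (@measurable_tnth _ R n _)).
  apply: measurableT_comp => //.
  by apply: (measurableT_comp (@measurable_tnth _ R n _)).
have -> : Ex P (fun w => (nsq (S (i |: J)%SET w) ^+ k.+1)%R) =
    (\int[P]_w (EFin \o f) (block X J w, block X [set i]%SET w))%E.
  apply: eq_integral => w _ /=; congr (nsq _ ^+ _)%:E; apply/funext => c.
  rewrite /S big_setU1 //= addrC; congr (_ + _).
    by apply: eq_bigr => l lJ; rewrite tnth_block lJ.
  by rewrite tnth_block inE eqxx.
rewrite block_fubini //; last 2 first.
- by move=> l lJ; rewrite inE; apply: contraNneq iJ => <-.
- by move=> z; rewrite lee_fin exprn_ge0 ?nsq_ge0.
pose G w := nsq (S J w) ^+ k.+1 +
  stepC k * (e i 1 * nsq (S J w) ^+ k + e i k.+1).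
have c0 : 0 <= stepC k := ltW (@stepC_gt0 R k).
have -> : (Ex P (fun w => (nsq (S J w) ^+ k.+1)%R) +
   (stepC k)%:E * ((e i 1)%:E * Ex P (fun w => (nsq (S J w) ^+ k)%R)
                   + (e i k.+1)%:E))%E = Ex P G.
  rewrite /G ExD; try by side.
  congr (_ + _)%E; rewrite ExZ; try by side.
  congr (_ * _)%E; rewrite ExD; try by side.
  by rewrite ExZ ?Ex_cst; try by side.
apply: ge0_le_integral => //.
- by move=> w _; apply: integral_ge0 => w' _; rewrite lee_fin exprn_ge0 ?nsq_ge0.
- have mI := measurable_block X [set i]%SET.
  have := @measurable_fun_fubini_tonelli_F _ _ T T R P
    (fun z => (EFin \o f) (block X J z.1, block X [set i]%SET z.2)).
  rewrite /fubini_F /=; apply.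
    apply: (measurableT_comp mf); apply/measurable_fun_pair.
      exact: (measurableT_comp (measurable_block X J)).
    exact: (measurableT_comp mI).
  by move=> z; rewrite lee_fin exprn_ge0 ?nsq_ge0.
- by apply/measurable_EFinP; rewrite /G; meas.
move=> w _; rewrite /G.
have -> : (\int[P]_w' (EFin \o f) (block X J w, block X [set i]%SET w') =
    Ex P (fun w' => (nsq (fun c => S J w c + x i w' c) ^+ k.+1)%R))%E.
  apply: eq_integral => w' _ /=; congr (nsq _ ^+ _)%:E; apply/funext => c.
  rewrite /SJ /S; congr (_ + _).
    by apply: eq_bigr => l lJ; rewrite tnth_block lJ.
  by rewrite tnth_block inE eqxx.
set s := S J w.
apply: (@Ex_le_centered _ _ _ P _
  (fun w' => \sum_c k.+1%:R * nsq s ^+ k * 2 * s c * x i w' c)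
  (fun w' => stepC k * (nsq s ^+ k * nsq (x i w') + nsq (x i w') ^+ k.+1))).
- by rewrite /nsq; meas.
- by have [] := linear_centered (fun c => k.+1%:R * nsq s ^+ k * 2 * s c)
    (nsq_moment_le fin (ltn0Sn k)).
- by meas; rewrite /nsq; meas.
- by move=> w'; rewrite exprn_ge0 ?nsq_ge0.
- by move=> w'; rewrite mulr_ge0 // addr_ge0 ?mulr_ge0 ?exprn_ge0 ?nsq_ge0.
- by have [] := linear_centered (fun c => k.+1%:R * nsq s ^+ k * 2 * s c)
    (nsq_moment_le fin (ltn0Sn k)).
- have m1 : measurable_fun setT (fun w' => nsq (x i w')).
    by have := mnx i 1; under eq_fun do rewrite expr1.
  rewrite ExZ; try by side.
  rewrite EFinM lee_pmul2l ?lte_fin ?stepC_gt0 //.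
  rewrite ExD; try by side.
  rewrite ExZ; try by side.
  have -> : Ex P (fun w' => nsq (x i w')) = Ex P (fun w' => nsq (x i w') ^+ 1).
    by apply: eq_Ex => w'; rewrite expr1.
  by rewrite -fe // -fe // -EFinM -EFinD mulrC.
- by move=> w'; exact: nsq_step.
Qed.

(** Induction on the order and, within it, on the set of summands. A new summand costs its variance
    times the moment of the sum of the next lower even order; summed up, this is the total variance
    times the previous bound, which [interp_pow_le] brings back to the two extreme terms. Vector
    values are needed later for the conditional variance of a chaos. *)
Theorem rosenthal k (J : {set 'I_n}) :
  (forall i, Ex P (fun w => (nsq (x i w) ^+ k.+1)%R) < +oo)%E ->
  (Ex P (fun w => (nsq (S J w) ^+ k.+1)%R) <=
   (rosC k * ((\sum_i e i 1) ^+ k.+1 + \sum_i e i k.+1))%:E)%E.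
Proof.
have e0 i l : 0 <= e i l by apply: fine_ge0; apply: Ex_ge0 => w; nonneg.
set V := \sum_i e i 1.
have V0 : 0 <= V by apply: sumr_ge0.
elim: k J => [|k IH] J fin.
  (* At the lowest order both terms of the bound equal [V], matching the contribution [2 * e i 1] of
     each summand. *)
  rewrite /rosC expr1 mul1r.
  apply: (@le_trans _ _ (\sum_(i in J) (2 * e i 1))%:E); last first.
    rewrite lee_fin -mulr_sumr mulr2n mulrDl !mul1r lerD // /V;
    by rewrite [leRHS](bigID (mem J)) /= lerDl sumr_ge0.
  elim/finset_ind_card: J => [|i J iJ IH].
    rewrite big_set0 (@eq_Ex _ _ _ _ _ (fun=> 0)) ?Ex_cst // => w.
  rewrite /S /nsq big1 ?expr0n // => c _; by rewrite big_set0 expr0n.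
  apply: le_trans (rosenthal_step iJ (fin i)) _.
  rewrite big_setU1 //= addrC EFinD; apply: leeD; first exact: IH.
  rewrite mul1e; under eq_Ex do rewrite expr0.
  by rewrite Ex_cst mule1 -EFinD lee_fin mulr2n mulrDl mul1r.
set U := \sum_i e i k.+2.
set B := rosC k * (V ^+ k.+1 + \sum_i e i k.+1).
have finl i : (Ex P (fun w => (nsq (x i w) ^+ k.+1)%R) < +oo)%E.
  exact: nsq_moment_le (fin i) _.
apply: (@le_trans _ _
    (\sum_(i in J) stepC k.+1 * (e i 1 * B + e i k.+2))%:E); last first.
  rewrite lee_fin; apply: (@le_trans _ _ (stepC k.+1 * (V * B + U))).
    rewrite -mulr_sumr ler_wpM2l ?(ltW (@stepC_gt0 R _)) //.
    rewrite big_split /= -mulr_suml lerD // ?ler_wpM2r //.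
    - by rewrite mulr_ge0 ?(ltW (rosC_gt0 k)) // addr_ge0 ?exprn_ge0 // sumr_ge0.
    - by rewrite /V [leRHS](bigID (mem J)) /= lerDl sumr_ge0.
    - by rewrite /U [leRHS](bigID (mem J)) /= lerDl sumr_ge0.
  rewrite [rosC k.+1]/= -mulrA ler_wpM2l ?(ltW (@stepC_gt0 R k.+1)) //.
  (* Term by term, with [V] held constant: [interp_pow_le] is applied to [nsq (x i w)] under the
     expectation. *)
  have VU : V * \sum_i e i k.+1 <= V ^+ k.+2 + U.
    rewrite [V ^+ k.+2]exprSr {3}/V /U !mulr_sumr -big_split /=.
    apply: ler_sum => i _.
    have fe l : (l <= k.+2)%N -> ((e i l)%:E = Ex P (fun w => (nsq (x i w) ^+ l)%R))%E.
      move=> lk; rewrite fineK // ge0_fin_numE; first exact: nsq_moment_le (fin i) lk.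
      by apply: Ex_ge0 => w; nonneg.
    rewrite -lee_fin EFinM EFinD EFinM !fe //.
    rewrite -!ExZ -?ExD; try by side.
    apply: le_Ex; try by side.
    by move=> w; rewrite expr1; exact: interp_pow_le.
  have V2 : 0 <= V ^+ k.+2 by nonneg.
  have U0 : 0 <= U by apply: sumr_ge0.
  have c0 := ltW (rosC_gt0 k).
  have := ler_wpM2l c0 VU.
  have -> : V * B = rosC k * V ^+ k.+2 + rosC k * (V * \sum_i e i k.+1).
    by rewrite /B !exprS; ring.
  by have := mulr_ge0 c0 V2; have := mulr_ge0 c0 U0; lra.
elim/finset_ind_card: J => [|i J iJ IHJ].
  rewrite big_set0 (@eq_Ex _ _ _ _ _ (fun=> 0)) ?Ex_cst // => w.
  rewrite /S /nsq big1 ?expr0n // => c _; by rewrite big_set0 expr0n.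
apply: le_trans (rosenthal_step iJ (fin i)) _.
rewrite big_setU1 // [X in (_ <= X%:E)%E]addrC [X in (_ <= X)%E]EFinD.
apply: leeD; first exact: IHJ.
rewrite EFinM lee_wpmul2l ?lee_fin ?(ltW (@stepC_gt0 R _)) //.
rewrite EFinD EFinM leeD2r // lee_wpmul2l ?lee_fin //.
exact: IH.
Qed.

End Rosenthal.

(** Such a set is [i |: L] for an arbitrary [L] avoiding both points. *)
Lemma card_sets_separating (I : finType) (i j : I) : i != j ->
  (4 * #|[set J : {set I} | (i \in J) && (j \notin J)]%SET| = 2 ^ #|I|)%N.
Proof.
move=> ij; have ji : j != i by rewrite eq_sym.
have -> : [set J : {set I} | (i \in J) && (j \notin J)]%SET =
    [set (i |: J)%SET | J in powerset (~: [set i; j])%SET]%SET.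
  apply/setP => J; rewrite inE; apply/andP/imsetP => [[iJ jJ]|[L]].
    exists (J :\ i)%SET; last by rewrite finset.setD1K.
    rewrite powersetE; apply/fintype.subsetP => l; rewrite !inE => /andP[li lJ].
    by rewrite negb_or li /=; apply: contraNneq jJ => <-.
  rewrite powersetE => /fintype.subsetP LS ->; rewrite !inE eqxx; split => //.
  rewrite negb_or ji /=; apply/negP => /LS; by rewrite !inE eqxx orbT.
rewrite card_in_imset.
  rewrite card_powerset; have := cardsC [set i; j]%SET.
  by rewrite cards2 ij => <-; rewrite expnD.
move=> J L; rewrite !powersetE => /fintype.subsetP JS /fintype.subsetP LS E.
have iN (Q : {set I}) : {subset Q <= (~: [set i; j])%SET} -> i \notin Q.
  by move=> QS; apply/negP => /QS; rewrite !inE eqxx.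
apply/setP => l; have := congr1 (fun Q : {set I} => l \in Q) E.
rewrite !inE; case: eqP => //= ->.
by rewrite (negbTE (iN _ JS)) (negbTE (iN _ LS)).
Qed.

(** The tangent inequalities at the mean are added; their linear parts cancel. *)
Lemma mean_pow_le (R : realType) (I : finType) (x : I -> R) k :
  (0 < #|I|)%N -> (forall i, 0 <= x i) ->
  (\sum_i x i) ^+ k.+1 <= #|I|%:R ^+ k * \sum_i x i ^+ k.+1.
Proof.
move=> I0 x0; have N0 : 0 < #|I|%:R :> R by rewrite ltr0n.
set N : R := #|I|%:R in N0 *.
set mu := (\sum_i x i) / N.
have mu0 : 0 <= mu by rewrite divr_ge0 ?sumr_ge0 // ltW.
have Emu : \sum_i x i = N * mu by rewrite /mu mulrC divfK // gt_eqF.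
have cN (c : R) : \sum_(i : I) c = N * c.
  by rewrite sumr_const mulr_natl.
have : N * mu ^+ k.+1 <= \sum_i x i ^+ k.+1.
  rewrite -cN; apply: (@le_trans _ _
    (\sum_i (mu ^+ k.+1 + k.+1%:R * mu ^+ k * (x i - mu)))).
    by rewrite big_split /= -mulr_sumr sumrB Emu !cN subrr mulr0 addr0.
  by apply: ler_sum => i _; exact: tangent_pow_le.
move=> h; rewrite Emu exprMn exprSr -mulrA ler_wpM2l //.
by rewrite exprn_ge0 // ltW.
Qed.

(* [k.+1] is the integer part of [p / 2]. *)
Record noise d (T : measurableType d) (R : realType) (P : probability T R)
    (n : nat) (X : 'I_n -> {RV P >-> R}) (p tau : R) (k : nat) : Prop := Noise {
  noise_indep : mutually_independent X;
  noise_p : 2 < p;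
  noise_k : 2 * k.+1%:R <= p < 2 * k.+2%:R;
  noise_centered : forall i, (\int[P]_w (X i w)%:E = 0)%E;
  noise_var : forall i, Ex P (fun w => X i w ^+ 2) = 1%E;
  noise_mom : forall i, Ex P (fun w => `|X i w| `^ p) = tau%:E;
  noise_dim : (0 < n)%N
}.

Lemma sqr_powR (R : realType) (x a : R) : (x ^+ 2) `^ a = `|x| `^ (2 * a).
Proof. by rewrite -real_normK ?num_real // -powR_mulrn ?normr_ge0 // powRrM. Qed.

(* The moments of order [2 * j.+1] of the noise are at most [2 * scaleK ^+ j]; this
   is the scale beyond which the expected noise of a model has to be for the
   truncation argument to work. *)
Definition scaleK (R : realType) (p tau : R) : R := tau `^ ((p / 2 - 1)^-1).

(** * Moments of the noise *)

Section Noise.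
Context d (T : measurableType d) (R : realType) (P : probability T R).
Context (n : nat) (X : 'I_n -> {RV P >-> R}) (p tau : R) (k : nat).
Hypothesis N : noise X p tau k.
Let p2 := noise_p N.
Let kp := noise_k N.
Let var1 := noise_var N.
Let momp := noise_mom N.
Let n0 := noise_dim N.

Let gam := p / 2 - 1.
Local Notation K := (scaleK p tau).

Lemma gam_gt0 : 0 < gam. Proof. by rewrite /gam; have := p2; lra. Qed.

Lemma mX i : measurable_fun setT (fun w => X i w).
Proof. exact: measurable_funP. Qed.
#[local] Hint Resolve mX : core.

Lemma mXp i q : measurable_fun setT (fun w => `|X i w| `^ q).
Proof.
apply: (measurableT_comp (@measurable_powR R q)).
by apply: measurableT_comp.
Qed.
#[local] Hint Resolve mXp : core.

(** Young's inequality with exponent [p / 2] bounds the unit variance by a convex combination of 1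
    and [tau]. *)
Lemma tau_ge1 : 1 <= tau.
Proof.
pose i := Ordinal n0.
have : (Ex P (fun w => (X i w ^+ 2)%R) <=
    ((1 - (gam + 1)^-1) + (gam + 1)^-1 * tau)%:E)%E.
  have g0 := gam_gt0; have g1 : 0 < gam + 1 by lra.
  have h01 : 0 <= 1 - (gam + 1)^-1.
    by rewrite subr_ge0 invf_le1 // lerDr ltW.
  apply: (@Ex_leD _ _ _ _ _ (fun=> 1 - (gam + 1)^-1)
    (fun w => (gam + 1)^-1 * `|X i w| `^ p)); try by side.
  - move=> w; have := @conjugate_powR R (X i w ^+ 2) 1 (gam + 1) ((gam + 1) / gam)
      (sqr_ge0 _) ler01 g1 (divr_gt0 g1 g0).
    rewrite mulr1 powR1 sqr_powR invf_div mul1r [_ / (gam + 1)]mulrC.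
    have -> : 2 * (gam + 1) = p by rewrite /gam; lra.
    have e1 : (gam + 1)^-1 + (gam + 1)^-1 * gam = 1.
      by rewrite -[X in X + _]mulr1 -mulrDr [1 + _]addrC mulVf // gt_eqF.
    by move=> /(_ e1); lra.
  - by rewrite Ex_cst.
  - apply: (@Ex_leZ _ _ _ _ _ _ _ (fun w => `|X i w| `^ p)); try by side.
    by rewrite momp.
rewrite var1 lee_fin => h.
have g1 : 0 < (gam + 1)^-1 by rewrite invr_gt0; have := gam_gt0; lra.
by rewrite -(ler_pM2l g1); lra.
Qed.

Lemma K_ge1 : 1 <= K.
Proof.
apply: (@le_trans _ _ (1 `^ (gam^-1))); first by rewrite powR1.
rewrite ge0_ler_powR ?nnegrE ?tau_ge1 //.
  by rewrite invr_ge0 ltW // gam_gt0.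
by rewrite (le_trans _ tau_ge1).
Qed.

Lemma K_gt0 : 0 < K. Proof. exact: lt_le_trans ltr01 K_ge1. Qed.

Lemma K_powR : K `^ gam = tau.
Proof.
rewrite /scaleK -powRrM mulVf ?gt_eqF ?gam_gt0 // powRr1 //.
exact: le_trans tau_ge1.
Qed.

Lemma k_le_gam : k%:R <= gam.
Proof. by rewrite /gam; have := kp; move=> /andP[]; rewrite -(natr1 k) => h _; lra. Qed.

Lemma gam_le_k1 : gam <= k.+1%:R.
Proof. by rewrite /gam; have := kp; move=> /andP[_]; rewrite -(natr1 k.+1) => h; lra. Qed.

(** With [s = x ^+ 2 / K], the power [s ^+ j] is at most 1 plus [s] to the power [gam], as
    [j <= k <= gam]; since [K] to the power [gam] is [tau], the last term is a [p]-th power divided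
    by [tau]. This pointwise bound replaces Hölder interpolation between the moments 2 and [p]. *)
Lemma even_pow_le (x : R) j : (j <= k)%N ->
  (x ^+ 2) ^+ j.+1 <= K ^+ j * (x ^+ 2 + `|x| `^ p / tau).
Proof.
move=> jk; have K0 := K_gt0.
have tau0 : 0 < tau by exact: lt_le_trans tau_ge1.
set s := x ^+ 2 / K.
have s0 : 0 <= s by rewrite divr_ge0 ?sqr_ge0 // ltW.
have sj : s ^+ j <= 1 + s `^ gam.
  have [s1|/ltW s1] := leP s 1.
    by apply: (@le_trans _ _ 1); rewrite ?exprn_ile1 // lerDl powR_ge0.
  apply: (@le_trans _ _ (s `^ gam)); last by rewrite lerDr.
  rewrite -powR_mulrn // ler_powR // (le_trans _ k_le_gam) // ler_nat //.
have Es : x ^+ 2 = s * K by rewrite /s divfK // gt_eqF.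
have -> : `|x| `^ p / tau = x ^+ 2 * s `^ gam.
  have -> : `|x| `^ p = (x ^+ 2) `^ (1 + gam).
    by rewrite sqr_powR; congr (_ `^ _); rewrite /gam; lra.
  have [->|x0] := eqVneq (x ^+ 2) 0.
    by rewrite powR0 ?mul0r // gt_eqF //; have := gam_gt0; lra.
  rewrite powRD ?x0 ?implybT // powRr1 ?sqr_ge0 // -mulrA; congr (_ * _).
  rewrite -K_powR /s powRM ?sqr_ge0 ?invr_ge0 ?(ltW K0) //; congr (_ * _).
  by rewrite -[in RHS]powR_inv1 ?(ltW K0) // -powRrM mulN1r powRN.
have -> : K ^+ j * (x ^+ 2 + x ^+ 2 * s `^ gam) =
  K ^+ j * x ^+ 2 * (1 + s `^ gam) by ring.
apply: le_trans (ler_wpM2l _ sj); last by rewrite mulr_ge0 ?sqr_ge0 ?exprn_ge0 ?ltW.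
by rewrite exprSr {1}Es exprMn; apply: eq_ler; ring.
Qed.

Lemma even_moment i j : (j <= k)%N ->
  (Ex P (fun w => ((X i w ^+ 2) ^+ j.+1)%R) <= (2 * K ^+ j)%:E)%E.
Proof.
move=> jk; have K0 := ltW K_gt0.
have tau0 : 0 < tau by exact: lt_le_trans tau_ge1.
rewrite mulrC; apply: (@Ex_leZ _ _ _ _ _ _ _
  (fun w => X i w ^+ 2 + `|X i w| `^ p / tau)); try by side.
  by move=> w; exact: even_pow_le.
have -> : (2 = 1 + tau^-1 * tau :> R) by rewrite mulVf ?gt_eqF.
apply: (@Ex_leD _ _ _ _ _ (fun w => X i w ^+ 2)
  (fun w => tau^-1 * `|X i w| `^ p)); try by side.
- by move=> w; rewrite [_ / tau]mulrC.
- by rewrite var1.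
apply: (@Ex_leZ _ _ _ _ _ _ _ (fun w => `|X i w| `^ p)); try by side.
by rewrite momp.
Qed.

Lemma noise_integrable i : P.-integrable setT (EFin \o X i).
Proof.
apply/integrableP; split; first exact/measurable_EFinP.
apply: (@le_lt_trans _ _ (Ex P (fun w => 1 + X i w ^+ 2))).
  apply: ge0_le_integral => //.
  - by apply/measurable_EFinP/measurableT_comp.
  - by apply/measurable_EFinP; meas.
  - move=> w _; rewrite lee_fin -real_normK ?num_real //.
    by have := sqr_ge0 (`|X i w| - 1); nra.
rewrite ExD; try by side.
by rewrite Ex_cst var1 -EFinD ltry.
Qed.

End Noise.

(** * Quadratic forms in the noise *)

Section Chaos.
Context d (T : measurableType d) (R : realType) (P : probability T R).
Context (n : nat) (X : 'I_n -> {RV P >-> R}) (p tau : R) (k : nat).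
Hypothesis N : noise X p tau k.
Local Notation K := (scaleK p tau).
Let nsq0 m (v : 'I_m -> R) : 0 <= nsq v := nsq_ge0 v.
#[local] Hint Resolve mX mXp nsq0 : core.

Lemma linear_moment m (a : 'I_n -> 'I_m -> R) :
  (Ex P (fun w => (nsq (fun c => \sum_i a i c * X i w) ^+ k.+1)%R) <=
   (rosC R k * ((\sum_i nsq (a i)) ^+ k.+1 +
              2 * K ^+ k * \sum_i nsq (a i) ^+ k.+1))%:E)%E.
Proof.
have K0 : 0 < K := K_gt0 N.
have nsqE i y : nsq (fun c => a i c * y) = nsq (a i) * y ^+ 2.
  by rewrite /nsq mulr_suml; apply: eq_bigr => c _; rewrite exprMn.
have mom i j : (j <= k)%N -> (Ex P (fun w => (nsq (fun c => a i c * X i w) ^+ j.+1)%R)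
    <= (nsq (a i) ^+ j.+1 * (2 * K ^+ j))%:E)%E.
  move=> jk; apply: (@Ex_leZ _ _ _ _ _ _ _ (fun w => (X i w ^+ 2) ^+ j.+1));
    try by side.
  - by move=> w; rewrite nsqE exprMn.
  - exact: even_moment N _ _ jk.
have mom1 i : (Ex P (fun w => (nsq (fun c => a i c * X i w) ^+ 1)%R)
    = (nsq (a i))%:E)%E.
  under eq_Ex do rewrite expr1 nsqE.
  by rewrite ExZ; try (by side); rewrite (noise_var N) mule1.
have := @rosenthal _ _ _ _ _ X (noise_indep N) m (fun i c y => a i c * y) _ _ k
  [set: 'I_n]%SET _.
have -> : Ex P (fun w => nsq (fun c => \sum_(i in [set: 'I_n]%SET) a i c * X i w) ^+ k.+1)
  = Ex P (fun w => nsq (fun c => \sum_i a i c * X i w) ^+ k.+1).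
  apply: eq_Ex => w; congr (nsq _ ^+ _); apply/funext => c.
  by apply: eq_bigl => i; rewrite inE.
move=> H; apply: le_trans (H _ _ _) _.
- by move=> i c; apply: measurable_funM => //; exact: measurable_cst.
- move=> i c.
  have := @integralZl _ _ _ P _ measurableT _ (noise_integrable N i) (a i c).
  by rewrite [X in _ = (_ * X)%E](noise_centered N) mule0.
- move=> i; exact: le_lt_trans (mom i k (leqnn k)) (ltry _).
rewrite lee_fin ler_wpM2l ?(ltW (rosC_gt0 R k)) // lerD //.
  by apply: eq_ler; congr (_ ^+ _); apply: eq_bigr => i _; rewrite mom1.
rewrite mulr_sumr; apply: ler_sum => i _; rewrite mulrC -lee_fin fineK ?mom //.
rewrite ge0_fin_numE ?(le_lt_trans (mom i k (leqnn k))) ?ltry //.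
by apply: Ex_ge0 => w; nonneg.
Qed.

Lemma linear_moment1 (a : 'I_n -> R) :
  (Ex P (fun w => (((\sum_i a i * X i w) ^+ 2) ^+ k.+1)%R) <=
   (rosC R k * ((\sum_i a i ^+ 2) ^+ k.+1 +
              2 * K ^+ k * \sum_i (a i ^+ 2) ^+ k.+1))%:E)%E.
Proof.
have := linear_moment (fun i (_ : 'I_1) => a i).
under eq_Ex do rewrite /nsq big_ord1.
have E i : nsq (fun _ : 'I_1 => a i) = a i ^+ 2 by rewrite /nsq big_ord1.
under eq_bigr do rewrite E.
by under [X in _ + _ * X]eq_bigr do rewrite E.
Qed.

Section Block.
Context (B : 'I_n -> 'I_n -> R) (t : R) (I : {set 'I_n}).
Hypothesis Bsupp : forall i j, B i j != 0 -> i \in I /\ j \notin I.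
Hypothesis Brow : forall i, \sum_j B i j ^+ 2 <= 1.
Hypothesis Bcol : forall j, \sum_i B i j ^+ 2 <= 1.
Hypothesis Btot : \sum_i \sum_j B i j ^+ 2 <= t.

(** Given the coordinates outside [I], the form is linear in those of [I], with coefficients
    [V w i]. Rosenthal applied conditionally leaves the squared norm of the vector [V w] and the
    powers of its entries. Both are estimated by Rosenthal again, the first through the columns of
    [B], the second through its rows. Since rows and columns have norm at most 1, powers of their
    squared norms are at most these norms, whose sum is at most [t]. *)
Lemma block_chaos_moment :
  (Ex P (fun w => (((\sum_i (\sum_j B i j * X j w) * X i w) ^+ 2) ^+ k.+1)%R) <=
   (8 * rosC R k ^+ 2 * (t ^+ k.+1 + K ^+ (2 * k) * t))%:E)%E.
Proof.
have K0 : 0 < K := K_gt0 N.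
have K1 : 1 <= K := K_ge1 N.
have C0 : 0 < rosC R k := rosC_gt0 R k.
have t0 : 0 <= t.
  apply: le_trans Btot; apply: sumr_ge0 => i _; apply: sumr_ge0 => j _.
  exact: sqr_ge0.
pose v (y : n.-tuple R) i := \sum_j B i j * tnth y j.
pose f (z : n.-tuple R * n.-tuple R) : R :=
  ((\sum_i v z.1 i * tnth z.2 i) ^+ 2) ^+ k.+1.
have mf : measurable_fun setT (EFin \o f).
  have mt (h : n.-tuple R * n.-tuple R -> n.-tuple R) i :
      measurable_fun setT h -> measurable_fun setT (fun z => tnth (h z) i).
    by move=> mh; exact: (measurableT_comp (@measurable_tnth _ R n i)).
  by rewrite /f /v; meas; apply: mt.
have blockE J w i : tnth (block X J w) i = if i \in J then X i w else 0.
  exact: tnth_block.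
have vE w i : v (block X (~: I)%SET w) i = \sum_j B i j * X j w.
  apply: eq_bigr => j _; rewrite blockE inE.
  case: ifPn => // /negbNE jI; have [->|/Bsupp[_]] := eqVneq (B i j) 0.
    by rewrite !mul0r.
  by rewrite jI.
have v0 y i : i \notin I -> v y i = 0.
  move=> iI; rewrite /v big1 // => j _.
  have [->|/Bsupp[iI' _]] := eqVneq (B i j) 0; first by rewrite mul0r.
  by rewrite iI' in iI.
have -> : Ex P (fun w => ((\sum_i (\sum_j B i j * X j w) * X i w) ^+ 2) ^+ k.+1) =
    (\int[P]_w (EFin \o f) (block X (~: I)%SET w, block X I w))%E.
  apply: eq_integral => w _ /=; congr ((_ ^+ _) ^+ _)%:E; apply: eq_bigr => i _.
  rewrite vE blockE; case: ifPn => // /(v0 (block X (~: I)%SET w)).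
  by rewrite vE => ->; rewrite !mul0r.
rewrite block_fubini //; last 3 first.
- exact: (noise_indep N).
- by move=> i; rewrite inE.
- by move=> z; rewrite lee_fin /f; nonneg.
set V := fun w i => \sum_j B i j * X j w.
have mV i : measurable_fun setT (fun w => V w i) by rewrite /V; meas.
pose G w := rosC R k * (nsq (V w) ^+ k.+1 + 2 * K ^+ k * \sum_i (V w i ^+ 2) ^+ k.+1).
apply: (@le_trans _ _ (Ex P G)).
  apply: ge0_le_integral => //.
  - by move=> w _; apply: integral_ge0 => w' _; rewrite lee_fin /f; nonneg.
  - have mI := measurable_block X I; have mJ := measurable_block X (~: I)%SET.
    have := @measurable_fun_fubini_tonelli_F _ _ T T R P
      (fun z => (EFin \o f) (block X (~: I)%SET z.1, block X I z.2)).
    rewrite /fubini_F /=; apply.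
      apply: (measurableT_comp mf); apply/measurable_fun_pair.
        exact: (measurableT_comp mJ).
      exact: (measurableT_comp mI).
    by move=> z; rewrite lee_fin /f; nonneg.
  - by apply/measurable_EFinP; rewrite /G /nsq; meas.
  move=> w _; apply: le_trans (linear_moment1 (V w)).
  rewrite le_eqVlt; apply/orP; left; apply/eqP; apply: eq_integral => w' _ /=.
  congr ((_ ^+ _) ^+ _)%:E; apply: eq_bigr => i _.
  rewrite vE blockE; case: ifPn => // /(v0 (block X (~: I)%SET w)).
  by rewrite vE /V => ->; rewrite !mul0r.
have rows i : (Ex P (fun w => (V w i ^+ 2) ^+ k.+1)%R <=
    (3 * rosC R k * K ^+ k * \sum_j B i j ^+ 2)%:E)%E.
  apply: le_trans (linear_moment1 (B i)) _; rewrite lee_fin.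
  have r0 : 0 <= \sum_j B i j ^+ 2 by apply: sumr_ge0 => j _; exact: sqr_ge0.
  have Kk : 1 <= K ^+ k by exact: exprn_ege1.
  set r := \sum_j B i j ^+ 2 in r0 *.
  have h1 : r ^+ k.+1 <= r by rewrite exprS ler_piMr // exprn_ile1 // Brow.
  have h2 : \sum_j (B i j ^+ 2) ^+ k.+1 <= r.
    apply: ler_sum => j _; rewrite exprS ler_piMr ?sqr_ge0 // exprn_ile1 ?sqr_ge0 //.
    apply: le_trans (Brow i); rewrite (bigD1 j) //= lerDl.
    by apply: sumr_ge0 => ? _; exact: sqr_ge0.
  have h3 : 2 * K ^+ k * \sum_j (B i j ^+ 2) ^+ k.+1 <= 2 * K ^+ k * r.
    by rewrite ler_wpM2l // mulr_ge0 // exprn_ge0 // ltW.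
  have h4 : r <= K ^+ k * r by rewrite ler_peMl.
  have -> : 3 * rosC R k * K ^+ k * r = rosC R k * (3 * K ^+ k * r) by ring.
  by rewrite ler_wpM2l ?(ltW C0) //; lra.
have cols : (Ex P (fun w => nsq (V w) ^+ k.+1)%R <=
    (rosC R k * (t ^+ k.+1 + 2 * K ^+ k * t))%:E)%E.
  apply: le_trans (linear_moment (fun j i => B i j)) _; rewrite lee_fin.
  have c0 j : 0 <= nsq (B^~ j) by [].
  have h1 : \sum_j nsq (B^~ j) <= t by rewrite /nsq exchange_big.
  have h2 : \sum_j nsq (B^~ j) ^+ k.+1 <= t.
    apply: le_trans h1; apply: ler_sum => j _.
    by rewrite exprS ler_piMr // exprn_ile1 // Bcol.
  rewrite ler_wpM2l ?(ltW C0) // lerD //.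
    by rewrite lerXn2r ?nnegrE // sumr_ge0.
  by rewrite ler_wpM2l // mulr_ge0 // exprn_ge0 // ltW.
apply: (@le_trans _ _ (rosC R k * (rosC R k * (t ^+ k.+1 + 2 * K ^+ k * t)
    + 2 * K ^+ k * \sum_i 3 * rosC R k * K ^+ k * \sum_j B i j ^+ 2))%:E).
  have Kk0 : 0 <= 2 * K ^+ k by rewrite mulr_ge0 // exprn_ge0 // ltW.
  rewrite /G; apply: (@Ex_leZ _ _ _ _ _ _ _ (fun w => nsq (V w) ^+ k.+1 +
     2 * K ^+ k * \sum_i (V w i ^+ 2) ^+ k.+1)) => //.
  - by rewrite /nsq; meas.
  - by rewrite /nsq; meas.
  - by nonneg.
  - by move=> w; nonneg.
  - by move=> w; nonneg.
  apply: (@Ex_leD _ _ _ _ _ (fun w => nsq (V w) ^+ k.+1)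
    (fun w => 2 * K ^+ k * \sum_i (V w i ^+ 2) ^+ k.+1)) => //.
  - by rewrite /nsq; meas.
  - by rewrite /nsq; meas.
  - by meas.
  - by move=> w; nonneg.
  - by move=> w; nonneg.
  - by move=> w; nonneg.
  apply: (@Ex_leZ _ _ _ _ _ _ _ (fun w => \sum_i (V w i ^+ 2) ^+ k.+1)) => //.
  - by meas.
  - by meas.
  - by move=> w; nonneg.
  - by move=> w; nonneg.
  apply: (@Ex_le_sum _ _ _ _ _ _ (fun i w => (V w i ^+ 2) ^+ k.+1)) => //.
  - by meas.
  - by move=> i; meas.
  - by move=> w; nonneg.
  - by move=> i w; nonneg.
rewrite lee_fin -mulr_sumr.
have qt := Btot; set q := \sum_i _ in qt *.
have Kk : 1 <= K ^+ k by exact: exprn_ege1.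
have -> : K ^+ (2 * k) = K ^+ k * K ^+ k by rewrite mul2n -addnn exprD.
set L := K ^+ k in Kk *.
have C2 : 0 <= rosC R k ^+ 2 by exact: sqr_ge0.
have -> : rosC R k * (rosC R k * (t ^+ k.+1 + 2 * L * t) +
    2 * L * (3 * rosC R k * L * q)) =
  rosC R k ^+ 2 * (t ^+ k.+1 + 2 * L * t + 6 * L * L * q) by ring.
rewrite [leRHS](_ : _ = rosC R k ^+ 2 * (8 * (t ^+ k.+1 + L * L * t))); last by ring.
rewrite ler_wpM2l //.
(* As [K >= 1], the term [2 * L * t] from the columns fits under [L * L * t]; with the 6 from the
   rows this gives the 8. *)
have LL : L <= L * L by rewrite ler_peMl // (le_trans ler01).
have LL0 : 0 <= L * L by nra.
have := ler_wpM2r t0 LL; have := ler_wpM2l LL0 qt.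
have : 0 <= t ^+ k.+1 by exact: exprn_ge0.
by lra.
Qed.

End Block.

Section Offdiag.
Context (A : 'I_n -> 'I_n -> R) (t : R).
Hypothesis Arow : forall i, \sum_j A i j ^+ 2 <= 1.
Hypothesis Acol : forall j, \sum_i A i j ^+ 2 <= 1.
Hypothesis Atot : \sum_i \sum_j A i j ^+ 2 <= t.

Definition offdiag w : R := \sum_i \sum_(j | j != i) A i j * X i w * X j w.

Lemma measurable_offdiag : measurable_fun setT offdiag.
Proof. by rewrite /offdiag; meas. Qed.

Let sub (I : {set 'I_n}) i j := if (i \in I) && (j \notin I) then A i j else 0.
Let UI (I : {set 'I_n}) w := \sum_i (\sum_j sub I i j * X j w) * X i w.

(* Each ordered pair i != j is separated by a quarter of all subsets. *)
Lemma offdiag_average w :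
  2 ^+ n * offdiag w = 4 * \sum_(I : {set 'I_n}) UI I w.
Proof.
pose c i j : R := #|[set I : {set 'I_n} | (i \in I) && (j \notin I)]%SET|%:R.
have h i j : \sum_(I : {set 'I_n}) sub I i j * X j w = c i j * (A i j * X j w).
  rewrite /c mulr_natl -sumr_const big_mkcond /= [RHS]big_mkcond /=.
  by apply: eq_bigr => I _; rewrite inE /sub; case: ifP => // _; rewrite mul0r.
have -> : \sum_(I : {set 'I_n}) UI I w =
    \sum_i (\sum_j c i j * (A i j * X j w)) * X i w.
  rewrite /UI exchange_big /=; apply: eq_bigr => i _.
  rewrite -mulr_suml exchange_big /=; congr (_ * _).
  by apply: eq_bigr => j _; exact: h.
rewrite /offdiag [LHS]mulr_sumr [RHS]mulr_sumr; apply: eq_bigr => i _.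
rewrite (bigD1 (P := predT) i) //=.
have -> : c i i = 0.
  rewrite /c (_ : [set I : {set 'I_n} | _]%SET = finset.set0) ?cards0 //.
  by apply/setP => I; rewrite !inE; case: (i \in I).
rewrite mul0r add0r mulr_suml !mulr_sumr; apply: eq_bigr => j ji.
have -> : 2 ^+ n = 4 * c i j :> R.
  by rewrite /c -natrM card_sets_separating 1?eq_sym // card_ord natrX.
by ring.
Qed.

(** Jensen's inequality for the average over all subsets. The factor 4 of that average is raised to
    the order [2 * k.+1], hence [16 ^+ k.+1]. *)
Lemma offdiag_moment :
  (Ex P (fun w => ((offdiag w ^+ 2) ^+ k.+1)%R) <=
   (16 ^+ k.+1 * (8 * rosC R k ^+ 2 * (t ^+ k.+1 + K ^+ (2 * k) * t)))%:E)%E.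
Proof.
set bnd := 8 * _ * _.
have UIm I : (Ex P (fun w => ((UI I w ^+ 2) ^+ k.+1)%R) <= bnd%:E)%E.
  have sub_le i j : sub I i j ^+ 2 <= A i j ^+ 2.
    by rewrite /sub; case: ifP => // _; rewrite expr0n sqr_ge0.
  apply: (@block_chaos_moment (sub I) t I).
  - by move=> i j; rewrite /sub; case: ifP => [/andP[]//|]; rewrite eqxx.
  - by move=> i; apply: le_trans (Arow i); apply: ler_sum.
  - by move=> j; apply: le_trans (Acol j); apply: ler_sum.
  - apply: le_trans Atot; apply: ler_sum => i _; exact: ler_sum.
have N0 : 0 < 2 ^+ n :> R by rewrite exprn_gt0.
have cardS : #|{set 'I_n}| = (2 ^ n)%N by rewrite -cardsT -powersetT card_powerset cardsT card_ord.
have pt w : (offdiag w ^+ 2) ^+ k.+1 <=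
    \sum_(I : {set 'I_n}) (16 ^+ k.+1 / 2 ^+ n) * (UI I w ^+ 2) ^+ k.+1.
  rewrite -mulr_sumr.
  have E : offdiag w = 4 / 2 ^+ n * \sum_(I : {set 'I_n}) UI I w.
    by apply: (mulfI (lt0r_neq0 N0)); rewrite offdiag_average; field; rewrite gt_eqF.
  have h : `|offdiag w| <= 4 / 2 ^+ n * \sum_(I : {set 'I_n}) `|UI I w|.
    rewrite E normrM ger0_norm ?divr_ge0 ?(ltW N0) // ler_wpM2l ?divr_ge0 ?(ltW N0) //.
    exact: ler_norm_sum.
  have := @mean_pow_le R {set 'I_n} (fun I => `|UI I w|) (2 * k).+1.
  rewrite cardS expn_gt0 => /(_ isT (fun=> normr_ge0 _)) hm.
  have -> : (offdiag w ^+ 2) ^+ k.+1 = `|offdiag w| ^+ (2 * k).+2.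
    by rewrite -real_normK ?num_real // -exprM mulnS.
  apply: le_trans (lerXn2r _ _ _ h) _; rewrite ?nnegrE ?mulr_ge0 ?divr_ge0 ?(ltW N0) ?sumr_ge0 //.
  rewrite exprMn; apply: le_trans (ler_wpM2l _ hm) _.
    by rewrite exprn_ge0 // divr_ge0 // ltW.
  rewrite natrX (eq_bigr (fun I => (UI I w ^+ 2) ^+ k.+1)); last first.
    by move=> I _; rewrite -[in RHS]real_normK ?num_real // -exprM mulnS.
  rewrite mulrA ler_wpM2r //; first by nonneg.
  rewrite expr_div_n; apply: eq_ler.
  have -> : (16 : R) ^+ k.+1 = 4 ^+ (2 * k).+2.
    by rewrite (_ : 16 = 4 ^+ 2); [rewrite -exprM mulnS|ring].
  move: N0; set c : R := 2 ^+ n => c0.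
  have c1 : c ^+ (2 * k).+1 != 0 by rewrite expf_neq0 // gt_eqF.
  by rewrite (exprS c (2 * k).+1) invfM -!mulrA mulVf // mulr1.
have := @Ex_le_sum _ _ _ P _ (fun w => (offdiag w ^+ 2) ^+ k.+1)
  (fun I w => (16 ^+ k.+1 / 2 ^+ n) * (UI I w ^+ 2) ^+ k.+1)
  (fun _ => 16 ^+ k.+1 / 2 ^+ n * bnd).
have c0 : 0 <= 16 ^+ k.+1 / 2 ^+ n :> R by rewrite divr_ge0 ?exprn_ge0 // ltW.
have mUI I : measurable_fun setT (UI I) by rewrite /UI; meas.
have -> : \sum_(I : {set 'I_n}) (16 ^+ k.+1 / 2 ^+ n * bnd) = 16 ^+ k.+1 * bnd.
  rewrite sumr_const cardS -[LHS]mulr_natr natrX; field; exact: lt0r_neq0.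
apply.
- by rewrite /offdiag; meas.
- by move=> I; meas.
- by move=> w; nonneg.
- by move=> I w; nonneg.
- exact: pt.
- move=> I; apply: (@Ex_leZ _ _ _ _ _ _ _ (fun w => (UI I w ^+ 2) ^+ k.+1)) => //.
  + by meas.
  + by meas.
  + by move=> w; nonneg.
  + by move=> w; nonneg.
Qed.

End Offdiag.

End Chaos.

(** * Powers with real exponents, and Jensen's inequality *)

Section PowRFacts.
Context {R : realType}.
Implicit Types x y q a b : R.

Lemma powR_le1 x q : 0 <= x <= 1 -> 0 <= q -> x `^ q <= 1.
Proof.
move=> /andP[x0 x1] q0; apply: (@le_trans _ _ (1 `^ q)); last by rewrite powR1.
by rewrite ge0_ler_powR ?nnegrE.
Qed.

Lemma powR_mono_exp x a b : 0 < x <= 1 -> a <= b -> x `^ b <= x `^ a.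
Proof.
move=> /andP[x0 x1] ab; have -> : b = a + (b - a) by lra.
rewrite powRD; last by rewrite (gt_eqF x0) implybT.
by rewrite ler_piMr ?powR_ge0 // powR_le1 ?subr_ge0 // (ltW x0).
Qed.

(** A ratio [z / (x + y)] in the unit interval is at most its power of exponent [q <= 1], and the
    ratios for [z = x] and [z = y] add up to 1. *)
Lemma powR_subadd x y q : 0 <= x -> 0 <= y -> 0 < q <= 1 ->
  (x + y) `^ q <= x `^ q + y `^ q.
Proof.
move=> x0 y0 /andP[q0 q1].
have [s0|s0] := eqVneq (x + y) 0.
  by rewrite s0 powR0 ?gt_eqF // addr_ge0 ?powR_ge0.
have sp : 0 < x + y by rewrite lt0r s0 addr_ge0.
have key z : 0 <= z -> z <= x + y -> z / (x + y) * (x + y) `^ q <= z `^ q.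
  move=> z0 zs; have [->|zn0] := eqVneq z 0; first by rewrite !mul0r powR_ge0.
  have zp : 0 < z by rewrite lt0r zn0.
  have h : 0 < z / (x + y) <= 1 by rewrite divr_gt0 // ler_pdivrMr // mul1r.
  have -> : z `^ q = (z / (x + y)) `^ q * (x + y) `^ q.
    by rewrite -powRM ?divfK ?divr_ge0 // ltW.
  rewrite ler_wpM2r ?powR_ge0 //; have := powR_mono_exp h q1.
  by rewrite powRr1 // divr_ge0 // ltW.
have := lerD (key x x0 _) (key y y0 _).
rewrite -mulrDl -mulrDl divff // mul1r; apply; by rewrite ?lerDl ?lerDr.
Qed.

Lemma powR_sum_subadd (I : finType) (f : I -> R) q :
  (forall i, 0 <= f i) -> 0 < q <= 1 ->
  (\sum_i f i) `^ q <= \sum_i f i `^ q.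
Proof.
move=> f0 /andP[q0 q1]; rewrite /index_enum; elim: (Finite.enum I) => [|i r IH].
  by rewrite !big_nil powR0 // gt_eqF.
rewrite !big_cons; apply: le_trans (powR_subadd _ _ _) _ => //.
- by apply: sumr_ge0.
- by rewrite q0.
- by rewrite lerD2l.
Qed.

(** A Markov inequality for an excess: where [x > y], the non-positive power [q - m] of [x] is at
    most that of [y]. *)
Lemma pos_part_powR_le x y q m : 0 < y -> 0 <= x -> 0 < q <= m%:R ->
  Num.max 0 (x - y) `^ q <= y `^ (q - m%:R) * x ^+ m.
Proof.
move=> y0 x0 /andP[q0 qm].
have [xy|yx] := leP (x - y) 0.
  by rewrite powR0 ?gt_eqF // mulr_ge0 ?powR_ge0 ?exprn_ge0.
have xp : 0 < x by lra.
apply: (@le_trans _ _ (x `^ q)); first by rewrite ge0_ler_powR ?nnegrE //; lra.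
rewrite -powR_mulrn //.
have -> : x `^ q = x `^ (q - m%:R) * x `^ m%:R.
  by rewrite -powRD ?subrK // (gt_eqF xp) implybT.
rewrite ler_wpM2r ?powR_ge0 //.
have -> : q - m%:R = - (m%:R - q) by lra.
rewrite !powRN lef_pV2 ?posrE ?powR_gt0 //.
by rewrite ge0_ler_powR ?nnegrE //; lra.
Qed.

End PowRFacts.

Lemma measurable_pos_powR d (T : measurableType d) (R : realType) (f : T -> R) q :
  measurable_fun setT f -> measurable_fun setT (fun w => Num.max 0 (f w) `^ q).
Proof.
move=> mf; apply: (measurableT_comp (measurable_powR q)).
have -> : (fun w => Num.max 0 (f w)) = f^\+%R by apply/funext => w; rewrite maxC.
exact: measurable_funrpos.
Qed.

Section JensenPow.
Context d (T : measurableType d) (R : realType) (P : probability T R).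

Lemma jensen_pow (f : T -> R) (mu : R) m : measurable_fun setT f ->
  (forall w, 0 <= f w) -> Ex P f = mu%:E ->
  ((mu ^+ m.+1)%:E <= Ex P (fun w => (f w ^+ m.+1)%R))%E.
Proof.
move=> mf f0 Ef.
have mu0 : 0 <= mu by rewrite -lee_fin -Ef Ex_ge0.
have h : (Ex P (fun w => m.+1%:R * mu ^+ m * f w)%R <=
    Ex P (fun w => f w ^+ m.+1 + m%:R * mu ^+ m.+1)%R)%E.
  apply: le_Ex; try by side.
  move=> w; have := @tangent_pow_le R (f w) mu m (f0 w) mu0.
  rewrite -(natr1 m) => h; rewrite -lerBlDr; apply: le_trans h; apply: eq_ler.
  by rewrite !exprSr; ring.
move: h; rewrite ExZ; try by side.
rewrite Ef ExD; try by side.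
rewrite Ex_cst -leeBlDr // -EFinM -EFinB; apply: le_trans; rewrite lee_fin.
by apply: eq_ler; rewrite -(natr1 m) !exprSr; ring.
Qed.

(** As [f] and [mu] are both non-negative, [|f - mu|] is at most the larger of them; this is why
    centering costs 2 at every order. *)
Lemma centered_pow_le (f : T -> R) (mu a : R) m : measurable_fun setT f ->
  (forall w, 0 <= f w) -> Ex P f = mu%:E ->
  (Ex P (fun w => ((f w ^+ 2) ^+ m.+1)%R) <= a%:E)%E ->
  (Ex P (fun w => (((f w - mu) ^+ 2) ^+ m.+1)%R) <= (2 * a)%:E)%E.
Proof.
move=> mf f0 Ef fa; have mu0 : 0 <= mu by rewrite -lee_fin -Ef Ex_ge0.
have E x : (x ^+ 2) ^+ m.+1 = x ^+ (2 * m).+2 :> R by rewrite -exprM mulnS.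
rewrite mulr2n mulrDl mul1r; apply: (@Ex_leD _ _ _ _ _
  (fun w => (f w ^+ 2) ^+ m.+1) (fun=> (mu ^+ 2) ^+ m.+1)); try by side.
  move=> w; clear Ef fa; have fw := f0 w; have [fm|mf'] := leP (f w) mu.
    apply: (@le_trans _ _ ((mu ^+ 2) ^+ m.+1)); last by rewrite lerDr; nonneg.
    by rewrite lerXn2r ?nnegrE ?sqr_ge0 // -(sqrrN (f w - mu)) opprB lerXn2r ?nnegrE; lra.
  apply: (@le_trans _ _ ((f w ^+ 2) ^+ m.+1)); last by rewrite lerDl; nonneg.
  by rewrite lerXn2r ?nnegrE ?sqr_ge0 // lerXn2r ?nnegrE; lra.
rewrite Ex_cst E; apply: le_trans (jensen_pow _ mf f0 Ef) _.
by under eq_Ex do rewrite -E.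
Qed.

End JensenPow.

(** * Truncation of the diagonal part *)

Section Truncation.
Context d (T : measurableType d) (R : realType) (P : probability T R).
Context (n : nat) (X : 'I_n -> {RV P >-> R}) (p tau : R) (k : nat).
Hypothesis N : noise X p tau k.
Local Notation K := (scaleK p tau).
Local Notation gam := (p / 2 - 1).
Let nsq0 m (v : 'I_m -> R) : 0 <= nsq v := nsq_ge0 v.
#[local] Hint Resolve mX mXp nsq0 : core.

Context (e : 'I_n -> R) (t : R).
Hypothesis e01 : forall i, 0 <= e i <= 1.
Hypothesis et : \sum_i e i = t.
Hypothesis Kt : K <= t.

Local Notation kap := ((K / t) `^ gam).

Let t1 : 1 <= t. Proof. exact: le_trans (K_ge1 N) Kt. Qed.
Let t0 : 0 < t. Proof. exact: lt_le_trans ltr01 t1. Qed.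
Let K0 : 0 < K := K_gt0 N.
Let K1 : 1 <= K := K_ge1 N.
Let g0 : 0 < gam := gam_gt0 N.
Let tau0 : 0 < tau. Proof. exact: lt_le_trans ltr01 (tau_ge1 N). Qed.
Let e0 i : 0 <= e i. Proof. by case/andP: (e01 i). Qed.
Let K01 : 0 < K / t <= 1.
Proof. by rewrite divr_gt0 //= ler_pdivrMr // mul1r. Qed.

(** Converts between the two currencies of the proof: a weight times [t] on the left, a deviation
    cost on the right. *)
Lemma tau_kap q : tau * t `^ (q - p / 2) * t = t `^ q * kap.
Proof.
rewrite powRM ?invr_ge0 ?(ltW K0) ?(ltW t0) // (K_powR N).
have -> : t^-1 `^ gam = t `^ (- gam).
  by rewrite -[in LHS]powR_inv1 ?(ltW t0) // -powRrM mulN1r.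
have -> : q - p / 2 = q + - gam + - 1 by lra.
have tn : t != 0 by rewrite gt_eqF.
rewrite !powRD ?tn ?implybT // powR_inv1 ?(ltW t0) //.
by field.
Qed.

(** Rosenthal at an integer order gives the decay [k.+1], which is at least the required decay
    [gam]. *)
Lemma kap_exp : (K / t) ^+ k.+1 <= kap.
Proof.
rewrite -powR_mulrn; last by case/andP: K01 => /ltW.
by rewrite powR_mono_exp // (gam_le_k1 N).
Qed.

(** Below the threshold, powers beyond [p / 2] are paid for by powers of [t]; above it, all powers
    up to [p / 2] are paid for by the [p]-th moment. With the threshold equal to the mean [t], both
    costs are [kap], up to the natural power of [t]. *)
Definition xi i (y : R) : R := if e i * y ^+ 2 <= t then e i * y ^+ 2 else 0.
Definition tl i (y : R) : R := e i * y ^+ 2 - xi i y.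

Let ey0 i y : 0 <= e i * y ^+ 2. Proof. by rewrite mulr_ge0 ?sqr_ge0. Qed.

Lemma xi_ge0 i y : 0 <= xi i y.
Proof. by rewrite /xi; case: ifP. Qed.

Lemma xi_le i y : xi i y <= t.
Proof. by rewrite /xi; case: ifP => // _; exact: ltW. Qed.

Lemma tl_ge0 i y : 0 <= tl i y.
Proof. by rewrite /tl /xi; case: ifP => _; rewrite ?subrr ?subr0. Qed.

Lemma measurable_xi i : measurable_fun setT (xi i).
Proof.
apply: measurable_fun_ifT => //; last by meas.
by apply: measurable_fun_ler => //; meas.
Qed.

Lemma mxiX i : measurable_fun setT (fun w => xi i (X i w)).
Proof. exact: (measurableT_comp (measurable_xi i)). Qed.

Lemma mtlX i : measurable_fun setT (fun w => tl i (X i w)).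
Proof. by apply: measurable_funB; [meas|exact: mxiX]. Qed.
#[local] Hint Resolve xi_ge0 tl_ge0 mxiX mtlX : core.

Lemma e_powR_le i y : (e i * y ^+ 2) `^ (p / 2) <= e i * `|y| `^ p.
Proof.
rewrite powRM ?sqr_ge0 // sqr_powR.
have -> : 2 * (p / 2) = p by lra.
rewrite ler_wpM2r ?powR_ge0 //.
have [->|ei0] := eqVneq (e i) 0; first by rewrite powR0 ?gt_eqF //; have := noise_p N; lra.
rewrite -[leRHS](@powRr1 _ (e i)) // powR_mono_exp ?lt0r ?ei0 ?e01 //.
by have := noise_p N; lra.
Qed.

Lemma tl_powR_le q i y : 0 < q <= p / 2 ->
  tl i y `^ q <= t `^ (q - p / 2) * (e i * `|y| `^ p).
Proof.
move=> /andP[q0 qp]; rewrite /tl /xi; case: ifPn => [_|]; last rewrite -ltNge => h.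
  by rewrite subrr powR0 ?gt_eqF // mulr_ge0 ?powR_ge0 // mulr_ge0 ?powR_ge0.
rewrite subr0; apply: le_trans (ler_wpM2l (powR_ge0 _ _) (e_powR_le i y)).
set x := e i * y ^+ 2 in h *; have xp := lt_trans t0 h.
have -> : x `^ q = x `^ (q - p / 2) * x `^ (p / 2).
  by rewrite -powRD ?subrK // (gt_eqF xp) implybT.
rewrite ler_wpM2r ?powR_ge0 //.
have -> : q - p / 2 = - (p / 2 - q) by lra.
rewrite !powRN lef_pV2 ?posrE ?powR_gt0 //.
by rewrite ge0_ler_powR ?nnegrE ?(ltW h) ?(ltW t0) ?(ltW xp) // subr_ge0.
Qed.

Lemma xi_pow_le i y :
  (xi i y ^+ 2) ^+ k.+1 <= t `^ (k.+1%:R * 2 - p / 2) * (e i * `|y| `^ p).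
Proof.
apply: le_trans (ler_wpM2l (powR_ge0 _ _) (e_powR_le i y)).
have k2 : 0 <= k.+1%:R * 2 - p / 2.
  have := gam_le_k1 N; have : (1 : R) <= k.+1%:R by rewrite ler1n.
  by lra.
have [x0|xn0] := eqVneq (xi i y) 0.
  by rewrite x0 !expr0n mulr_ge0 ?powR_ge0.
have xp : 0 < xi i y by rewrite lt0r xn0 xi_ge0.
have -> : (xi i y ^+ 2) ^+ k.+1 =
    xi i y `^ (k.+1%:R * 2 - p / 2) * xi i y `^ (p / 2).
  rewrite -powRD ?subrK; last by rewrite (gt_eqF xp) implybT.
  by rewrite mulrC powRrM powR_mulrn ?powR_mulrn ?exprn_ge0 // ltW.
apply: ler_pM; rewrite ?powR_ge0 //.
  by rewrite ge0_ler_powR ?nnegrE ?xi_le // ltW.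
have p20 : 0 <= p / 2 by have := noise_p N; lra.
by rewrite ge0_ler_powR ?nnegrE // /xi; case: ifP.
Qed.

Lemma Ex_eXp (c : R) i : 0 <= c ->
  (Ex P (fun w => c * (e i * `|X i w| `^ p))%R <= (c * (e i * tau))%:E)%E.
Proof.
move=> c0; rewrite ExZ; try by side.
by rewrite ExZ; try (by side); rewrite (noise_mom N) -!EFinM.
Qed.

Lemma tl_moment q : 0 < q <= p / 2 ->
  (Ex P (fun w => \sum_i tl i (X i w) `^ q)%R <= (t `^ q * kap)%:E)%E.
Proof.
move=> q01; rewrite -tau_kap.
have -> : tau * t `^ (q - p / 2) * t = \sum_i t `^ (q - p / 2) * (e i * tau).
  by rewrite -mulr_sumr -mulr_suml et; ring.
have mt i : measurable_fun setT (fun w => tl i (X i w) `^ q).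
  exact: (measurableT_comp (measurable_powR q)).
apply: (@Ex_le_sum _ _ _ _ _ _ (fun i w => tl i (X i w) `^ q)); try by side.
move=> i; apply: le_trans (Ex_eXp i (powR_ge0 t (q - p / 2))).
apply: le_Ex; try by side.
by move=> w; exact: tl_powR_le.
Qed.

Definition mu i : R := fine (Ex P (fun w => xi i (X i w))).

Let Ex_eX i : Ex P (fun w => e i * X i w ^+ 2)%R = (e i)%:E.
Proof. by rewrite ExZ; try (by side); rewrite (noise_var N) mule1. Qed.

Lemma muE i : Ex P (fun w => xi i (X i w)) = (mu i)%:E.
Proof.
have [] := @Ex_fineK _ _ _ P (fun w => xi i (X i w)) (fun w => e i * X i w ^+ 2) (e i);
  try by side.
- by move=> w; rewrite /xi; case: ifP.
- by rewrite Ex_eX.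
Qed.

Lemma mu_le i : mu i <= e i.
Proof.
rewrite -lee_fin -muE -Ex_eX; apply: le_Ex; try by side.
by move=> w; rewrite /xi; case: ifP.
Qed.

Lemma sum_mu_le : \sum_i mu i <= t.
Proof. by rewrite -et; apply: ler_sum => i _; exact: mu_le. Qed.

(** The mean lost by truncation is the first moment of the tails, which [tl_moment] controls. Lower
    deviations need this, as truncation moves the center downwards. *)
Lemma sum_mu_ge : t - t * kap <= \sum_i mu i.
Proof.
have h : 0 < (1 : R) <= p / 2 by rewrite ltr01 /=; have := noise_p N; lra.
have := tl_moment h; rewrite powRr1 ?(ltW t0) // => tk.
rewrite lerBlDr -lee_fin -et.
have -> : ((\sum_i e i)%:E = \sum_i Ex P (fun w => e i * X i w ^+ 2)%R)%E.
  by rewrite -sumEFin; apply: eq_bigr => i _.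
have -> : (\sum_i Ex P (fun w => e i * X i w ^+ 2)%R =
    \sum_i ((mu i)%:E + Ex P (fun w => tl i (X i w) `^ 1)%R))%E.
  apply: eq_bigr => i _; rewrite -muE -ExD; try by side.
    by apply: eq_Ex => w; rewrite powRr1 // /tl addrC subrK.
  exact: (measurableT_comp (measurable_powR 1)).
rewrite big_split /= sumEFin EFinD; apply: leeD => //.
rewrite -et in tk; apply: le_trans tk; rewrite Ex_sum // => i.
  exact: (measurableT_comp (measurable_powR 1)).
by move=> w; exact: powR_ge0.
Qed.

(** In [4 ^+ k.+1] one factor 2 pays for centering and one for the bound on the second moments; the
    separate 2 pays for centering the top moments. *)
Definition truncC : R := rosC R k * (4 ^+ k.+1 + 2).

Lemma trunc_moment :
  (Ex P (fun w => (((\sum_i (xi i (X i w) - mu i)) ^+ 2) ^+ k.+1)%R) <=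
   (truncC * ((t ^+ 2) ^+ k.+1 * kap))%:E)%E.
Proof.
have c0 : 0 <= t `^ (k.+1%:R * 2 - p / 2) by exact: powR_ge0.
have E2 : tau * t `^ (k.+1%:R * 2 - p / 2) * t = (t ^+ 2) ^+ k.+1 * kap.
  by rewrite tau_kap mulrC [X in t `^ X]mulrC powRrM !powR_mulrn ?exprn_ge0 ?(ltW t0) // mulrC.
pose b i := t `^ (k.+1%:R * 2 - p / 2) * (e i * tau).
have bs : \sum_i b i = (t ^+ 2) ^+ k.+1 * kap.
  by rewrite -E2 /b -mulr_sumr -mulr_suml et; ring.
have xik i : (Ex P (fun w => ((xi i (X i w) ^+ 2) ^+ k.+1)%R) <= (b i)%:E)%E.
  apply: le_trans (Ex_eXp i c0); apply: le_Ex; try by side.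
  by move=> w; exact: xi_pow_le.
(* [v] bounds the second moments of the truncated terms. If [k] is 0, then [p < 4] and the noise may
   have no fourth moment, so the truncated bound [b] serves; otherwise the fourth moment is at most
   [2 * K]. *)
have [v [v0 xi1 vs]] : exists v : 'I_n -> R, [/\ forall i, 0 <= v i,
    forall i, (Ex P (fun w => ((xi i (X i w) ^+ 2) ^+ 1)%R) <= (v i)%:E)%E &
    (\sum_i v i) ^+ k.+1 <= 2 ^+ k.+1 * ((t ^+ 2) ^+ k.+1 * kap)].
  have [k0|kpos] := posnP k.
    exists b; split.
    - by move=> i; rewrite mulr_ge0 // mulr_ge0 // ltW.
    - by move=> i; have := xik i; rewrite k0.
    - rewrite bs; have a0 : 0 <= (t ^+ 2) ^+ k.+1 * kap.
        by rewrite mulr_ge0 ?powR_ge0 // exprn_ge0 ?sqr_ge0.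
      set a := _ * kap in a0 *; by rewrite k0 !expr1 ler_peMl // ler1n.
  exists (fun i => 2 * K * e i); split.
  - by move=> i; apply: mulr_ge0 => //; apply: mulr_ge0 => //; exact: ltW.
  - move=> i; have h := @even_moment _ _ _ _ _ _ _ _ _ N i 1 kpos.
    rewrite mulrC; apply: (@Ex_leZ _ _ _ _ _ _ _ (fun w => (X i w ^+ 2) ^+ 2)); try by side.
    move=> w; rewrite expr1 /xi; case: ifP => _; last by rewrite expr0n; nonneg.
    rewrite exprMn ler_wpM2r //; first by nonneg.
    by rewrite expr2 ler_piMr //; case/andP: (e01 i).
  - rewrite -mulr_sumr et -mulrA exprMn ler_wpM2l ?exprn_ge0 //.
    have -> : (K * t) ^+ k.+1 = (t ^+ 2) ^+ k.+1 * (K / t) ^+ k.+1.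
      by rewrite -exprMn; congr (_ ^+ _); field; rewrite gt_eqF.
    by rewrite ler_wpM2l ?kap_exp //; nonneg.
have kp0 : 0 <= kap by exact: powR_ge0.
have cent i j a : (Ex P (fun w => ((xi i (X i w) ^+ 2) ^+ j.+1)%R) <= a%:E)%E ->
    (Ex P (fun w => (nsq (fun _ : 'I_1 => xi i (X i w) - mu i) ^+ j.+1)%R) <= (2 * a)%:E)%E.
  move=> h; under eq_Ex do rewrite /nsq big_ord1.
  exact: (centered_pow_le (mxiX i) _ (muE i) h).
have := @rosenthal _ _ _ _ _ X (noise_indep N) 1 (fun i _ y => xi i y - mu i) _ _ k
  [set: 'I_n]%SET _.
have -> : Ex P (fun w => nsq (fun _ : 'I_1 =>
    \sum_(i in [set: 'I_n]%SET) (xi i (X i w) - mu i)) ^+ k.+1)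
  = Ex P (fun w => ((\sum_i (xi i (X i w) - mu i)) ^+ 2) ^+ k.+1).
  apply: eq_Ex => w; rewrite /nsq big_ord1; congr ((_ ^+ _) ^+ _).
  by apply: eq_bigl => i; rewrite inE.
move=> H; apply: le_trans (H _ _ _) _.
- by move=> i _; apply: measurable_funB; [exact: measurable_xi|exact: measurable_cst].
- move=> i _; under eq_integral do rewrite EFinB.
  rewrite integralB_EFin //; first last.
  + exact: finite_measure_integrable_cst.
  + apply/integrableP; split; first exact/measurable_EFinP.
    under eq_integral do rewrite gee0_abs ?lee_fin //.
    by have := muE i; rewrite /Ex => ->; exact: ltry.
  have := muE i; rewrite /Ex => ->.
  by rewrite integral_cst //= probability_setT mule1 subee.
- by move=> i; exact: le_lt_trans (cent i k _ (xik i)) (ltry _).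
have finE i j a : (Ex P (fun w => (nsq (fun _ : 'I_1 => xi i (X i w) - mu i) ^+ j)%R) <= a%:E)%E ->
    0 <= fine (Ex P (fun w => (nsq (fun _ : 'I_1 => xi i (X i w) - mu i) ^+ j)%R)) <= a.
  move=> h; have f0 : (0 <= Ex P (fun w => (nsq (fun _ : 'I_1 => xi i (X i w) - mu i) ^+ j)%R))%E.
    by apply: Ex_ge0 => w; nonneg.
  rewrite fine_ge0 //= -lee_fin fineK // ge0_fin_numE //.
  exact: le_lt_trans h (ltry _).
rewrite lee_fin /truncC -mulrA ler_wpM2l ?(ltW (rosC_gt0 R k)) // mulrDl lerD //.
  apply: (@le_trans _ _ ((2 * \sum_i v i) ^+ k.+1)).
    rewrite lerXn2r ?nnegrE ?mulr_ge0 ?sumr_ge0 //.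
      by move=> i _; case/andP: (finE i 1%N _ (cent i 0%N _ (xi1 i))).
    rewrite mulr_sumr; apply: ler_sum => i _.
    by case/andP: (finE i 1%N _ (cent i 0%N _ (xi1 i))).
  rewrite exprMn; apply: le_trans (ler_wpM2l _ vs) _; first by nonneg.
  have -> : (4 : R) ^+ k.+1 = 2 ^+ k.+1 * 2 ^+ k.+1.
    by rewrite -exprMn; congr (_ ^+ _); ring.
  by rewrite -[leRHS]mulrA.
rewrite -bs mulr_sumr; apply: ler_sum => i _.
by case/andP: (finE i k.+1 _ (cent i k _ (xik i))).
Qed.

End Truncation.

(** * Exact second moments of linear forms *)

Section SecondMoment.
Context d (T : measurableType d) (R : realType) (P : probability T R).
Context (n : nat) (X : 'I_n -> {RV P >-> R}) (p tau : R) (k : nat).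
Hypothesis N : noise X p tau k.
Let nsq0 m (v : 'I_m -> R) : 0 <= nsq v := nsq_ge0 v.
#[local] Hint Resolve mX mXp nsq0 : core.

Lemma affine_square_mean (a b c : R) i : 0 <= c ->
  (\int[P]_w (a + b * X i w + c * X i w ^+ 2)%:E = (a + c)%:E)%E.
Proof.
move=> c0.
have iX := noise_integrable N i.
have iX2 : P.-integrable setT (EFin \o (fun w => X i w ^+ 2)).
  apply/integrableP; split; first by apply/measurable_EFinP; meas.
  under eq_integral do rewrite gee0_abs ?lee_fin ?sqr_ge0 //.
  by have := noise_var N i; rewrite /Ex => ->; exact: ltry.
have ia : P.-integrable setT (cst a%:E) by exact: finite_measure_integrable_cst.
have ibX : P.-integrable setT (fun w => b%:E * (X i w)%:E)%E.
  exact: (integrableZl measurableT b iX).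
have icX : P.-integrable setT (fun w => c%:E * (X i w ^+ 2)%:E)%E.
  exact: (integrableZl measurableT c iX2).
transitivity (\int[P]_w ((cst a%:E \+ (fun w => b%:E * (X i w)%:E))
    \+ (fun w => c%:E * (X i w ^+ 2)%:E)) w)%E; first by [].
rewrite integralD //; last exact: integrableD.
rewrite integralD // integral_cst //= probability_setT mule1.
have -> : (\int[P]_w (b%:E * (X i w)%:E) = 0)%E.
  have := @integralZl _ _ _ P _ measurableT _ iX b.
  by rewrite [X in _ = (_ * X)%E](noise_centered N) mule0.
rewrite adde0.
have -> : (\int[P]_w (c%:E * (X i w ^+ 2)%:E) = c%:E)%E.
  have := @integralZl _ _ _ P _ measurableT _ iX2 c.
  by have := noise_var N i; rewrite /Ex /= => ->; rewrite mule1.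
by rewrite EFinD.
Qed.

(** An equality is required here, since expected noise has to coincide with a trace. When an index
    is added, the cross term is centered given the block [J]. *)
Lemma second_moment_set m (a : 'I_n -> 'I_m -> R) (J : {set 'I_n}) :
  Ex P (fun w => nsq (fun c => \sum_(i in J) a i c * X i w)) =
  (\sum_(i in J) nsq (a i))%:E.
Proof.
elim/finset_ind_card: J => [|i J iJ IH].
  rewrite big_set0 (@eq_Ex _ _ _ _ _ (fun=> 0)) ?Ex_cst // => w.
  rewrite /nsq big1 // => c _; by rewrite big_set0 expr0n.
pose SJ (y : n.-tuple R) c := \sum_(l in J) a l c * tnth y l.
pose f (z : n.-tuple R * n.-tuple R) : R :=
  nsq (fun c => SJ z.1 c + a i c * tnth z.2 i).
have mf : measurable_fun setT (EFin \o f).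
  have mt (h : n.-tuple R * n.-tuple R -> n.-tuple R) l :
      measurable_fun setT h -> measurable_fun setT (fun z => tnth (h z) l).
    by move=> mh; exact: (measurableT_comp (@measurable_tnth _ R n l)).
  by rewrite /f /nsq /SJ; meas; apply: mt.
have -> : Ex P (fun w => nsq (fun c => \sum_(l in (i |: J)%SET) a l c * X l w)) =
    (\int[P]_w (EFin \o f) (block X J w, block X [set i]%SET w))%E.
  apply: eq_integral => w _ /=; congr (nsq _)%:E; apply/funext => c.
  rewrite big_setU1 //= addrC; congr (_ + _).
    by apply: eq_bigr => l lJ; rewrite tnth_block lJ.
  by rewrite tnth_block inE eqxx.
rewrite block_fubini //; last 3 first.
- exact: (noise_indep N).
- by move=> l lJ; rewrite inE; apply: contraNneq iJ => <-.
- by move=> z; rewrite lee_fin nsq_ge0.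
rewrite big_setU1 //= addrC EFinD -IH.
have -> : ((nsq (a i))%:E = Ex P (fun=> nsq (a i)))%E by rewrite Ex_cst.
rewrite -ExD; try by side.
apply: eq_integral => w _.
set s := fun c => \sum_(l in J) a l c * X l w.
rewrite -(affine_square_mean (nsq s) (2 * \sum_c s c * a i c) i (nsq_ge0 (a i))).
apply: eq_integral => w' _ /=; congr (_%:E).
rewrite /f /nsq mulr_sumr !mulr_suml -!big_split /=; apply: eq_bigr => c _.
have -> : SJ (block X J w) c = s c.
  by apply: eq_bigr => l lJ; rewrite tnth_block lJ.
by rewrite tnth_block inE eqxx; ring.
Qed.

Lemma second_moment m (a : 'I_n -> 'I_m -> R) :
  Ex P (fun w => nsq (fun c => \sum_i a i c * X i w)) = (\sum_i nsq (a i))%:E.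
Proof.
have E (F : 'I_n -> R) : \sum_(i in [set: 'I_n]%SET) F i = \sum_i F i.
  by apply: eq_bigl => i; rewrite inE.
rewrite -E -second_moment_set; apply: eq_Ex => w; congr nsq.
by apply/funext => c; rewrite E.
Qed.

End SecondMoment.

(** * Deviations of a quadratic form on both sides of its mean *)

Section QuadraticForm.
Context d (T : measurableType d) (R : realType) (P : probability T R).
Context (n : nat) (X : 'I_n -> {RV P >-> R}) (p tau : R) (k : nat).
Hypothesis N : noise X p tau k.
Local Notation K := (scaleK p tau).
Local Notation gam := (p / 2 - 1).
Let nsq0 m (v : 'I_m -> R) : 0 <= nsq v := nsq_ge0 v.
#[local] Hint Resolve mX mXp nsq0 : core.

Lemma linear_unit_moment (c : 'I_n -> R) : \sum_i c i ^+ 2 <= 1 ->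
  (Ex P (fun w => (((\sum_i c i * X i w) ^+ 2) ^+ k.+1)%R) <=
   (3 * rosC R k * K ^+ k)%:E)%E.
Proof.
move=> c1; apply: le_trans (linear_moment1 N c) _; rewrite lee_fin.
have K1 := K_ge1 N; have K0 := K_gt0 N; have C0 := rosC_gt0 R k.
have r0 : 0 <= \sum_j c j ^+ 2 by apply: sumr_ge0 => j _; exact: sqr_ge0.
have Kk : 1 <= K ^+ k by exact: exprn_ege1.
have h1 : (\sum_j c j ^+ 2) ^+ k.+1 <= 1 by rewrite exprn_ile1.
have h2 : \sum_j (c j ^+ 2) ^+ k.+1 <= 1.
  apply: le_trans (c1); apply: ler_sum => j _.
  rewrite exprS ler_piMr ?sqr_ge0 // exprn_ile1 ?sqr_ge0 //.
  apply: le_trans (c1); rewrite (bigD1 j) //= lerDl.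
  by apply: sumr_ge0 => ? _; exact: sqr_ge0.
have -> : 3 * rosC R k * K ^+ k = rosC R k * (3 * K ^+ k) by ring.
rewrite ler_wpM2l ?(ltW C0) //.
have h3 : 2 * K ^+ k * \sum_j (c j ^+ 2) ^+ k.+1 <= 2 * K ^+ k * 1.
  by rewrite ler_wpM2l // mulr_ge0 // exprn_ge0 // ltW.
by lra.
Qed.

(** The row and column conditions are those satisfied by a symmetric positive contraction, whose
    square it dominates. They bound the diagonal entries by 1 and the squared Frobenius norm by the
    trace. *)
Context (A : 'I_n -> 'I_n -> R) (t : R).
Hypothesis A0 : forall i, 0 <= A i i.
Hypothesis Arow : forall i, \sum_j A i j ^+ 2 <= A i i.
Hypothesis Acol : forall j, \sum_i A i j ^+ 2 <= A j j.
Hypothesis At : \sum_i A i i = t.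
Hypothesis Kt : K <= t.

Local Notation kap := ((K / t) `^ gam).
Let t1 : 1 <= t. Proof. exact: le_trans (K_ge1 N) Kt. Qed.
Let t0 : 0 < t. Proof. exact: lt_le_trans ltr01 t1. Qed.
Let K0 : 0 < K := K_gt0 N.
Let K1 : 1 <= K := K_ge1 N.
Let kap0 : 0 <= kap. Proof. exact: powR_ge0. Qed.

Let e i := A i i.

Lemma diag_le1 i : 0 <= e i <= 1.
Proof.
rewrite A0 /=; have : e i ^+ 2 <= e i.
  apply: le_trans (Arow i); rewrite (bigD1 i) //= lerDl.
  by apply: sumr_ge0 => j _; exact: sqr_ge0.
by have := A0 i; rewrite /e; nra.
Qed.

Definition quad w : R := \sum_i \sum_j A i j * X i w * X j w.

Lemma measurable_quad : measurable_fun setT quad.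
Proof. by rewrite /quad; meas. Qed.

Definition offC : R := 16 ^+ k.+1 * (16 * rosC R k ^+ 2).

Lemma offC_ge0 : 0 <= offC.
Proof. by rewrite /offC; nonneg. Qed.

Lemma truncC_ge0 : 0 <= truncC R k.
Proof. by rewrite /truncC; have := rosC_gt0 R k => h; nonneg. Qed.

Lemma offdiag_kap :
  (Ex P (fun w => ((offdiag X A w ^+ 2) ^+ k.+1)%R) <=
   (offC * ((t ^+ 2) ^+ k.+1 * kap))%:E)%E.
Proof.
have Arow1 i : \sum_j A i j ^+ 2 <= 1.
  by apply: le_trans (Arow i) _; case/andP: (diag_le1 i).
have Acol1 j : \sum_i A i j ^+ 2 <= 1.
  by apply: le_trans (Acol j) _; case/andP: (diag_le1 j).
have Atot : \sum_i \sum_j A i j ^+ 2 <= t.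
  by rewrite -At; apply: ler_sum => i _; exact: Arow.
apply: le_trans (offdiag_moment N Arow1 Acol1 Atot) _; rewrite lee_fin /offC.
rewrite [leRHS](_ : _ = 16 ^+ k.+1 *
  (8 * rosC R k ^+ 2 * (2 * ((t ^+ 2) ^+ k.+1 * kap)))); last by ring.
rewrite ler_wpM2l ?exprn_ge0 // ler_wpM2l //; first by nonneg.
(* Both terms of the chaos bound lie below [(t * K) ^+ k.+1], which is
   [(t ^+ 2) ^+ k.+1 * (K / t) ^+ k.+1]. *)
have h0 : t ^+ k.+1 * K ^+ k.+1 <= (t ^+ 2) ^+ k.+1 * kap.
  apply: le_trans (ler_wpM2l _ (kap_exp N Kt)); last by nonneg.
  rewrite -!exprMn; apply: eq_ler; congr (_ ^+ _); field; exact: lt0r_neq0.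
have tk0 : 0 <= t ^+ k.+1 by rewrite exprn_ge0 ?ltW.
have h1 : t ^+ k.+1 <= t ^+ k.+1 * K ^+ k.+1 by rewrite ler_peMr // exprn_ege1.
have h2 : K ^+ (2 * k) * t <= t ^+ k.+1 * K ^+ k.+1.
  case: k => [|l]; first by rewrite muln0 expr0 mul1r !expr1 ler_peMr // ltW.
  have -> : (2 * l.+1 = l.+2 + l)%N by rewrite mul2n -addnn addSn addnS.
  rewrite exprD -mulrA mulrC ler_wpM2r ?exprn_ge0 ?(ltW K0) //.
  apply: (@le_trans _ _ (t ^+ l * t)).
    by rewrite ler_wpM2r ?(ltW t0) // lerXn2r ?nnegrE ?(ltW K0) ?(ltW t0).
  by rewrite -exprSr ler_weXn2l.
by lra.
Qed.

Lemma quadE w : quad w = \sum_i (xi e t i (X i w) - mu X e t i) +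
  offdiag X A w + \sum_i tl e t i (X i w) + \sum_i mu X e t i.
Proof.
have -> : quad w = \sum_i A i i * X i w ^+ 2 + offdiag X A w.
  rewrite /offdiag -big_split /=; apply: eq_bigr => i _.
  by rewrite (bigD1 i) //= -mulrA -expr2.
have -> : \sum_i A i i * X i w ^+ 2 = \sum_i (xi e t i (X i w) - mu X e t i) +
    \sum_i tl e t i (X i w) + \sum_i mu X e t i.
  by rewrite -!big_split /=; apply: eq_bigr => i _; rewrite /tl /e; ring.
by ring.
Qed.

(** The non-positive power of [delta / 2] comes from Markov's inequality for the two centered parts,
    each given half of the slack; the 1 accounts for the tails. *)
Definition upC (q delta : R) : R :=
  (delta / 2) `^ (q - (2 * k.+1)%N%:R) * (truncC R k + offC) + 1.

Lemma upC_gt0 q delta : 0 < upC q delta.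
Proof.
have h1 := offC_ge0; have h2 := truncC_ge0.
by rewrite /upC ltr_wpDl // mulr_ge0 ?powR_ge0 // addr_ge0.
Qed.

(** The truncated means add up to at most [t], so the whole slack [delta * t] is shared by the
    truncated diagonal and the chaos. The tails get none of it: they are separated by subadditivity
    of the power [q]. *)
Lemma quad_upper q delta : 0 < q <= 1 -> 0 < delta ->
  (Ex P (fun w => Num.max 0 (quad w - (1 + delta) * t) `^ q)%R <=
   (upC q delta * (t `^ q * kap))%:E)%E.
Proof.
move=> /andP[q0 q1] d0.
have e1 := diag_le1.
have p2 := noise_p N.
set m := (2 * k.+1)%N.
set y := delta / 2 * t.
have y0 : 0 < y by rewrite mulr_gt0 // divr_gt0.
pose D1 w := \sum_i (xi e t i (X i w) - mu X e t i).
pose U w := offdiag X A w.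
have mD1 : measurable_fun setT D1.
  by rewrite /D1; meas; exact: mxiX.
have mU : measurable_fun setT U := measurable_offdiag X A.
have mt i : measurable_fun setT (fun w => tl e t i (X i w) `^ q).
  exact: (measurableT_comp (measurable_powR q) (mtlX X e t i)).
have qm : 0 < q <= m%:R.
  by rewrite q0 (le_trans q1) // ler1n /m mul2n.
have sqm x : `|x| ^+ m = (x ^+ 2) ^+ k.+1 :> R.
  by rewrite /m exprM real_normK ?num_real.
have pt w : Num.max 0 (quad w - (1 + delta) * t) `^ q <=
    y `^ (q - m%:R) * ((D1 w ^+ 2) ^+ k.+1 + (U w ^+ 2) ^+ k.+1)
    + \sum_i tl e t i (X i w) `^ q.
  have s0 : 0 <= \sum_i tl e t i (X i w).
    by apply: sumr_ge0 => i _; exact: tl_ge0.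
  have q01 : 0 < q <= 1 by rewrite q0.
  have a0 x : 0 <= Num.max 0 x :> R by rewrite le_max lexx.
  apply: (@le_trans _ _ ((Num.max 0 (`|D1 w| - y) + Num.max 0 (`|U w| - y)
      + \sum_i tl e t i (X i w)) `^ q)).
    rewrite ge0_ler_powR ?nnegrE ?(ltW q0) ?addr_ge0 // ge_max !addr_ge0 //=.
    rewrite quadE -/(D1 w) -/(U w).
    have := sum_mu_le N e1 At; have := ler_norm (D1 w); have := ler_norm (U w).
    have : `|D1 w| - y <= Num.max 0 (`|D1 w| - y) by rewrite le_max lexx orbT.
    have : `|U w| - y <= Num.max 0 (`|U w| - y) by rewrite le_max lexx orbT.
    have -> : (1 + delta) * t = t + y + y by rewrite /y; field.
    by move=> *; lra.
  apply: le_trans (powR_subadd _ s0 q01) _; first by rewrite addr_ge0.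
  apply: lerD; last by apply: powR_sum_subadd => // i; exact: tl_ge0.
  apply: le_trans (powR_subadd (a0 _) (a0 _) q01) _.
  rewrite mulrDr -!sqm; apply: lerD; exact: pos_part_powR_le.
have yt : y `^ (q - m%:R) * (t ^+ 2) ^+ k.+1 = (delta / 2) `^ (q - m%:R) * t `^ q.
  rewrite powRM ?(ltW t0) ?divr_ge0 ?(ltW d0) // -mulrA; congr (_ * _).
  rewrite -exprM -/m -powR_mulrn ?(ltW t0) // -powRD ?subrK //.
  by rewrite (gt_eqF t0) implybT.
have -> : upC q delta * (t `^ q * kap) =
  y `^ (q - m%:R) * (truncC R k * ((t ^+ 2) ^+ k.+1 * kap) + offC * ((t ^+ 2) ^+ k.+1 * kap))
  + t `^ q * kap.
  rewrite /upC -/m mulrDl mul1r; congr (_ + _).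
  transitivity ((y `^ (q - m%:R) * (t ^+ 2) ^+ k.+1) * (truncC R k + offC) * kap).
    by rewrite yt; ring.
  by ring.
apply: (@Ex_leD _ _ _ _ _
  (fun w => y `^ (q - m%:R) * ((D1 w ^+ 2) ^+ k.+1 + (U w ^+ 2) ^+ k.+1))
  (fun w => \sum_i tl e t i (X i w) `^ q)); try by side.
- apply: measurable_pos_powR; apply: measurable_funB; last by meas.
  exact: measurable_quad.
- apply: (@Ex_leZ _ _ _ _ _ _ _
    (fun w => (D1 w ^+ 2) ^+ k.+1 + (U w ^+ 2) ^+ k.+1)); try by side.
  apply: (@Ex_leD _ _ _ _ _ (fun w => (D1 w ^+ 2) ^+ k.+1)
    (fun w => (U w ^+ 2) ^+ k.+1)); try by side.
  + exact: (trunc_moment N e1 At Kt).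
  + exact: offdiag_kap.
- by apply: (tl_moment N e1 At Kt); rewrite q0; lra.
Qed.

Definition loC (delta : R) : R :=
  (4 / delta) ^+ (2 * k.+1) * (truncC R k + offC) + 4 / delta.

Lemma quad_lower delta : 0 < delta ->
  (P [set w | quad w <= (1 - delta) * t]%R <= (loC delta * kap)%:E)%E.
Proof.
move=> d0; have e1 := diag_le1.
set m := (2 * k.+1)%N.
set y := delta / 4 * t.
have y0 : 0 < y by rewrite mulr_gt0 // divr_gt0.
pose D1 w := \sum_i (xi e t i (X i w) - mu X e t i).
pose U w := offdiag X A w.
have mD1 : measurable_fun setT D1.
  by rewrite /D1; meas; exact: mxiX.
have mU : measurable_fun setT U := measurable_offdiag X A.
set E := [set w | _].
have mE : measurable E.
  have := @measurable_fun_ler _ T R setT quad (fun=> (1 - delta) * t)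
    measurable_quad (measurable_cst _).
  move=> /(_ measurableT [set true]); rewrite setTI /preimage /= => h.
  by apply: h.
have sqm x : `|x| ^+ m = (x ^+ 2) ^+ k.+1 :> R.
  by rewrite /m exprM real_normK ?num_real.
have big x : y <= `|x| -> 1 <= y ^- m * (x ^+ 2) ^+ k.+1.
  move=> yx; rewrite -sqm mulrC ler_pdivlMr ?exprn_gt0 // mul1r.
  by rewrite lerXn2r ?nnegrE ?(ltW y0).
have ym0 : 0 <= y ^- m by rewrite invr_ge0 exprn_ge0 ?ltW.
have d4 : 0 <= 4 / delta by rewrite divr_ge0 // ltW.
have pt w : \1_E w <= y ^- m * ((D1 w ^+ 2) ^+ k.+1 + (U w ^+ 2) ^+ k.+1)
    + 4 / delta * kap.
  rewrite indicE; have g0 : 0 <= y ^- m * ((D1 w ^+ 2) ^+ k.+1 + (U w ^+ 2) ^+ k.+1).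
    by nonneg.
  have k4 : 0 <= 4 / delta * kap by rewrite mulr_ge0.
  have [|_] := boolP (w \in E); last by rewrite addr_ge0.
  rewrite inE /E /= quadE -/(D1 w) -/(U w) => wE.
  have s0 : 0 <= \sum_i tl e t i (X i w).
    by apply: sumr_ge0 => i _; exact: tl_ge0.
  have [kd|kd] := leP (delta / 4) kap.
    have : 1 <= 4 / delta * kap.
      apply: le_trans (ler_wpM2l d4 kd); apply: eq_ler; field; exact: lt0r_neq0.
    by lra.
  have hmu := sum_mu_ge N e1 At Kt.
  have tk : t * kap <= y by rewrite /y mulrC ler_wpM2r ?(ltW t0) ?(ltW kd).
  have dt : delta * t = 4 * y by rewrite /y; field.
  have : y <= `|D1 w| \/ y <= `|U w|.
    have [|h1] := leP y `|D1 w|; first by left.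
    have [|h2] := leP y `|U w|; first by right.
    have := ler_norm (- D1 w); have := ler_norm (- U w); rewrite !normrN => h3 h4.
    have : (1 - delta) * t = t - 4 * y by rewrite -dt; ring.
    by move=> h5; exfalso; move: wE; rewrite h5; move: hmu; move=> *; lra.
  have D0 : 0 <= y ^- m * (D1 w ^+ 2) ^+ k.+1 by nonneg.
  have U0 : 0 <= y ^- m * (U w ^+ 2) ^+ k.+1 by nonneg.
  by rewrite mulrDr; case=> /big; lra.
have -> : P E = Ex P \1_E by rewrite /Ex integral_indic // setIT.
have yt : y ^- m * (t ^+ 2) ^+ k.+1 = (4 / delta) ^+ m.
  rewrite -exprM -/m -exprVn -exprMn; congr (_ ^+ _).
  by rewrite /y; field; rewrite !lt0r_neq0.
have -> : loC delta * kap =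
  y ^- m * (truncC R k * ((t ^+ 2) ^+ k.+1 * kap) + offC * ((t ^+ 2) ^+ k.+1 * kap))
  + 4 / delta * kap.
  rewrite /loC -/m mulrDl; congr (_ + _).
  transitivity ((y ^- m * (t ^+ 2) ^+ k.+1) * (truncC R k + offC) * kap).
    by rewrite yt; ring.
  by ring.
apply: (@Ex_leD _ _ _ _ _
  (fun w => y ^- m * ((D1 w ^+ 2) ^+ k.+1 + (U w ^+ 2) ^+ k.+1))
  (fun=> 4 / delta * kap)); try by side.
- apply: (@Ex_leZ _ _ _ _ _ _ _
    (fun w => (D1 w ^+ 2) ^+ k.+1 + (U w ^+ 2) ^+ k.+1)); try by side.
  apply: (@Ex_leD _ _ _ _ _ (fun w => (D1 w ^+ 2) ^+ k.+1)
    (fun w => (U w ^+ 2) ^+ k.+1)); try by side.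
  + exact: (trunc_moment N e1 At Kt).
  + exact: offdiag_kap.
- by rewrite Ex_cst.
Qed.

End QuadraticForm.

(** * Geometry of orthogonal projections *)

Section Euclidean.
Context {R : realType}.

Definition sqn n (x : 'cV[R]_n) : R := nsq (fun i => x i 0).
Definition dot n (x y : 'cV[R]_n) : R := \sum_i x i 0 * y i 0.

Lemma sqn_ge0 n (x : 'cV[R]_n) : 0 <= sqn x. Proof. exact: nsq_ge0. Qed.

Lemma dotE n (x y : 'cV[R]_n) : dot x y = (x^T *m y) 0 0.
Proof. by rewrite mxE; apply: eq_bigr => i _; rewrite mxE. Qed.

Lemma dotxx n (x : 'cV[R]_n) : dot x x = sqn x.
Proof. by apply: eq_bigr => i _; rewrite expr2. Qed.

Lemma dotC n (x y : 'cV[R]_n) : dot x y = dot y x.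
Proof. by apply: eq_bigr => i _; rewrite mulrC. Qed.

Lemma dot_mulmxl m n (A : 'M[R]_(m, n)) x y : dot (A *m x) y = dot x (A^T *m y).
Proof. by rewrite !dotE trmx_mul mulmxA. Qed.

Lemma cauchy_dot n (x y : 'cV[R]_n) : dot x y ^+ 2 <= sqn x * sqn y.
Proof. exact: cauchy_nsq. Qed.

Lemma sqnD n (x y : 'cV[R]_n) : sqn (x + y) = sqn x + 2 * dot x y + sqn y.
Proof.
rewrite /sqn /nsq /dot mulr_sumr -!big_split /=; apply: eq_bigr => i _.
by rewrite mxE; ring.
Qed.

Lemma sqnZ n a (x : 'cV[R]_n) : sqn (a *: x) = a ^+ 2 * sqn x.
Proof.
by rewrite /sqn /nsq mulr_sumr; apply: eq_bigr => i _; rewrite mxE exprMn.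
Qed.

Lemma dotZl n a (x y : 'cV[R]_n) : dot (a *: x) y = a * dot x y.
Proof. by rewrite /dot mulr_sumr; apply: eq_bigr => i _; rewrite mxE mulrA. Qed.

Lemma dotZr n a (x y : 'cV[R]_n) : dot x (a *: y) = a * dot x y.
Proof. by rewrite dotC dotZl dotC. Qed.

Lemma dotDl n (x y z : 'cV[R]_n) : dot (x + y) z = dot x z + dot y z.
Proof. by rewrite /dot -big_split /=; apply: eq_bigr => i _; rewrite mxE mulrDl. Qed.

Lemma dotDr n (x y z : 'cV[R]_n) : dot x (y + z) = dot x y + dot x z.
Proof. by rewrite dotC dotDl !(dotC x). Qed.

Lemma sqn_eq0 n (x : 'cV[R]_n) : (sqn x == 0) = (x == 0).
Proof.
apply/eqP/eqP => [|->].
  rewrite /sqn /nsq => /psumr_eq0P x0; apply/matrixP => i j; rewrite mxE (ord1 j).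
  by apply/eqP; rewrite -sqrf_eq0; apply/eqP/x0 => // l _; exact: sqr_ge0.
by rewrite /sqn /nsq big1 // => i _; rewrite mxE expr0n.
Qed.

Lemma sqn_mulmx_frobenius m n (A : 'M[R]_(m, n)) x :
  sqn (A *m x) <= (\sum_i nsq (A i)) * sqn x.
Proof.
rewrite /sqn [leLHS]/nsq mulr_suml; apply: ler_sum => i _.
by rewrite mxE; exact: cauchy_nsq.
Qed.

Lemma trace_gram m n (B : 'M[R]_(m, n)) :
  \tr (B^T *m B) = \sum_i nsq (fun c => B c i).
Proof.
apply: eq_bigr => i _; rewrite mxE /nsq; apply: eq_bigr => c _.
by rewrite mxE expr2.
Qed.

(** With [z = B^T *m y], Cauchy-Schwarz is applied to [|z|^2 = <y, B z>], and one factor [|z|^2] is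
    cancelled. *)
Lemma sqn_trmx_le m n (B : 'M[R]_(m, n)) r : 0 <= r ->
  (forall x, sqn (B *m x) <= r * sqn x) ->
  forall y, sqn (B^T *m y) <= r * sqn y.
Proof.
move=> r0 Br y; set z := B^T *m y.
have [z0|z0] := eqVneq (sqn z) 0; first by rewrite z0 mulr_ge0 ?sqn_ge0.
have zp : 0 < sqn z by rewrite lt0r z0 sqn_ge0.
have h : sqn z ^+ 2 <= sqn y * (r * sqn z).
  rewrite -{1}dotxx {2}/z -dot_mulmxl dotC.
  apply: le_trans (cauchy_dot _ _) _.
  by rewrite ler_wpM2l ?sqn_ge0.
by rewrite -(ler_pM2r zp) -expr2; apply: le_trans h _; apply: eq_ler; ring.
Qed.

Lemma normn_sqr n (x : 'cV[R]_n) : normn x ^+ 2 = n%:R^-1 * sqn x.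
Proof. by rewrite /normn sqr_sqrtr // mulr_ge0 ?invr_ge0 ?sqn_ge0. Qed.

Lemma normn_ge0 n (x : 'cV[R]_n) : 0 <= normn x.
Proof. exact: sqrtr_ge0. Qed.

Lemma normn_ratio n (A : 'M[R]_n) x : x != 0 ->
  (normn (A *m x) / normn x) ^+ 2 * sqn x = sqn (A *m x).
Proof.
case: n A x => [|n] A x x0; first by rewrite flatmx0 eqxx in x0.
have n0 : n.+1%:R != 0 :> R by rewrite pnatr_eq0.
have s0 : sqn x != 0 by rewrite sqn_eq0.
rewrite expr_div_n !normn_sqr; move: n0 s0; move: (n.+1%:R : R) => c c0 s0.
by field; rewrite c0 s0.
Qed.

(** For an unbounded set [sup] would be a default value; the Frobenius norm provides a bound. *)
Lemma specnorm_has_ubound n (A : 'M[R]_n) :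
  has_ubound [set normn (A *m x) / normn x | x in [set x : 'cV[R]_n | x != 0]].
Proof.
exists (Num.sqrt (\sum_i nsq (A i))) => _ [x /= x0 <-].
have F0 : 0 <= \sum_i nsq (A i) by apply: sumr_ge0 => i _; exact: nsq_ge0.
rewrite -(@ler_pXn2r _ 2) ?nnegrE ?sqrtr_ge0 ?divr_ge0 ?normn_ge0 // sqr_sqrtr //.
have sp : 0 < sqn x by rewrite lt0r sqn_eq0 x0 sqn_ge0.
by rewrite -(ler_pM2r sp) normn_ratio // sqn_mulmx_frobenius.
Qed.

Lemma ler_specnorm n (A : 'M[R]_n) x : x != 0 ->
  normn (A *m x) / normn x <= specnorm A.
Proof. by move=> x0; apply: (ub_le_sup (specnorm_has_ubound A)); exists x. Qed.

Lemma specnorm_ge0 n (A : 'M[R]_n) : 0 <= specnorm A.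
Proof.
have [[x x0]|h] := pselect (exists x : 'cV[R]_n, x != 0).
  apply: le_trans (ler_specnorm A x0); by rewrite divr_ge0 ?normn_ge0.
rewrite /specnorm (_ : [set _ | _ in _] = set0) ?sup0 //.
by apply/seteqP; split=> // y [x /= x0 _]; apply: h; exists x.
Qed.

Lemma sqn_mulmx_le n (A : 'M[R]_n) x : sqn (A *m x) <= specnorm A ^+ 2 * sqn x.
Proof.
have [->|x0] := eqVneq x 0.
  by rewrite mulmx0 (_ : sqn 0 = 0) ?mulr0 //; apply/eqP; rewrite sqn_eq0.
rewrite -normn_ratio // ler_wpM2r ?sqn_ge0 //.
by rewrite lerXn2r ?nnegrE ?specnorm_ge0 ?divr_ge0 ?normn_ge0 ?ler_specnorm.
Qed.

Lemma specnorm_gt0 n (A : 'M[R]_n) : A != 0 -> 0 < specnorm A.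
Proof.
move=> A0; rewrite lt0r specnorm_ge0 andbT; apply: contraNneq A0 => s0.
apply/eqP/matrixP => i j; rewrite mxE.
have := sqn_mulmx_le A (delta_mx j 0); rewrite s0 expr0n mul0r => h.
have : sqn (A *m delta_mx j 0) == 0 by rewrite eq_le h sqn_ge0.
by rewrite sqn_eq0 -colE => /eqP /matrixP /(_ i 0); rewrite !mxE.
Qed.

Lemma specnorm_le n (A B : 'M[R]_n) :
  (forall x, sqn (A *m x) <= sqn (B *m x)) -> specnorm A <= specnorm B.
Proof.
move=> AB; have [h|h] := pselect (exists x : 'cV[R]_n, x != 0); last first.
  rewrite {1}/specnorm (_ : [set _ | _ in _] = set0) ?sup0 ?specnorm_ge0 //.
  by apply/seteqP; split=> // y [x /= x0 _]; apply: h; exists x.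
apply: sup_le_ub; first by case: h => x x0; exists (normn (A *m x) / normn x); exists x.
move=> _ [x /= x0 <-]; apply: le_trans (ler_specnorm B x0).
rewrite ler_wpM2r ?invr_ge0 ?normn_ge0 // /normn ler_wsqrtr //.
by rewrite ler_wpM2l ?invr_ge0 // AB.
Qed.

Section Projection.
Context (n : nat) (U : {vspace 'cV[R]_n}) (A : 'M[R]_n).
Hypothesis AU : is_orthogonal_projection U A.

Lemma proj_fixed u : u \in U -> A *m u = u.
Proof.
move=> uU; have [Au h] := AU u.
have hU : u - A *m u \in U by rewrite rpredB.
have /eqP := h _ hU; set z := u - A *m u => z0.
have : sqn z == 0 by rewrite -dotxx dotE (eqP z0) mxE.
by rewrite sqn_eq0 subr_eq0 => /eqP.
Qed.

(** Entry by entry, this says that the residual of one basis vector is orthogonal to the projection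
    of another. Symmetry and idempotence follow. *)
Lemma proj_gram : A^T *m A = A^T.
Proof.
apply/matrixP => i j; have [Ai _] := AU (delta_mx i 0).
have [_ /(_ _ Ai) h] := AU (delta_mx j 0).
have : dot (A *m delta_mx i 0) (delta_mx j 0 - A *m delta_mx j 0) = 0.
  by rewrite dotE h mxE.
rewrite -!colE -(scaleN1r (col j A)) dotDr dotZr mulN1r => /eqP.
rewrite subr_eq0 => /eqP E; transitivity (dot (col i A) (col j A)).
  by rewrite mxE; apply: eq_bigr => c _; rewrite !mxE.
rewrite -E /dot (bigD1 j) //= big1 => [|c cj].
  by rewrite !mxE !eqxx mulr1 addr0.
by rewrite !mxE (negbTE cj) mulr0.
Qed.

Lemma proj_sym : A^T = A.
Proof. by rewrite -{1}proj_gram -[RHS]trmxK -[in RHS]proj_gram trmx_mul !trmxK. Qed.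

Lemma proj_idem : A *m A = A.
Proof. by rewrite -{1}proj_sym proj_gram proj_sym. Qed.

Lemma proj_dot x y : dot (A *m x) (y - A *m y) = 0.
Proof.
rewrite dot_mulmxl mulmxBr mulmxA proj_sym proj_idem subrr.
by rewrite /dot big1 // => i _; rewrite mxE mulr0.
Qed.

Lemma proj_pythagoras x y :
  sqn (A *m x + (y - A *m y)) = sqn (A *m x) + sqn (y - A *m y).
Proof. by rewrite sqnD proj_dot mulr0 addr0. Qed.

Lemma proj_sqn_le x : sqn (A *m x) <= sqn x.
Proof.
have -> : sqn x = sqn (A *m x + (x - A *m x)) by rewrite addrC subrK.
by rewrite proj_pythagoras lerDl sqn_ge0.
Qed.

Lemma coproj_sqn_le x : sqn (x - A *m x) <= sqn x.
Proof.
have -> : sqn x = sqn (A *m x + (x - A *m x)) by rewrite addrC subrK.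
by rewrite proj_pythagoras lerDr sqn_ge0.
Qed.

End Projection.
End Euclidean.

(** * Deviations for a single model *)

Section NoiseVector.
Context d (T : measurableType d) (R : realType) (P : probability T R).
Context (n : nat) (X : 'I_n -> {RV P >-> R}) (p tau q : R) (k : nat).
Hypothesis N : noise X p tau k.
Hypothesis q01 : 0 < q <= 1.
Local Notation K := (scaleK p tau).
Local Notation gam := (p / 2 - 1).
Let nsq0 m (v : 'I_m -> R) : 0 <= nsq v := nsq_ge0 v.
#[local] Hint Resolve mX mXp nsq0 : core.
Let K0 : 0 < K := K_gt0 N.
Let K1 : 1 <= K := K_ge1 N.
Let q0 : 0 < q. Proof. by case/andP: q01. Qed.
Let q1 : q <= 1. Proof. by case/andP: q01. Qed.
Let tau1 : 1 <= tau := tau_ge1 N.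
Let tau0 : 0 < tau. Proof. exact: lt_le_trans ltr01 tau1. Qed.

Definition nvec w : 'cV[R]_n := \col_i X i w.

Lemma sqn_nvec (B : 'M[R]_n) w :
  sqn (B *m nvec w) = nsq (fun c => \sum_i B c i * X i w).
Proof.
rewrite /sqn /nsq; apply: eq_bigr => c _; rewrite mxE; congr (_ ^+ 2).
by apply: eq_bigr => i _; rewrite mxE.
Qed.

Lemma measurable_sqn_nvec (B : 'M[R]_n) (u : 'cV[R]_n) :
  measurable_fun setT (fun w => sqn (u + B *m nvec w)).
Proof.
rewrite (_ : (fun w => _) = fun w => nsq (fun c => u c 0 + \sum_i B c i * X i w)).
  by meas.
apply/funext => w; rewrite /sqn; congr nsq; apply/funext => c.
by rewrite !mxE; congr (_ + _); apply: eq_bigr => i _; rewrite mxE.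
Qed.

Lemma measurable_sqn_nvec0 (B : 'M[R]_n) :
  measurable_fun setT (fun w => sqn (B *m nvec w)).
Proof.
have := measurable_sqn_nvec B 0; rewrite (_ : (fun w => _) = (fun w => sqn (B *m nvec w))) //.
by apply/funext => w; rewrite add0r.
Qed.

Lemma dot_nvec (B : 'M[R]_n) u w :
  dot u (B *m nvec w) = \sum_i (B^T *m u) i 0 * X i w.
Proof.
rewrite dotC dot_mulmxl dotC.
by apply: eq_bigr => i _; rewrite [nvec w i 0]mxE.
Qed.

Lemma measurable_dot_nvec (B : 'M[R]_n) u :
  measurable_fun setT (fun w => dot u (B *m nvec w)).
Proof.
rewrite (_ : (fun w => _) = fun w => \sum_i (B^T *m u) i 0 * X i w); first by meas.
by apply/funext => w; exact: dot_nvec.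
Qed.
#[local] Hint Resolve measurable_sqn_nvec0 measurable_dot_nvec : core.

Lemma Ex_sqn_nvec (B : 'M[R]_n) :
  Ex P (fun w => sqn (B *m nvec w)) = (\tr (B^T *m B))%:E.
Proof.
under eq_Ex do rewrite sqn_nvec.
by rewrite (second_moment N (fun i c => B c i)) trace_gram.
Qed.

Lemma Ex_sqn_nvecZ (c : R) (B : 'M[R]_n) : 0 <= c ->
  Ex P (fun w => c * sqn (B *m nvec w)) = (c * \tr (B^T *m B))%:E.
Proof.
move=> c0; rewrite ExZ // ?Ex_sqn_nvec //; move=> w; exact: sqn_ge0.
Qed.

(** Jensen's inequality for a concave power up to a factor 2: after division by [m], a power of
    exponent [q] is at most [1 + x]. *)
Lemma Ex_powR_le (f : T -> R) m : measurable_fun setT f ->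
  (forall w, 0 <= f w) -> 0 < m -> (Ex P f <= m%:E)%E ->
  (Ex P (fun w => f w `^ q)%R <= (2 * m `^ q)%:E)%E.
Proof.
move=> mf f0 m0 fm.
have mq : measurable_fun setT (fun w => f w `^ q).
  exact: (measurableT_comp (measurable_powR q)).
have -> : 2 * m `^ q = m `^ q + m `^ q / m * m by field; exact: lt0r_neq0.
apply: (@Ex_leD _ _ _ _ _ (fun=> m `^ q) (fun w => m `^ q / m * f w)); try by side.
- clear fm; move=> w; have -> : f w = m * (f w / m) by field; exact: lt0r_neq0.
  rewrite powRM ?divr_ge0 ?(ltW m0) //.
  have -> : m `^ q + m `^ q / m * (m * (f w / m)) = m `^ q * (1 + f w / m).
    by field; exact: lt0r_neq0.
  rewrite ler_wpM2l ?powR_ge0 //.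
  have x0 : 0 <= f w / m by rewrite divr_ge0 // ltW.
  have [x1|/ltW x1] := leP (f w / m) 1.
    by apply: (@le_trans _ _ 1); [rewrite powR_le1 ?x0 ?(ltW q0)|rewrite lerDl].
  apply: (@le_trans _ _ (f w / m)); last by rewrite lerDr.
  by rewrite -[leRHS](powRr1 x0) ler_powR.
- by rewrite Ex_cst.
- by apply: (@Ex_leZ _ _ _ _ _ _ _ f); try by side.
Qed.

Section Gram.
Context (B : 'M[R]_n) (r : R).
Hypothesis r0 : 0 < r.
Hypothesis Br : forall x, sqn (B *m x) <= r * sqn x.

Local Notation t := (\tr (B^T *m B) / r).
Local Notation kap := ((K / t) `^ gam).

Let A i j := r^-1 * (B^T *m B) i j.

Let Asym i j : A i j = A j i.
Proof.
rewrite /A; congr (_ * _); rewrite !mxE; apply: eq_bigr => c _.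
by rewrite !mxE mulrC.
Qed.

Let A0 i : 0 <= A i i.
Proof.
rewrite /A mulr_ge0 ?invr_ge0 ?(ltW r0) // mxE; apply: sumr_ge0 => c _.
by rewrite mxE -expr2 sqr_ge0.
Qed.

(** Column [j] of the Gram matrix is [B^T B e_j], and the transpose obeys the same norm bound as
    [B], so its squared norm is at most [r * |B e_j|^2]. *)
Let Acol j : \sum_i A i j ^+ 2 <= A j j.
Proof.
pose v := B *m (delta_mx j 0 : 'cV[R]_n).
have E1 : \sum_i A i j ^+ 2 = r^-1 ^+ 2 * sqn (B^T *m v).
  rewrite /sqn /nsq mulr_sumr; apply: eq_bigr => i _.
  by rewrite /A exprMn /v mulmxA -colE [in RHS]mxE.
have E2 : A j j = r^-1 * sqn v.
  rewrite /A; congr (_ * _); rewrite mxE /sqn /nsq; apply: eq_bigr => c _.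
  by rewrite /v -colE !mxE expr2.
rewrite E1 E2 expr2 -mulrA ler_wpM2l ?invr_ge0 ?(ltW r0) //.
by rewrite ler_pdivrMl // sqn_trmx_le // ltW.
Qed.

Let Arow i : \sum_j A i j ^+ 2 <= A i i.
Proof. by rewrite (eq_bigr (fun j => A j i ^+ 2)) // => j _; rewrite Asym. Qed.

Let At : \sum_i A i i = t.
Proof. by rewrite -mulr_sumr mulrC. Qed.

Let quadB w : quad X A w = sqn (B *m nvec w) / r.
Proof.
rewrite -dotxx dot_mulmxl mulmxA /quad /dot mulr_suml.
apply: eq_bigr => i _; rewrite [nvec w i 0]mxE mxE mulr_sumr mulr_suml.
by apply: eq_bigr => j _; rewrite /A [nvec w j 0]mxE; ring.
Qed.

Lemma gram_upper delta : K <= t -> 0 < delta ->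
  (Ex P (fun w => Num.max 0 (sqn (B *m nvec w) / r - (1 + delta) * t) `^ q)%R <=
   (upC k q delta * (t `^ q * kap))%:E)%E.
Proof.
move=> Kt d0; under eq_Ex do rewrite -quadB.
exact: (quad_upper N A0 Arow Acol At Kt q01 d0).
Qed.

Lemma gram_lower delta : K <= t -> 0 < delta ->
  (P [set w | sqn (B *m nvec w) / r <= (1 - delta) * t]%R <= (loC k delta * kap)%:E)%E.
Proof.
move=> Kt d0; have := quad_lower N A0 Arow Acol At Kt d0.
rewrite (_ : [set w | quad X A w <= _] =
  [set w | sqn (B *m nvec w) / r <= (1 - delta) * t]) //.
by apply/seteqP; split=> w /=; rewrite quadB.
Qed.

Lemma dot_moment u : sqn u <= 1 ->
  (Ex P (fun w => ((dot u (B *m nvec w) ^+ 2 / r) ^+ k.+1)%R) <=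
   (3 * rosC R k * K ^+ k)%:E)%E.
Proof.
move=> u1; pose c i := (Num.sqrt r)^-1 * (B^T *m u) i 0.
have s0 : Num.sqrt r ^+ 2 = r by rewrite sqr_sqrtr // ltW.
have c1 : \sum_i c i ^+ 2 <= 1.
  have -> : \sum_i c i ^+ 2 = r^-1 * sqn (B^T *m u).
    rewrite /sqn /nsq mulr_sumr; apply: eq_bigr => i _.
    by rewrite /c exprMn exprVn s0.
  rewrite ler_pdivrMl // mulr1; apply: le_trans (sqn_trmx_le (ltW r0) Br u) _.
  by rewrite -[leRHS]mulr1 ler_wpM2l // ltW.
have := linear_unit_moment N c1; apply: le_trans; rewrite le_eqVlt; apply/orP; left.
apply/eqP; apply: eq_Ex => w; congr (_ ^+ _); rewrite dot_nvec.
have -> : \sum_i c i * X i w = (Num.sqrt r)^-1 * \sum_i (B^T *m u) i 0 * X i w.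
  by rewrite mulr_sumr; apply: eq_bigr => i _; rewrite mulrA.
by rewrite exprMn exprVn s0 mulrC.
Qed.

Lemma dot_upper u y : sqn u <= 1 -> 0 < y ->
  (Ex P (fun w => Num.max 0 (dot u (B *m nvec w) ^+ 2 / r - y) `^ q)%R <=
   (y `^ (q - k.+1%:R) * (3 * rosC R k * K ^+ k))%:E)%E.
Proof.
move=> u1 y0.
have x0 w : 0 <= dot u (B *m nvec w) ^+ 2 / r by rewrite divr_ge0 ?sqr_ge0 ?ltW.
have mx : measurable_fun setT (fun w => dot u (B *m nvec w) ^+ 2 / r) by meas.
apply: (@Ex_leZ _ _ _ _ _ _ _ (fun w => (dot u (B *m nvec w) ^+ 2 / r) ^+ k.+1)).
- by apply: measurable_pos_powR; meas.
- by meas.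
- exact: powR_ge0.
- by move=> w; exact: powR_ge0.
- by move=> w; rewrite exprn_ge0.
- move=> w; apply: pos_part_powR_le => //.
  by rewrite q0 (le_trans q1) // ler1n.
- exact: dot_moment.
Qed.

Lemma dot_tail u y : sqn u <= 1 -> 0 < y ->
  (P [set w | y <= dot u (B *m nvec w) ^+ 2 / r]%R <=
   (y ^- k.+1 * (3 * rosC R k * K ^+ k))%:E)%E.
Proof.
move=> u1 y0.
have x0 w : 0 <= dot u (B *m nvec w) ^+ 2 / r by rewrite divr_ge0 ?sqr_ge0 ?ltW.
have mx : measurable_fun setT (fun w => dot u (B *m nvec w) ^+ 2 / r) by meas.
set E := [set w | _].
have mE : measurable E.
  have := @measurable_fun_ler _ T R setT (fun=> y) _ (measurable_cst _) mx.
  move=> /(_ measurableT [set true]); rewrite setTI /preimage /= => h.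
  by apply: h.
have -> : P E = Ex P \1_E by rewrite /Ex integral_indic // setIT.
apply: (@Ex_leZ _ _ _ _ _ _ _ (fun w => (dot u (B *m nvec w) ^+ 2 / r) ^+ k.+1)); try by side.
- move=> w; rewrite indicE; have [|_] := boolP (w \in E); last first.
    by rewrite mulr_ge0 ?exprn_ge0 // invr_ge0 exprn_ge0 // ltW.
  rewrite inE /E /= => yx; rewrite mulrC ler_pdivlMr ?exprn_gt0 // mul1r.
  by rewrite lerXn2r ?nnegrE ?(ltW y0).
- exact: dot_moment.
Qed.

End Gram.
End NoiseVector.

Section RiskBounds.
Context d (T : measurableType d) (R : realType) (P : probability T R).
Context (n : nat) (X : 'I_n -> {RV P >-> R}) (p tau q : R) (k : nat).
Hypothesis N : noise X p tau k.
Hypothesis q01 : 0 < q <= 1.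
Local Notation K := (scaleK p tau).
Local Notation gam := (p / 2 - 1).
Local Notation nv := (nvec X).
Let K0 : 0 < K := K_gt0 N.
Let K1 : 1 <= K := K_ge1 N.
Let q0 : 0 < q. Proof. by case/andP: q01. Qed.
Let q1 : q <= 1. Proof. by case/andP: q01. Qed.
Let tau1 : 1 <= tau := tau_ge1 N.
Let tau0 : 0 < tau. Proof. exact: lt_le_trans ltr01 tau1. Qed.
Let g0 : 0 < gam := gam_gt0 N.
#[local] Hint Resolve mX mXp measurable_sqn_nvec0 measurable_dot_nvec : core.

Context (r : R).
Hypothesis r0 : 0 < r.

Lemma tau_gamE t : 0 < t -> K <= t -> tau * t `^ (q - p / 2) * t = t `^ q * (K / t) `^ gam.
Proof. by move=> t0 Kt; exact: (tau_kap N Kt q). Qed.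

(** If [t >= K], the deviation bound applies and its factor [t] is absorbed by [1 + D]. If [t < K],
    the excess is bounded by the form itself, and [t] to the power [gam] is at most [tau]. *)
Lemma model_form_bound (B : 'M[R]_n) (D delta : R) :
  (forall x, sqn (B *m x) <= r * sqn x) ->
  0 < \tr (B^T *m B) / r -> \tr (B^T *m B) / r <= D -> 0 < delta ->
  (Ex P (fun w => Num.max 0 (sqn (B *m nv w) / r
      - (1 + delta) * (\tr (B^T *m B) / r)) `^ q)%R <=
   ((upC k q delta + 2) *
    (tau * (1 + D) * (\tr (B^T *m B) / r) `^ (q - p / 2)))%:E)%E.
Proof.
move=> Br; set t := \tr (B^T *m B) / r => t0 tD d0.
have u0 := upC_gt0 k q delta.
have s0 w : 0 <= sqn (B *m nv w) / r by rewrite divr_ge0 ?sqn_ge0 ?ltW.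
have ms : measurable_fun setT (fun w => sqn (B *m nv w) / r) by meas.
set F := tau * (1 + D) * t `^ (q - p / 2).
have tF : tau * t `^ (q - p / 2) * t <= F.
  rewrite /F -!mulrA ler_wpM2l ?(ltW tau0) // mulrC ler_wpM2r ?powR_ge0 //; lra.
have F0 : 0 <= F.
  apply: le_trans (tF); apply: mulr_ge0; last exact: ltW.
  by apply: mulr_ge0; [exact: ltW|exact: powR_ge0].
have [Kt|tK] := leP K t.
  apply: le_trans (gram_upper N q01 r0 Br Kt d0) _; rewrite lee_fin -/t.
  rewrite -tau_gamE //; apply: (@le_trans _ _ (upC k q delta * F)).
    by rewrite ler_wpM2l // ltW.
  by rewrite ler_wpM2r //; lra.
have Et : (Ex P (fun w => sqn (B *m nv w) / r)%R <= t%:E)%E.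
  rewrite (@eq_Ex _ _ _ _ _ (fun w => r^-1 * sqn (B *m nv w))); last first.
    by move=> w; rewrite mulrC.
  by rewrite (Ex_sqn_nvecZ N) ?invr_ge0 ?(ltW r0) // mulrC.
apply: (@le_trans _ _ (2 * t `^ q)%:E).
  apply: le_trans (Ex_powR_le q01 ms s0 t0 Et).
  apply: le_Ex; try by side.
  - by apply: measurable_pos_powR; meas.
  - exact: (measurableT_comp (measurable_powR q)).
  - move=> w; rewrite ge0_ler_powR ?nnegrE ?(ltW q0) ?le_max ?lexx // ge_max s0 /=.
    by rewrite gerBl mulr_ge0 ?(ltW t0) //; lra.
rewrite lee_fin; apply: (@le_trans _ _ (2 * F)); last by rewrite ler_wpM2r //; lra.
rewrite ler_wpM2l //; apply: le_trans tF.
have -> : t `^ q = t `^ (q - p / 2) * t `^ gam * t.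
  rewrite -{4}(powRr1 (ltW t0)) -!powRD ?(gt_eqF t0) ?implybT //.
  by congr (_ `^ _); lra.
have tg : t `^ gam <= tau.
  by rewrite -(K_powR N) ge0_ler_powR ?nnegrE ?(ltW g0) ?ltW.
by rewrite ler_wpM2r ?(ltW t0) // mulrC ler_wpM2r ?powR_ge0.
Qed.

Definition lineC (delta : R) : R := delta `^ (q - k.+1%:R) * (3 * rosC R k).

Lemma model_dot_bound (B : 'M[R]_n) u (t D delta : R) :
  (forall x, sqn (B *m x) <= r * sqn x) -> sqn u <= 1 ->
  0 < t -> t <= D -> 0 < delta ->
  (Ex P (fun w => Num.max 0 (dot u (B *m nv w) ^+ 2 / r - delta * t) `^ q)%R <=
   (lineC delta * (tau * (1 + D) * t `^ (q - p / 2)))%:E)%E.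
Proof.
move=> Br u1 t0 tD d0.
have y0 : 0 < delta * t by rewrite mulr_gt0.
apply: le_trans (dot_upper N q01 r0 Br u1 y0) _; rewrite lee_fin.
rewrite powRM ?(ltW d0) ?(ltW t0) // /lineC.
have C0 := ltW (rosC_gt0 R k).
have Kk : K ^+ k <= tau.
  apply: (@le_trans _ _ (K `^ gam)); last by rewrite (K_powR N).
  by rewrite -powR_mulrn ?(ltW K0) // ler_powR // (k_le_gam N).
have p2 := noise_p N.
(* The exponents differ by [p / 2 - k.+1], which lies between 0 and 1: the extra power of [t] is at
   most 1 or at most [t], hence at most [1 + D]. *)
have tt : t `^ (q - k.+1%:R) <= (1 + D) * t `^ (q - p / 2).
  have -> : q - k.+1%:R = (p / 2 - k.+1%:R) + (q - p / 2) by lra.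
  rewrite (@powRD _ t (p / 2 - k.+1%:R) (q - p / 2)); last by rewrite (gt_eqF t0) implybT.
  rewrite ler_wpM2r ?powR_ge0 //.
  have e0 : 0 <= p / 2 - k.+1%:R.
    by have /andP[] := noise_k N => h _; lra.
  have e1 : p / 2 - k.+1%:R <= 1.
    by have := gam_le_k1 N; lra.
  have [t1|/ltW t1] := leP t 1.
    apply: (@le_trans _ _ 1); last by lra.
    by rewrite powR_le1 // t1 ltW.
  apply: (@le_trans _ _ t); last by lra.
  by rewrite -[leRHS](powRr1 (ltW t0)) ler_powR.
have h : K ^+ k * t `^ (q - k.+1%:R) <= tau * ((1 + D) * t `^ (q - p / 2)).
  by apply: ler_pM; rewrite ?powR_ge0 ?exprn_ge0 ?(ltW K0).
have c0 : 0 <= delta `^ (q - k.+1%:R) * (3 * rosC R k).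
  by rewrite mulr_ge0 ?powR_ge0 // mulr_ge0.
by have := ler_wpM2l c0 h; lra.
Qed.

Lemma Ex_dot_sqr_le (B : 'M[R]_n) u :
  (forall x, sqn (B *m x) <= r * sqn x) -> sqn u <= 1 ->
  (Ex P (fun w => dot u (B *m nv w) ^+ 2 / r)%R <= 1%:E)%E.
Proof.
move=> Br u1.
have E w : dot u (B *m nv w) ^+ 2 / r =
    r^-1 * nsq (fun _ : 'I_1 => \sum_i (B^T *m u) i 0 * X i w).
  by rewrite /nsq big_ord1 dot_nvec mulrC.
under eq_Ex do rewrite E.
rewrite ExZ; try by side.
rewrite (second_moment N (fun i (_ : 'I_1) => (B^T *m u) i 0)).
have -> : \sum_i nsq (fun _ : 'I_1 => (B^T *m u) i 0) = sqn (B^T *m u).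
  by apply: eq_bigr => i _; rewrite /nsq big_ord1.
rewrite -EFinM lee_fin ler_pdivrMl // mulr1.
apply: le_trans (sqn_trmx_le (ltW r0) Br u) _.
by rewrite -[leRHS]mulr1 ler_wpM2l // ltW.
Qed.

Lemma null_model_dot_bound (B : 'M[R]_n) u :
  (forall x, sqn (B *m x) <= r * sqn x) -> sqn u <= 1 ->
  (Ex P (fun w => (dot u (B *m nv w) ^+ 2 / r) `^ q)%R <= 2%:E)%E.
Proof.
move=> Br u1.
have x0 w : 0 <= dot u (B *m nv w) ^+ 2 / r by rewrite divr_ge0 ?sqr_ge0 ?ltW.
have mx : measurable_fun setT (fun w => dot u (B *m nv w) ^+ 2 / r) by meas.
have := Ex_powR_le q01 mx x0 ltr01 (Ex_dot_sqr_le Br u1).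
by rewrite powR1 mulr1.
Qed.

Definition badC (delta : R) : R :=
  2 `^ q * ((loC k delta + delta ^- k.+1 * (3 * rosC R k)) * 2 `^ gam)
  + upC k q 1 + 4.

Lemma loC_ge0 (delta : R) : 0 < delta -> 0 <= loC k delta.
Proof.
move=> d0; rewrite /loC; have h1 := offC_ge0 R k; have h2 := truncC_ge0 R k.
have h3 : 0 <= 4 / delta by rewrite divr_ge0 // ltW.
by nonneg.
Qed.

(** If the expected total noise [n_] is below [2 * K], a first moment bound suffices. Otherwise the
    noise is cut at [2 * n_]: the part below costs the probability of [E], the part above is an
    upper deviation. Both are of order [n_ ^ q * (K / n_) ^ gam], which is at most [K ^ q] because
    [q <= gam]. *)
Lemma bad_event_bound (B G : 'M[R]_n) u (E : set T) (delta : R) :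
  q <= gam -> 0 < delta ->
  (forall x, sqn (B *m x) <= r * sqn x) ->
  (forall x, sqn (G *m x) <= r * sqn x) -> sqn u <= 1 ->
  0 < \tr (B^T *m B) / r ->
  \tr (B^T *m B) / r <= 2 * (\tr (G^T *m G) / r) ->
  measurable E ->
  (forall w, E w -> sqn (G *m nv w) / r <= (1 - delta) * (\tr (G^T *m G) / r)
     \/ delta * (\tr (G^T *m G) / r) <= dot u (B *m nv w) ^+ 2 / r) ->
  (Ex P (fun w => (sqn (B *m nv w) / r) `^ q * \1_E w)%R <=
   (badC delta * K `^ q)%:E)%E.
Proof.
move=> qg d0 Br Gr u1; set n_ := \tr (B^T *m B) / r.
set t := \tr (G^T *m G) / r => n0 nt mE Esub.
have u0 := upC_gt0 k q (1 : R).
have l0 := loC_ge0 d0.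
have c0 := rosC_gt0 R k.
have dk0 : 0 <= delta ^- k.+1 by rewrite invr_ge0 exprn_ge0 // ltW.
have s0 w : 0 <= sqn (B *m nv w) / r by rewrite divr_ge0 ?sqn_ge0 ?ltW.
have ms : measurable_fun setT (fun w => sqn (B *m nv w) / r) by meas.
have mq : measurable_fun setT (fun w => (sqn (B *m nv w) / r) `^ q).
  exact: (measurableT_comp (measurable_powR q)).
have mI : measurable_fun setT (\1_E : T -> R) by exact: measurable_indic.
have I0 w : 0 <= \1_E w :> R by rewrite indicE.
have I1 w : \1_E w <= 1 :> R by rewrite indicE lern1 leq_b1.
set bC := loC k delta + delta ^- k.+1 * (3 * rosC R k).
have bC0 : 0 <= bC by rewrite addr_ge0 // mulr_ge0 // mulr_ge0 // ltW.
have pb0 : 0 <= 2 `^ q * (bC * 2 `^ gam) by rewrite !mulr_ge0 ?powR_ge0.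
have Kq0 : 0 <= K `^ q by exact: powR_ge0.
have En : (Ex P (fun w => sqn (B *m nv w) / r)%R <= n_%:E)%E.
  rewrite (@eq_Ex _ _ _ _ _ (fun w => r^-1 * sqn (B *m nv w))); last first.
    by move=> w; rewrite mulrC.
  by rewrite (Ex_sqn_nvecZ N) ?invr_ge0 ?(ltW r0) // mulrC.
have [nK|Kn] := ltP n_ (2 * K).
  apply: (@le_trans _ _ (2 * n_ `^ q)%:E).
    apply: le_trans (Ex_powR_le q01 ms s0 n0 En); apply: le_Ex; try by side.
    by move=> w; rewrite ler_piMr ?powR_ge0.
  rewrite lee_fin; apply: (@le_trans _ _ (4 * K `^ q)).
    have -> : 4 * K `^ q = 2 * (2 * K `^ q) by ring.
    rewrite ler_wpM2l //; apply: (@le_trans _ _ ((2 * K) `^ q)).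
      by rewrite ge0_ler_powR ?nnegrE ?(ltW q0) ?(ltW n0) ?(ltW nK) // mulr_ge0 // ltW.
    rewrite powRM ?(ltW K0) // ler_wpM2r //.
    by rewrite -[leRHS](@powRr1 _ 2) // ler_powR // ler1n.
  by rewrite ler_wpM2r // /badC -/bC; lra.
have Kt : K <= t by lra.
have Kn' : K <= n_ by lra.
have t0 : 0 < t by exact: lt_le_trans Kt.
set kn := (K / n_) `^ gam.
have kn0 : 0 <= kn by exact: powR_ge0.
have ktn : (K / t) `^ gam <= 2 `^ gam * kn.
  have Kn0 : 0 <= K / n_ by rewrite divr_ge0 // ltW.
  have Kt0 : 0 <= K / t by rewrite divr_ge0 // ltW.
  have h : K / t <= 2 * (K / n_).
    have -> : 2 * (K / n_) = K * (n_ / 2)^-1 by field; exact: lt0r_neq0.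
    have nh0 : n_ / 2 \is Num.pos by rewrite posrE; apply: divr_gt0.
    rewrite ler_wpM2l ?(ltW K0) // lef_pV2 //.
    by rewrite ler_pdivrMr // mulrC.
  apply: (@le_trans _ _ ((2 * (K / n_)) `^ gam)); last by rewrite powRM.
  by rewrite ge0_ler_powR ?nnegrE ?(ltW g0) // mulr_ge0.
have PE : (Ex P (\1_E : T -> R) <= (bC * (2 `^ gam * kn))%:E)%E.
  have -> : Ex P (\1_E : T -> R) = P E by rewrite /Ex integral_indic // setIT.
  set E1 := [set w | sqn (G *m nv w) / r <= (1 - delta) * t].
  set E2 := [set w | delta * t <= dot u (B *m nv w) ^+ 2 / r].
  have mE1 : measurable E1.
    have mg : measurable_fun setT (fun w => sqn (G *m nv w) / r) by meas.
    have := @measurable_fun_ler _ T R setT _ (fun=> (1 - delta) * t) mg (measurable_cst _).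
    by move=> /(_ measurableT [set true]); rewrite setTI /preimage /= => h; apply: h.
  have mE2 : measurable E2.
    have mg : measurable_fun setT (fun w => dot u (B *m nv w) ^+ 2 / r) by meas.
    have := @measurable_fun_ler _ T R setT (fun=> delta * t) _ (measurable_cst _) mg.
    by move=> /(_ measurableT [set true]); rewrite setTI /preimage /= => h; apply: h.
  apply: (@le_trans _ _ (P (E1 `|` E2))).
    apply: le_measure => //.
    - by apply/mem_set.
    - by apply/mem_set; exact: measurableU.
  apply: le_trans (measureU2 _ mE1 mE2) _.
  have y0 : 0 < delta * t by rewrite mulr_gt0.
  apply: le_trans (leeD (gram_lower N r0 Gr Kt d0) (dot_tail N r0 Br u1 y0)) _.
  rewrite -EFinD lee_fin -/t.
  have h2 : (delta * t) ^- k.+1 * (3 * rosC R k * K ^+ k) <=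
      delta ^- k.+1 * (3 * rosC R k) * (K / t) `^ gam.
    rewrite exprMn invfM -!mulrA ler_wpM2l // mulrCA [leRHS]mulrA.
    rewrite [leLHS](_ : _ = 3 * rosC R k * (t ^- k.+1 * K ^+ k)); last by ring.
    rewrite ler_wpM2l //; first by rewrite mulr_ge0 // ltW.
    apply: le_trans (kap_exp N Kt).
    have -> : (K / t) ^+ k.+1 = t ^- k.+1 * K ^+ k.+1.
      by rewrite mulrC -exprVn -exprMn.
    rewrite ler_wpM2l //.
      by rewrite invr_ge0 exprn_ge0 // ltW.
    by rewrite ler_weXn2l.
  apply: le_trans (lerD (lexx _) h2) _; rewrite -mulrDl.
  by rewrite ler_wpM2l.
have nkn : n_ `^ q * kn <= K `^ q.
  rewrite /kn; apply: (@le_trans _ _ (n_ `^ q * (K / n_) `^ q)).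
    rewrite ler_wpM2l ?powR_ge0 // powR_mono_exp // divr_gt0 //=.
    by rewrite ler_pdivrMr // mul1r.
  have Kn0 : 0 <= K / n_ by rewrite divr_ge0 // ltW.
  have nE : n_ * (K / n_) = K by field; exact: lt0r_neq0.
  by have := @powRM R n_ (K / n_) q (ltW n0) Kn0; rewrite nE => ->.
have -> : badC delta * K `^ q = 2 `^ q * (bC * 2 `^ gam) * K `^ q
    + (upC k q 1 * K `^ q + 4 * K `^ q) by rewrite /badC -/bC; ring.
have up := gram_upper N q01 r0 Br Kn' ltr01.
apply: (@Ex_leD _ _ _ _ _ (fun w => (2 * n_) `^ q * \1_E w)
  (fun w => Num.max 0 (sqn (B *m nv w) / r - (1 + 1) * n_) `^ q)); try by side.
- by apply: measurable_pos_powR; meas.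
- clear up PE En; move=> w; rewrite indicE.
  have m0 x : 0 <= Num.max 0 x :> R by rewrite le_max lexx.
  case: (w \in E); last by rewrite !mulr0 add0r powR_ge0.
  have n20 : 0 <= 2 * n_ by apply: mulr_ge0 => //; exact: ltW.
  rewrite !mulr1; apply: le_trans (powR_subadd n20 (m0 _) q01).
  apply: ge0_ler_powR; rewrite ?nnegrE ?(ltW q0) ?s0 ?addr_ge0 //.
  have -> : 1 + 1 = 2 :> R by ring.
  by rewrite -lerBlDl le_max lexx orbT.
- apply: (@le_trans _ _ ((2 * n_) `^ q * (bC * (2 `^ gam * kn)))%:E).
    by apply: (@Ex_leZ _ _ _ _ _ _ _ (\1_E : T -> R)); try by side.
  rewrite lee_fin powRM ?(ltW n0) //.
  by clear up PE En; have := ler_wpM2l pb0 nkn; lra.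
- apply: le_trans up _; rewrite lee_fin -/n_ -/kn.
  apply: (@le_trans _ _ (upC k q 1 * K `^ q)).
    by rewrite ler_wpM2l // ltW.
  by rewrite lerDl mulr_ge0.
Qed.

End RiskBounds.

(** * Selection among countably many models *)

Section CountableSelection.
Context d (T : measurableType d) (R : realType) (P : probability T R).
Context (M : countType) (mhat : T -> M).
Hypothesis mmhat : forall m, measurable (mhat @^-1` [set m]).

(** Indexing by the integer code of the selected model gives a partition to which countable
    additivity applies; integers that code no model give the empty set. *)
Let E (k : nat) : set T := [set w | pickle (mhat w) = k].

Let E_case k : (exists m, pickle m = k /\ E k = mhat @^-1` [set m]) \/ E k = set0.
Proof.
case Ek : (pickle_inv k : option M) => [m|].
  left; exists m; have := @pickle_invK M k; rewrite Ek /= => mk; split=> //.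
  apply/seteqP; split=> w; rewrite /E /=; last by move=> ->.
  by rewrite -mk => /(pcan_inj pickleK).
right; apply/seteqP; split=> // w; rewrite /E /= => wk.
by move: Ek; rewrite -wk pickleK_inv.
Qed.

Let mE k : measurable (E k).
Proof. by case: (E_case k) => [[m [_ ->]]|->]. Qed.

Let EUT : \bigcup_k E k = setT.
Proof. by apply/seteqP; split=> // w _; exists (pickle (mhat w)). Qed.

Let triv : trivIset setT E.
Proof. by move=> i j _ _ [w [/= <- <-]]. Qed.

Lemma measurable_select (F : M -> T -> R) :
  (forall m, measurable_fun setT (F m)) ->
  measurable_fun setT (fun w => F (mhat w) w).
Proof.
move=> mF _ B mB; rewrite setTI.
have -> : (fun w => F (mhat w) w) @^-1` B =
    \bigcup_k (E k `&` (fun w => F (mhat w) w) @^-1` B).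
  by rewrite -setI_bigcupl EUT setTI.
apply: bigcupT_measurable => k.
case: (E_case k) => [[m [_ Em]]|->]; last by rewrite set0I.
have -> : E k `&` (fun w => F (mhat w) w) @^-1` B = mhat @^-1` [set m] `&` F m @^-1` B.
  by rewrite Em; apply/seteqP; split=> w [/= <-].
apply: measurableI => //; rewrite -[X in measurable X]setTI; exact: mF.
Qed.

(** On each event of the partition the selected function is one fixed [F m], and by positivity its
    integral there is at most its full expectation. *)
Lemma Ex_select_le (F : M -> T -> R) (b : M -> R) :
  (forall m, measurable_fun setT (F m)) -> (forall m w, 0 <= F m w) ->
  (forall m, 0 <= b m) -> (forall m, (Ex P (F m) <= (b m)%:E)%E) ->
  (Ex P (fun w => F (mhat w) w) <= \esum_(m in [set: M]) (b m)%:E)%E.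
Proof.
move=> mF F0 b0 Fb; have mS := measurable_select mF.
rewrite /Ex -EUT ge0_integral_bigcup //; first last.
- by move=> w _; rewrite lee_fin.
- by rewrite EUT; exact/measurable_EFinP.
pose g k : \bar R := if pickle_inv k is Some m then (b m)%:E else 0%E.
have g0 k : (0 <= g k)%E by rewrite /g; case: pickle_inv => // m; rewrite lee_fin.
apply: (@le_trans _ _ (\sum_(k <oo) g k)%E).
  apply: lee_nneseries => [k _ _|k _].
    by apply: integral_ge0 => w _; rewrite lee_fin.
  case: (E_case k) => [[m [mk Em]]|->]; last by rewrite integral_set0.
  have -> : g k = (b m)%:E by rewrite /g -mk pickleK_inv.
  apply: le_trans (Fb m).
  apply: (@le_trans _ _ (\int[P]_(w in E k) (F m w)%:E)%E).
    rewrite le_eqVlt; apply/orP; left; apply/eqP; apply: eq_integral => w.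
    by rewrite Em inE => /= ->.
  apply: ge0_subset_integral => //; last by move=> w _; rewrite lee_fin.
  exact/measurable_EFinP.
rewrite nneseries_esumT //.
have -> : (\esum_(k in [set: nat]) g k = \esum_(k in (@pickle M) @` [set: M]) g k)%E.
  rewrite [RHS]esum_mkcond; apply: eq_esum => k _; case: ifPn => // kN.
  rewrite /g; case Ek : (pickle_inv k : option M) => [m|] //.
  have := @pickle_invK M k; rewrite Ek /= => mk.
  by move: kN; rewrite notin_setE => -[]; exists m.
rewrite esum_image; last by move=> m m' _ _; exact: (pcan_inj pickleK).
by apply: le_esum => m _; rewrite /g pickleK_inv.
Qed.

End CountableSelection.

(** * Sums over countable families *)

Section Esum.
Context (R : realType) (M : choiceType).

Lemma esum_scale_le (c : R) (A : set M) (b : M -> R) : 0 <= c ->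
  (forall m, 0 <= b m) ->
  (\esum_(m in A) (c * b m)%:E <= c%:E * \esum_(m in A) (b m)%:E)%E.
Proof.
move=> c0 b0; rewrite ge_ereal_sup //= => _ [X [finX XA]] <-.
have -> : (\sum_(m \in X) (c * b m)%:E = c%:E * \sum_(m \in X) (b m)%:E)%E.
  rewrite !fsbig_finite //= ge0_sume_distrr.
    by apply: eq_bigr => m _; rewrite EFinM.
  by move=> m _; rewrite lee_fin.
rewrite lee_wpmul2l ?lee_fin //; apply: esum_ge; by exists X.
Qed.

Lemma esum1_le_counting (A : set M) :
  (\esum_(m in A) 1%:E <= counting A :> \bar R)%E.
Proof.
rewrite /counting; case: asboolP => [finA|_]; last exact: leey.
rewrite esum_fset //; rewrite fsbig_finite //= sumEFin lee_fin.
by rewrite big_const_seq count_predT iter_addr addr0.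
Qed.

Lemma esum_ge1term (A : set M) (b : M -> R) m : A m ->
  ((b m)%:E <= \esum_(m in A) (b m)%:E)%E.
Proof.
move=> Am; apply: esum_ge; exists [set m]; last by rewrite fsbig_set1.
by split=> // _ ->.
Qed.

End Esum.

(** * The oracle inequality along a sample *)

Section OracleInequality.
Context {R : realType}.
Variables (theta : R).
Hypothesis theta0 : 0 < theta.

(** Equals [1 + (4 / theta + 5 / 2) * (2 + theta)], the constant produced by [oracle_good]; it is
    large enough for [oracle_always] too. *)
Definition oracleC : R := 10 + 5 / 2 * theta + 8 / theta.
(** The relative error of the variance estimator that still leaves half of the surplus [theta] of
    the penalty. *)
Definition dev : R := theta / (2 * (1 + theta)).

Lemma dev_gt0 : 0 < dev.
Proof.
have t1 : 0 < 1 + theta by have := theta0; lra.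
by apply: divr_gt0 => //; apply: mulr_gt0.
Qed.

Lemma devE : (1 + theta) * (1 - dev) = 1 + theta / 2.
Proof. by rewrite /dev; field; apply: lt0r_neq0; have := theta0; lra. Qed.

Lemma double_mul_le (x a b : R) : 0 <= a -> 0 <= b -> x ^+ 2 <= a * b ->
  `|2 * x| <= a + b.
Proof.
move=> a0 b0 h; rewrite -(@ler_pXn2r _ 2) ?nnegrE ?addr_ge0 ?normr_ge0 //.
rewrite real_normK ?num_real //.
by have := sqr_ge0 (a - b); move: h; rewrite !expr2 => h1 h2; lra.
Qed.

(* b, N, Q, a: squared bias, quadratic noise, squared noise along the bias and
   expected noise of a model; the suffix h marks the selected model. *)
Variables (v b bh N Nh Q Qh a ah V x xh : R).
Hypotheses (v0 : 0 <= v) (b0 : 0 <= b) (bh0 : 0 <= bh) (N0 : 0 <= N) (Nh0 : 0 <= Nh).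
Hypotheses (Q0 : 0 <= Q) (Qh0 : 0 <= Qh) (a0 : 0 <= a) (ah0 : 0 <= ah) (V0 : 0 <= V).
Hypothesis xQ : x ^+ 2 <= v * b * Q.
Hypothesis xhQ : xh ^+ 2 <= v * bh * Qh.
Hypothesis crit : bh + 2 * xh - v * Nh + (1 + theta) * ah * V <=
  b + 2 * x - v * N + (1 + theta) * a * V.

Local Notation xi2 := (Num.max 0 (Q - theta / 16 * a)).

Let xi20 : 0 <= v * xi2.
Proof. by rewrite mulr_ge0 // le_max lexx. Qed.

Ltac slra :=
  pose proof theta0; pose proof b0; pose proof bh0; pose proof xi20;
  lra.

(** The cross term of the competing model may use up a whole bias [b], but that of the selected
    model only half of [bh], since the other half must survive on the left. *)
Let basic : bh / 2 + (1 + theta) * ah * V <=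
  2 * b + v * Q + (1 + theta) * a * V + v * (Nh + 2 * Qh).
Proof.
have h1 : `|2 * x| <= b + v * Q.
  by apply: double_mul_le; rewrite ?mulr_ge0 //; apply: le_trans xQ _; apply: eq_ler; ring.
have h2 : `|2 * xh| <= bh / 2 + 2 * v * Qh.
  apply: double_mul_le; rewrite ?mulr_ge0 ?divr_ge0 //.
  by apply: le_trans xhQ _; apply: eq_ler; field.
move: h1 h2; rewrite !ler_norml => /andP[_ h1] /andP[h2 _].
by have := mulr_ge0 v0 N0; have := crit; slra.
Qed.

Let vQ : v * Q <= theta / 16 * (v * a) + v * xi2.
Proof.
have h : Q <= theta / 16 * a + xi2.
  by rewrite -lerBlDl le_max lexx orbT.
by have := ler_wpM2l v0 h; slra.
Qed.

(** Of the surplus [theta / 2], the quadratic noise of the selected model takes [theta / 8] and the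
    noise along its bias twice [theta / 16]. The remaining [theta / 4] bounds [v * ah], and through
    it the noise [v * Nh] in the loss. *)
Lemma oracle_good : (1 - dev) * v <= V ->
  bh + v * Nh <= oracleC * (b + v * a + a * V + v * xi2
    + v * Num.max 0 (Nh - (1 + theta / 8) * ah)
    + v * Num.max 0 (Qh - theta / 16 * ah)).
Proof.
move=> Vv; set y1 := Num.max 0 (Nh - _); set y2 := Num.max 0 (Qh - _).
have y10 : 0 <= v * y1 by rewrite mulr_ge0 // le_max lexx.
have y20 : 0 <= v * y2 by rewrite mulr_ge0 // le_max lexx.
have h1 : v * Nh <= (1 + theta / 8) * (v * ah) + v * y1.
  have h : Nh <= (1 + theta / 8) * ah + y1 by rewrite -lerBlDl le_max lexx orbT.
  by have := ler_wpM2l v0 h; slra.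
have h2 : v * Qh <= theta / 16 * (v * ah) + v * y2.
  have h : Qh <= theta / 16 * ah + y2 by rewrite -lerBlDl le_max lexx orbT.
  by have := ler_wpM2l v0 h; slra.
have h3 : (1 + theta / 2) * (v * ah) <= (1 + theta) * ah * V.
  have t1 : 0 <= (1 + theta) * ah by rewrite mulr_ge0 //; slra.
  have := ler_wpM2l t1 Vv.
  have -> : (1 + theta) * ah * ((1 - dev) * v) = ((1 + theta) * (1 - dev)) * (v * ah) by ring.
  by rewrite devE.
set Gam := 2 * b + theta / 16 * (v * a) + v * xi2 + (1 + theta) * (a * V)
  + 2 * (v * y1) + 2 * (v * y2).
have va0 : 0 <= v * a by exact: mulr_ge0.
have vah0 : 0 <= v * ah by exact: mulr_ge0.
have aV0 : 0 <= a * V by exact: mulr_ge0.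
have key : bh / 2 + theta / 4 * (v * ah) <= Gam.
  by rewrite /Gam; have := basic; have := vQ; slra.
have tva : 0 <= theta / 4 * (v * ah) by rewrite mulr_ge0 // divr_ge0 // ltW.
have k1 : bh <= 2 * Gam by slra.
have k2 : v * ah <= 4 / theta * Gam.
  have t4 : 0 <= 4 / theta by rewrite divr_ge0 // ltW.
  have h : theta / 4 * (v * ah) <= Gam by slra.
  have := ler_wpM2l t4 h.
  have -> : 4 / theta * (theta / 4 * (v * ah)) = v * ah.
    by field; exact: lt0r_neq0.
  by [].
have k3 : (1 + theta / 8) * (v * ah) <= (1 + theta / 8) * (4 / theta * Gam).
  by rewrite ler_wpM2l //; slra.
have k4 : (1 + theta / 8) * (4 / theta * Gam) = (4 / theta + 1 / 2) * Gam.
  by field; exact: lt0r_neq0.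
set Sm := b + v * a + a * V + v * xi2 + v * y1 + v * y2.
have S0 : 0 <= Sm by rewrite !addr_ge0.
have GS : Gam <= (2 + theta) * Sm.
  rewrite /Gam /Sm.
  have := mulr_ge0 (ltW theta0) b0; have := mulr_ge0 (ltW theta0) va0.
  have := mulr_ge0 (ltW theta0) aV0; have := mulr_ge0 (ltW theta0) xi20.
  have := mulr_ge0 (ltW theta0) y10; have := mulr_ge0 (ltW theta0) y20.
  by slra.
have t4 : 0 <= 4 / theta + 5 / 2 by have : 0 <= 4 / theta by [rewrite divr_ge0 // ltW]; slra.
have := ler_wpM2l t4 GS.
have -> : (4 / theta + 5 / 2) * ((2 + theta) * Sm) = (oracleC - 1) * Sm.
  by rewrite /oracleC; field; exact: lt0r_neq0.
have : v * y1 <= Sm by rewrite /Sm; slra.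
by move=> h5 h6; slra.
Qed.

(** Only the sign of [V] is used: the penalty of the selected model is dropped and both of its noise
    terms are replaced by the common bound [E]. *)
Lemma oracle_always E : Nh <= E -> Qh <= E ->
  bh + v * Nh <= oracleC * (b + v * a + a * V + v * xi2 + v * E).
Proof.
move=> NE QE.
have va0 : 0 <= v * a by exact: mulr_ge0.
have aV0 : 0 <= a * V by exact: mulr_ge0.
have ahV0 : 0 <= (1 + theta) * ah * V by rewrite !mulr_ge0 //; slra.
have vE0 : 0 <= v * E by rewrite mulr_ge0 // (le_trans Nh0).
have h1 := ler_wpM2l v0 NE; have h2 := ler_wpM2l v0 QE.
have c8 : 0 <= 8 / theta by rewrite divr_ge0 // ltW.
have k : bh + v * Nh <= 4 * b + theta / 8 * (v * a) + 2 * (v * xi2)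
   + 2 * (1 + theta) * (a * V) + 7 * (v * E).
  by have := basic; have := vQ; slra.
apply: le_trans k _; rewrite /oracleC.
have tt (y : R) : 0 <= y -> 0 <= theta * y by move=> y0; rewrite mulr_ge0 // ltW.
have := tt _ b0; have := tt _ va0; have := tt _ aV0; have := tt _ xi20; have := tt _ vE0.
have cc (y : R) : 0 <= y -> 0 <= 8 / theta * y by move=> y0; rewrite mulr_ge0.
have := cc _ b0; have := cc _ va0; have := cc _ aV0; have := cc _ xi20; have := cc _ vE0.
by slra.
Qed.

End OracleInequality.

(** * Residual and loss of a projection estimator *)

Section Geometry.
Context {R : realType} (n : nat).
Implicit Types (h z s e : 'cV[R]_n).

(** The inverse of 0 being 0, a null vector has null direction; hence [sqn_direction] is an
    inequality. *)
Definition direction h : 'cV[R]_n := (Num.sqrt (sqn h))^-1 *: h.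

Lemma sqn_direction h : sqn (direction h) <= 1.
Proof.
rewrite sqnZ exprVn sqr_sqrtr ?sqn_ge0 //.
have [->|h0] := eqVneq (sqn h) 0; first by rewrite mulr0.
by rewrite mulVf.
Qed.

Lemma dot_direction h z : dot h z ^+ 2 = sqn h * dot (direction h) z ^+ 2.
Proof.
rewrite dotZl exprMn exprVn sqr_sqrtr ?sqn_ge0 // mulrA.
have [h0|h0] := eqVneq (sqn h) 0; last by rewrite divff // mul1r.
have /eqP -> : h == 0 by rewrite -sqn_eq0 h0.
by rewrite /dot big1 ?expr0n ?mulr0 // => i _; rewrite mxE mul0r.
Qed.

Lemma dot_direction_le h z : dot (direction h) z ^+ 2 <= sqn z.
Proof.
apply: le_trans (cauchy_dot _ _) _.
by rewrite -[leRHS]mul1r ler_wpM2r ?sqn_ge0 ?sqn_direction.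
Qed.

Context (U : {vspace 'cV[R]_n}) (A : 'M[R]_n).
Hypothesis AU : is_orthogonal_projection U A.
Context (Pn : 'M[R]_n) (s : 'cV[R]_n) (sigma : R).

(** The last term does not depend on the projection and cancels when two criteria are compared. *)
Lemma sqn_residual e :
  sqn (observation Pn s sigma e - A *m observation Pn s sigma e) =
  sqn (s - A *m s) + 2 * (sigma * dot (s - A *m s) (Pn *m e))
  - sigma ^+ 2 * sqn ((A *m Pn) *m e) + sigma ^+ 2 * sqn (Pn *m e).
Proof.
set z := Pn *m e; set h := s - A *m s; rewrite -mulmxA -/z.
have -> : observation Pn s sigma e - A *m observation Pn s sigma e =
    h + sigma *: (z - A *m z).
  by rewrite /observation mulmxDr -scalemxAr scalerBr opprD addrACA.
rewrite sqnD sqnZ dotZr.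
have hz : dot h (A *m z) = 0 by rewrite dotC (proj_dot AU).
have E : dot h (z - A *m z) = dot h z.
  by rewrite dotDr -(scaleN1r (A *m z)) dotZr hz mulr0 addr0.
have : sqn (A *m z + (z - A *m z)) = sqn (A *m z) + sqn (z - A *m z).
  exact: (proj_pythagoras AU).
by rewrite E addrC subrK => ->; ring.
Qed.

Lemma sqn_loss e :
  sqn (s - A *m observation Pn s sigma e) =
  sqn (s - A *m s) + sigma ^+ 2 * sqn ((A *m Pn) *m e).
Proof.
have -> : s - A *m observation Pn s sigma e =
    A *m (- sigma *: (Pn *m e)) + (s - A *m s).
  rewrite /observation mulmxDr opprD addrA addrC; congr (_ + _).
  by rewrite -!scalemxAr scaleNr.
rewrite (proj_pythagoras AU) addrC; congr (_ + _).
by rewrite -scalemxAr sqnZ sqrrN mulmxA.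
Qed.

Lemma trace_proj : \tr (Pn^T *m A *m Pn) = \tr ((A *m Pn)^T *m (A *m Pn)).
Proof.
by rewrite trmx_mul (proj_sym AU) -!mulmxA (mulmxA A A) (proj_idem AU).
Qed.

Lemma trace_coproj : \tr (Pn^T *m (1%:M - A) *m Pn) =
  \tr ((Pn - A *m Pn)^T *m (Pn - A *m Pn)).
Proof.
have -> : Pn - A *m Pn = (1%:M - A) *m Pn by rewrite mulmxBl mul1mx.
have AT : (1%:M - A)^T = 1%:M - A by rewrite linearB /= trmx1 (proj_sym AU).
rewrite trmx_mul AT -!mulmxA (mulmxA (1%:M - A)).
have -> : (1%:M - A) *m (1%:M - A) = 1%:M - A.
  by rewrite mulmxBr mulmx1 mulmxBl mul1mx (proj_idem AU) subrr subr0.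
by [].
Qed.

(* Completing the square: the bias can lower the residual only through the noise
   along its own direction. *)
Lemma sqn_residual_ge e :
  sigma ^+ 2 * (sqn ((Pn - A *m Pn) *m e) - dot (direction (s - A *m s)) (Pn *m e) ^+ 2)
  <= sqn (observation Pn s sigma e - A *m observation Pn s sigma e).
Proof.
rewrite sqn_residual; set h := s - A *m s; set z := Pn *m e.
have : sqn (A *m z + (z - A *m z)) = sqn (A *m z) + sqn (z - A *m z).
  exact: (proj_pythagoras AU).
rewrite addrC subrK => zE.
have -> : (Pn - A *m Pn) *m e = z - A *m z by rewrite mulmxBl -mulmxA.
rewrite -mulmxA -/z zE.
have : `|2 * (sigma * dot h z)| <= sqn h + sigma ^+ 2 * dot (direction h) z ^+ 2.
  apply: double_mul_le; [exact: sqn_ge0|by apply: mulr_ge0; exact: sqr_ge0|].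
  by rewrite exprMn (dot_direction h z) mulrCA.
by rewrite ler_norml => /andP[h1 _]; lra.
Qed.

Lemma sqn_residual_le e :
  sqn (observation Pn s sigma e - A *m observation Pn s sigma e) <=
  2 * sqn (s - A *m s) + 2 * sigma ^+ 2 * sqn ((Pn - A *m Pn) *m e).
Proof.
have -> : observation Pn s sigma e - A *m observation Pn s sigma e =
    (s - A *m s) + sigma *: ((Pn - A *m Pn) *m e).
  rewrite /observation mulmxDr mulmxBl scalerBr -scalemxAr mulmxA.
  by rewrite opprD addrACA.
rewrite sqnD; set h := s - _; set z := sigma *: _.
have : `|2 * dot h z| <= sqn h + sqn z.
  by apply: double_mul_le; rewrite ?sqn_ge0 // cauchy_dot.
rewrite ler_norml => /andP[_]; rewrite sqnZ; lra.
Qed.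

End Geometry.

(** * Risk of the selected estimator *)

Section Risk.
Context (R : realType) (n : nat) (Pn : 'M[R]_n) (s : 'cV[R]_n) (sigma tau : R).
Context d (T : measurableType d) (P : probability T R).
Context (eps : 'I_n -> {RV P >-> R}).
Context (M : countType) (S : M -> {vspace 'cV[R]_n}) (pi_ : M -> 'M[R]_n).
Context (V : {vspace 'cV[R]_n}) (pi : 'M[R]_n) (mhat : T -> M).
Context (p q theta : R) (k : nat).
Hypothesis N : noise eps p tau k.
Hypothesis theta0 : 0 < theta.
Hypothesis q01 : 0 < q <= 1.
Hypothesis qp : 2 * (q + 1) < p.
Hypothesis Pn0 : Pn != 0.
Hypothesis sigma0 : 0 < sigma.
Hypothesis SP : forall m, (S m <= imspace Pn)%VS.
Hypothesis piS : forall m, is_orthogonal_projection (S m) (pi_ m).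
Hypothesis piV : is_orthogonal_projection V pi.
Hypothesis trV : \tr (Pn^T *m pi *m Pn) <= \tr (Pn^T *m Pn) / 2.
Hypothesis mmhat : forall m, measurable (mhat @^-1` [set m]).
Local Notation Y w := (observation Pn s sigma (nvec eps w)).
Hypothesis minimizer : forall w m,
  criterion Pn pi theta (pi_ (mhat w)) (Y w) <= criterion Pn pi theta (pi_ m) (Y w).

Local Notation K := (scaleK p tau).
Local Notation gam := (p / 2 - 1).
Local Notation r := (specnorm Pn ^+ 2).
Local Notation e w := (nvec eps w).
Local Notation tr m := (\tr (Pn^T *m pi_ m *m Pn)).
Local Notation t m := (tr m / r).
Local Notation G := (Pn - pi *m Pn).
Local Notation v := (sigma ^+ 2 * r).

Let q0 : 0 < q. Proof. by case/andP: q01. Qed.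
Let qg : q <= gam. Proof. by have := qp; lra. Qed.
Let r0 : 0 < r. Proof. by rewrite exprn_gt0 // specnorm_gt0. Qed.
Let Pr x : sqn (Pn *m x) <= r * sqn x. Proof. exact: sqn_mulmx_le. Qed.
Let K0 : 0 < K := K_gt0 N.
Let tau1 : 1 <= tau := tau_ge1 N.
Let tau0 : 0 < tau. Proof. exact: lt_le_trans ltr01 tau1. Qed.
Let v0 : 0 < v. Proof. by rewrite mulr_gt0 // exprn_gt0. Qed.
#[local] Hint Resolve mX mXp measurable_sqn_nvec0 measurable_dot_nvec : core.

Let piPr m x : sqn ((pi_ m *m Pn) *m x) <= r * sqn x.
Proof. by rewrite -mulmxA; apply: le_trans (proj_sqn_le (piS m) _) (Pr x). Qed.

Let Gr x : sqn (G *m x) <= r * sqn x.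
Proof.
by rewrite mulmxBl -mulmxA; apply: le_trans (coproj_sqn_le piV _) (Pr x).
Qed.

Let trace_gt0 (B : 'M[R]_n) : B != 0 -> 0 < \tr (B^T *m B).
Proof.
move=> B0; rewrite trace_gram lt0r.
have nn i : 0 <= nsq (B^~ i) by exact: nsq_ge0.
rewrite sumr_ge0 // andbT; apply: contraNneq B0 => /psumr_eq0P B0.
apply/eqP/matrixP => i j; rewrite mxE.
have /eqP := B0 (fun i _ => nn i) j isT; rewrite /nsq psumr_eq0; last first.
  by move=> c _; exact: sqr_ge0.
by move/allP => /(_ i); rewrite mem_index_enum sqrf_eq0 => /(_ isT) /eqP.
Qed.

Let trG0 : \tr (Pn^T *m Pn) <= 2 * \tr (G^T *m G).
Proof.
rewrite -(trace_coproj piV) mulmxBr mulmx1 mulmxBl linearB /=.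
by have := trV; lra.
Qed.

Let trP0 : 0 < \tr (Pn^T *m Pn). Proof. exact: trace_gt0. Qed.

Let trGp : 0 < \tr (G^T *m G). Proof. by have := trG0; have := trP0; lra. Qed.

Let tE m : t m = \tr ((pi_ m *m Pn)^T *m (pi_ m *m Pn)) / r.
Proof. by rewrite (trace_proj (piS m)). Qed.

Let t0 m : 0 <= t m.
Proof.
rewrite tE divr_ge0 ?(ltW r0) // trace_gram sumr_ge0 // => i _; exact: nsq_ge0.
Qed.

Let n0 : (0 < n)%N := noise_dim N.
Let nR0 : 0 < n%:R :> R. Proof. by rewrite ltr0n. Qed.

(** Null models receive the value 1, so that one sum over all models accounts for [N0] as well as
    for the sum in [Rn]. *)
Definition sel_weight m : R :=
  if S m == 0%VS then 1 else
  (1 + tr m / specnorm (pi_ m *m Pn) ^+ 2) * t m `^ (q - p / 2).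

Lemma proj_null m : S m == 0%VS -> pi_ m = 0.
Proof.
move=> /eqP S0; apply/matrixP => i j; rewrite mxE.
have [h _] := piS m (delta_mx j 0); rewrite S0 memv0 in h.
by have /matrixP/(_ i 0) := eqP h; rewrite -colE !mxE.
Qed.

(** As [S m] lies in the image of [Pn], a null product would make [pi_ m] vanish on [S m], where it
    is the identity. *)
Lemma proj_nonnull m : S m != 0%VS -> pi_ m *m Pn != 0.
Proof.
move=> S0; apply/eqP => B0; move/eqP: S0; apply.
apply/eqP; rewrite -subv0; apply/subvP => x xS; rewrite memv0.
have /memv_imgP[y _ xy] := subvP (SP m) x xS.
move: xy; rewrite lfunE /= => xy.
by rewrite -(proj_fixed (piS m) xS) xy mulmxA B0 mul0mx.
Qed.

Lemma sel_pos m : S m != 0%VS ->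
  0 < t m /\ t m <= tr m / specnorm (pi_ m *m Pn) ^+ 2.
Proof.
move=> S0; have B0 := proj_nonnull S0.
have a0 : 0 < tr m by rewrite (trace_proj (piS m)) trace_gt0.
split; first by rewrite divr_gt0.
have s0 : 0 < specnorm (pi_ m *m Pn) ^+ 2 by rewrite exprn_gt0 // specnorm_gt0.
rewrite ler_wpM2l ?(ltW a0) // lef_pV2 ?posrE //.
rewrite lerXn2r ?nnegrE ?specnorm_ge0 //; apply: specnorm_le => x.
by rewrite -mulmxA (proj_sqn_le (piS m)).
Qed.

Lemma sel_weight_ge0 m : 0 <= sel_weight m.
Proof.
rewrite /sel_weight; case: ifPn => // S0; have [h1 h2] := sel_pos S0.
by rewrite mulr_ge0 ?powR_ge0 //; lra.
Qed.

Definition dirm m := direction (s - pi_ m *m s).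
Definition xi1 m w : R := Num.max 0 (sqn ((pi_ m *m Pn) *m e w) / r
  - (1 + theta / 8) * t m).
Definition xi2 m w : R := Num.max 0 (dot (dirm m) (Pn *m e w) ^+ 2 / r
  - theta / 16 * t m).
(** [upC + 2] for the quadratic excess, [lineC] for the excess along the bias, and a last 2 for null
    models. *)
Definition selC : R := upC k q (theta / 8) + 2 + lineC q k (theta / 16) + 2.

Lemma lineC_ge0 : 0 <= lineC q k (theta / 16).
Proof.
by rewrite /lineC; have := rosC_gt0 R k => h; nonneg.
Qed.

Lemma selC_ge0 : 0 <= selC.
Proof.
have := upC_gt0 k q (theta / 8); have := lineC_ge0.
by rewrite /selC => *; lra.
Qed.

Lemma measurable_xi1 m : measurable_fun setT (fun w => xi1 m w `^ q).
Proof. by apply: measurable_pos_powR; meas. Qed.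

Lemma measurable_xi2 m : measurable_fun setT (fun w => xi2 m w `^ q).
Proof. by apply: measurable_pos_powR; meas. Qed.
#[local] Hint Resolve measurable_xi1 measurable_xi2 : core.

Lemma sel_bound m :
  (Ex P (fun w => xi1 m w `^ q + xi2 m w `^ q)%R <= (selC * (tau * sel_weight m))%:E)%E.
Proof.
have th16 : 0 < theta / 16 by rewrite divr_gt0.
have th8 : 0 < theta / 8 by rewrite divr_gt0.
have c1 := upC_gt0 k q (theta / 8); have c2 := lineC_ge0.
have u1 : sqn (dirm m) <= 1 by exact: sqn_direction.
(* A null model has no quadratic noise, and the noise along its bias has a [q]-th moment at most 2;
   [tau >= 1] puts this under the weight 1. *)
have [S0|S0] := boolP (S m == 0%VS).
  have w1 : sel_weight m = 1 by rewrite /sel_weight S0.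
  have x1 w : xi1 m w = 0.
    rewrite /xi1 (proj_null S0) mul0mx mul0mx mulmx0 mul0mx linear0 mul0r mulr0 subr0.
    have -> : sqn (0 : 'cV[R]_n) = 0 by apply/eqP; rewrite sqn_eq0.
    by rewrite mul0r maxxx.
  apply: (@le_trans _ _ 2%:E).
    apply: le_trans (null_model_dot_bound N q01 r0 Pr u1).
    apply: le_Ex; try by side.
    - by apply: (measurableT_comp (measurable_powR q)); meas.
    - move=> w; rewrite x1 powR0 ?gt_eqF // add0r.
      have x0 : 0 <= dot (dirm m) (Pn *m e w) ^+ 2 / r.
        by rewrite divr_ge0 ?sqr_ge0 ?ltW.
      rewrite ge0_ler_powR ?nnegrE ?(ltW q0) ?le_max ?lexx // ge_max x0 /=.
      by rewrite gerBl mulr_ge0 // ltW.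
  rewrite lee_fin w1 mulr1; have := ler_wpM2l selC_ge0 tau1; rewrite mulr1.
  by apply: le_trans; rewrite /selC; lra.
have [tp tD] := sel_pos S0.
have wE : sel_weight m = (1 + tr m / specnorm (pi_ m *m Pn) ^+ 2) * t m `^ (q - p / 2).
  by rewrite /sel_weight (negbTE S0).
set D := tr m / specnorm (pi_ m *m Pn) ^+ 2 in tD wE.
set F := tau * (1 + D) * t m `^ (q - p / 2).
have FE : tau * sel_weight m = F by rewrite wE /F mulrA.
have F0 : 0 <= F by rewrite -FE mulr_ge0 ?sel_weight_ge0 // ltW.
have h1 : (Ex P (fun w => xi1 m w `^ q)%R <= ((upC k q (theta / 8) + 2) * F)%:E)%E.
  have := @model_form_bound _ _ _ _ _ _ _ _ _ _ N q01 _ r0 (pi_ m *m Pn) D (theta / 8) (piPr m).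
  by rewrite -(trace_proj (piS m)); apply.
have h2 := @model_dot_bound _ _ _ _ _ _ _ _ _ _ N q01 _ r0 Pn (dirm m) (t m) D (theta / 16)
  Pr u1 tp tD th16.
have -> : selC * (tau * sel_weight m) = (upC k q (theta / 8) + 2) * F +
    (lineC q k (theta / 16) * F + 2 * F) by rewrite FE /selC; ring.
apply: (@Ex_leD _ _ _ _ _ (fun w => xi1 m w `^ q) (fun w => xi2 m w `^ q)) => //;
  try by side.
by apply: le_trans h2 _; rewrite lee_fin lerDl mulr_ge0.
Qed.

Local Notation V2 w := (r * sigma2_hat Pn pi (Y w)).

Let sqr_normn (x : 'cV[R]_n) : n%:R * normn x ^+ 2 = sqn x.
Proof. by rewrite normn_sqr mulrA divff ?mul1r // gt_eqF. Qed.

Lemma sigma2_hatE w : sigma2_hat Pn pi (Y w) = sqn (Y w - pi *m Y w) / \tr (G^T *m G).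
Proof. by rewrite /sigma2_hat sqr_normn (trace_coproj piV). Qed.

Lemma criterionE m w : n%:R * criterion Pn pi theta (pi_ m) (Y w) =
  sqn (Y w - pi_ m *m Y w) + (1 + theta) * t m * V2 w.
Proof.
rewrite /criterion /pen mulrDr sqr_normn; congr (_ + _).
move: (sigma2_hat _ _ _) (tr m) r r0 (n%:R : R) nR0 => a b c c0 e e0.
by field; rewrite !gt_eqF.
Qed.

Lemma sigma2_hat_ge0 w : 0 <= V2 w.
Proof.
by rewrite sigma2_hatE mulr_ge0 ?(ltW r0) // divr_ge0 ?sqn_ge0 // ltW.
Qed.

Lemma measurable_sigma2_hat : measurable_fun setT (fun w => sigma2_hat Pn pi (Y w)).
Proof.
under eq_fun do rewrite sigma2_hatE.
have -> : (fun w => sqn (Y w - pi *m Y w) / \tr (G^T *m G)) =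
   (fun w => (sqn ((s - pi *m s) + (sigma *: G) *m e w)) * (\tr (G^T *m G))^-1).
  apply/funext => w; congr (sqn _ / _).
  rewrite /observation mulmxDr -scalemxAl mulmxBl scalerBr -scalemxAr mulmxA.
  by rewrite opprD addrACA.
by apply: measurable_funM => //; exact: measurable_sqn_nvec.
Qed.

Definition bad_event : set T := [set w | sigma2_hat Pn pi (Y w) < (1 - dev theta) * sigma ^+ 2].

Lemma measurable_bad_event : measurable bad_event.
Proof.
have := @measurable_fun_ltr _ T R setT _ (fun=> (1 - dev theta) * sigma ^+ 2)
  measurable_sigma2_hat (measurable_cst _).
by move=> /(_ measurableT [set true]); rewrite setTI /preimage /= => h; apply: h.
Qed.

(** One term serves for every possible choice on the bad event, since projecting does not increase
    the norm of the noise. *)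
Definition full_noise w : R := sqn (Pn *m e w) / r * \1_bad_event w.

Lemma loss_le m w : sqn (s - pi_ (mhat w) *m Y w) <= oracleC theta *
  (sqn (s - pi_ m *m s) + v * t m + t m * V2 w + v * xi2 m w
   + v * xi1 (mhat w) w + v * xi2 (mhat w) w + v * full_noise w).
Proof.
set h := mhat w.
have v0' := ltW v0; have r0' := ltW r0.
have sN (a : R) : v * (a / r) = sigma ^+ 2 * a.
  by move: r r0 => c c0; field; exact: lt0r_neq0.
have xQ l : (sigma * dot (s - pi_ l *m s) (Pn *m e w)) ^+ 2 <=
    v * sqn (s - pi_ l *m s) * (dot (dirm l) (Pn *m e w) ^+ 2 / r).
  apply: eq_ler; rewrite exprMn (dot_direction (s - _)) -/(dirm l).
  by rewrite (mulrAC v) sN mulrA mulrAC.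
have crit : sqn (s - pi_ h *m s) + 2 * (sigma * dot (s - pi_ h *m s) (Pn *m e w))
    - v * (sqn ((pi_ h *m Pn) *m e w) / r) + (1 + theta) * t h * V2 w <=
    sqn (s - pi_ m *m s) + 2 * (sigma * dot (s - pi_ m *m s) (Pn *m e w))
    - v * (sqn ((pi_ m *m Pn) *m e w) / r) + (1 + theta) * t m * V2 w.
  have := minimizer w m; rewrite -(ler_pM2l nR0) !criterionE.
  rewrite !(sqn_residual (piS _)) -/h !sN => hh.
  by rewrite -(lerD2r (sigma ^+ 2 * sqn (Pn *m e w))) addrAC [leRHS]addrAC.
have b0 l : 0 <= sqn (s - pi_ l *m s) by exact: sqn_ge0.
have N0 l : 0 <= sqn ((pi_ l *m Pn) *m e w) / r by rewrite divr_ge0 ?sqn_ge0.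
have Q0 l : 0 <= dot (dirm l) (Pn *m e w) ^+ 2 / r by rewrite divr_ge0 ?sqr_ge0.
rewrite (sqn_loss (piS h)) -sN.
have x1p l : 0 <= v * xi1 l w by rewrite mulr_ge0 // le_max lexx.
have x2p l : 0 <= v * xi2 l w by rewrite mulr_ge0 // le_max lexx.
have oc : 0 <= oracleC theta.
  have : 0 <= 8 / theta by rewrite divr_ge0 // ltW.
  by rewrite /oracleC; have := theta0; lra.
have [wE|wE] := pselect (bad_event w).
  have -> : full_noise w = sqn (Pn *m e w) / r.
    by rewrite /full_noise indicE mem_set // mulr1.
  have NE : sqn ((pi_ h *m Pn) *m e w) / r <= sqn (Pn *m e w) / r.
    by rewrite ler_wpM2r ?invr_ge0 // -mulmxA (proj_sqn_le (piS h)).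
  have QE : dot (dirm h) (Pn *m e w) ^+ 2 / r <= sqn (Pn *m e w) / r.
    by rewrite ler_wpM2r ?invr_ge0 // dot_direction_le.
  apply: le_trans (oracle_always theta0 v0' (b0 m) (b0 h) (N0 m) (N0 h) (Q0 m)
    (Q0 h) (t0 m) (t0 h) (sigma2_hat_ge0 w) (xQ m) (xQ h) crit NE QE) _.
  by rewrite ler_wpM2l // lerD2r -[leRHS]addrA lerDl; exact: addr_ge0.
have -> : full_noise w = 0 by rewrite /full_noise indicE memNset // mulr0.
rewrite mulr0 addr0.
apply: (oracle_good theta0 v0' (b0 m) (b0 h) (N0 m) (Q0 m)
    (Q0 h) (t0 m) (t0 h) (sigma2_hat_ge0 w) (xQ m) (xQ h) crit).
rewrite mulrA (mulrC r) ler_wpM2r // leNgt; exact/negP.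
Qed.

(** [n] times the bracket of the oracle inequality, for a single model. *)
Definition mean_risk m : R :=
  sqn (s - pi_ m *m s) + sigma ^+ 2 * tr m + 2 * sqn (s - pi *m s).

Let tr_ge0 m : 0 <= tr m.
Proof.
rewrite (trace_proj (piS m)) trace_gram sumr_ge0 // => i _; exact: nsq_ge0.
Qed.

Lemma mean_risk_ge0 m : 0 <= mean_risk m.
Proof.
have s2 : 0 <= sigma ^+ 2 by exact: sqr_ge0.
have h1 : 0 <= sigma ^+ 2 * tr m by exact: mulr_ge0.
have h2 : 0 <= 2 * sqn (s - pi *m s) by rewrite mulr_ge0 ?sqn_ge0.
by rewrite /mean_risk !addr_ge0 ?sqn_ge0.
Qed.

Let tr_le m : tr m <= \tr (Pn^T *m Pn).
Proof.
rewrite (trace_proj (piS m)) !trace_gram; apply: ler_sum => i _.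
have := proj_sqn_le (piS m) (col i Pn).
rewrite /sqn /nsq => h; apply: le_trans (le_trans h _); apply: eq_ler.
  by apply: eq_bigr => c _; rewrite !mxE; congr (_ ^+ 2); apply: eq_bigr => j _; rewrite mxE.
by apply: eq_bigr => c _; rewrite mxE.
Qed.

(** [tr m] is at most the full trace, hence at most twice the denominator of the variance estimator;
    so the mean of [t m * V2 w] is at most [2 * mean_risk m]. The other factor 2 comes from
    [Ex_powR_le]. *)
Lemma Ex_penalty m :
  (Ex P (fun w => (t m * V2 w) `^ q)%R <= (4 * mean_risk m `^ q)%:E)%E.
Proof.
have X0 := mean_risk_ge0 m; have a0 := tr_ge0 m.
have s20 : 0 < sigma ^+ 2 by rewrite exprn_gt0.
have B0 : 0 <= sqn (s - pi *m s) by exact: sqn_ge0.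
have [tr0|tr0] := eqVneq (tr m) 0.
  rewrite (@eq_Ex _ _ _ _ _ (fun=> 0)) => [|w]; last first.
    by rewrite tr0 mul0r mul0r powR0 // gt_eqF.
  by rewrite Ex_cst lee_fin mulr_ge0 // powR_ge0.
have tp : 0 < tr m by rewrite lt0r tr0 a0.
have X1 : 0 < 2 * mean_risk m.
  have := mulr_gt0 s20 tp; rewrite /mean_risk.
  have := sqn_ge0 (s - pi_ m *m s); move: B0.
  by move: (sqn (s - pi_ m *m s)) (sqn (s - pi *m s)) (sigma ^+ 2 * tr m) => *; lra.
have mV : measurable_fun setT (fun w => t m * V2 w).
  by have h := measurable_sigma2_hat; meas.
have V0 w : 0 <= t m * V2 w by rewrite mulr_ge0 ?t0 ?sigma2_hat_ge0.
apply: (@le_trans _ _ (2 * (2 * mean_risk m) `^ q)%:E); last first.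
  rewrite lee_fin powRM // (_ : 4 = 2 * 2 :> R); last by ring.
  rewrite -mulrA ler_wpM2l // ler_wpM2r ?powR_ge0 //.
  by rewrite -[leRHS](@powRr1 _ 2) // ler_powR ?ler1n //; case/andP: q01.
apply: Ex_powR_le => //.
have gp := trGp; have gP := trG0; move: gp gP; move gE : (\tr (G^T *m G)) => g gp gP.
have E1 w : t m * V2 w <= tr m / g * (2 * sqn (s - pi *m s))
    + tr m / g * (2 * sigma ^+ 2) * sqn (G *m e w).
  rewrite sigma2_hatE gE.
  have -> : t m * (r * (sqn (Y w - pi *m Y w) / g)) =
      tr m / g * sqn (Y w - pi *m Y w).
    clear gE gP; move: (sqn _) (tr m) r r0 g gp => x y c c0 z z0.
    by field; rewrite !gt_eqF.
  rewrite -(mulrA (tr m / g)) -mulrDr ler_wpM2l ?divr_ge0 ?(ltW gp) //.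
  exact: sqn_residual_le.
have g2 : tr m / g <= 2 by rewrite ler_pdivrMr // (le_trans (tr_le m)).
have tg0 : 0 <= tr m / g by rewrite divr_ge0 // ltW.
have s1 : 0 <= tr m / g * (2 * sqn (s - pi *m s)) by rewrite mulr_ge0 // mulr_ge0.
have s2 : 0 <= tr m / g * (2 * sigma ^+ 2) by rewrite mulr_ge0 // mulr_ge0 // ltW.
apply: (@le_trans _ _ ((tr m / g * (2 * sqn (s - pi *m s)))
    + (tr m / g * (2 * sigma ^+ 2) * g))%:E).
  apply: (@Ex_leD _ _ _ _ _ (fun=> tr m / g * (2 * sqn (s - pi *m s)))
    (fun w => tr m / g * (2 * sigma ^+ 2) * sqn (G *m e w))) => //; try by side.
  - by move=> w; rewrite mulr_ge0 ?sqn_ge0.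
  - by rewrite Ex_cst.
  - by rewrite (Ex_sqn_nvecZ N) ?gE.
have -> : tr m / g * (2 * sigma ^+ 2) * g = 2 * (sigma ^+ 2 * tr m).
  by field; rewrite gt_eqF.
rewrite lee_fin /mean_risk.
have := ler_wpM2r B0 g2; have := sqn_ge0 (s - pi_ m *m s).
move: (sqn _) (sqn _) (tr m / g) (sigma ^+ 2 * tr m) => x y z u h1 h2.
by lra.
Qed.

Local Notation bad := (badC p q k (dev theta / 2)).

Let bad_gt0 : 0 < bad.
Proof.
have d0 : 0 < dev theta / 2 by rewrite divr_gt0 ?dev_gt0.
rewrite /badC; have := loC_ge0 k d0 => h1; have := upC_gt0 k q (1 : R) => h2.
have h3 := rosC_gt0 R k.
have h4 : 0 <= 2 `^ q * ((loC k (dev theta / 2) + (dev theta / 2) ^- k.+1 *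
    (3 * rosC R k)) * 2 `^ gam) by nonneg; rewrite ltW.
by apply: ltr_wpDl; [apply: addr_ge0 => //; exact: ltW|].
Qed.

Let full_noise_ge0 w : 0 <= full_noise w.
Proof.
by rewrite /full_noise mulr_ge0 ?indicE // divr_ge0 ?sqn_ge0 // ltW.
Qed.

Let measurable_full_noise : measurable_fun setT full_noise.
Proof.
have h : measurable_fun setT (\1_bad_event : T -> R).
  exact/measurable_indic/measurable_bad_event.
by rewrite /full_noise; meas.
Qed.

(** By [sqn_residual_ge], a small variance estimator means little noise off [V] or much noise along
    the bias of [V]; the tolerance [dev theta] is divided equally between the two. *)
Lemma Ex_full_noise :
  (Ex P (fun w => full_noise w `^ q)%R <= (bad * K `^ q)%:E)%E.
Proof.
have d0 : 0 < dev theta / 2 by rewrite divr_gt0 ?dev_gt0.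
have u1 := sqn_direction (s - pi *m s).
have NP : 0 < \tr (Pn^T *m Pn) / r by rewrite divr_gt0.
have NG : \tr (Pn^T *m Pn) / r <= 2 * (\tr (G^T *m G) / r).
  by rewrite mulrA ler_wpM2r ?invr_ge0 // ltW.
have := bad_event_bound N q01 r0 qg d0 Pr Gr u1 NP NG measurable_bad_event.
move=> h; apply: le_trans (h _).
  rewrite le_eqVlt; apply/orP; left; apply/eqP; apply: eq_Ex => w.
  rewrite /full_noise indicE; case: (w \in bad_event); first by rewrite !mulr1.
  by rewrite !mulr0 powR0 // gt_eqF.
move=> w; rewrite /bad_event /= sigma2_hatE => h1.
have h2 := @sqn_residual_ge _ _ _ _ piV Pn s sigma (e w).
have gp := trGp; move: h1 h2 gp; set g := \tr (G^T *m G); set a := sqn (G *m e w).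
set b := dot _ _ ^+ 2; rewrite ltr_pdivrMr // => h1 h2 gp.
have s2 : 0 < sigma ^+ 2 by rewrite exprn_gt0.
have h3 : a - b < (1 - dev theta) * g.
  rewrite -(ltr_pM2l s2); apply: le_lt_trans h2 _; move: h1.
  by rewrite -mulrA (mulrCA (1 - dev theta)).
have [ab|ab] := leP a ((1 - dev theta / 2) * g).
  by left; rewrite mulrA ler_wpM2r ?invr_ge0 // ltW.
right; rewrite mulrA ler_wpM2r ?invr_ge0 //; first exact: ltW.
by clear h; move: (dev theta) h3 ab => dd h3 ab; lra.
Qed.
Section FiniteWeight.
Context (W : R).
Hypothesis WE : (N0 S + \esum_(m in [set m | S m != 0%VS])
  ((1 + tr m / specnorm (pi_ m *m Pn) ^+ 2) * t m `^ (q - p / 2))%:E = W%:E)%E.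

Let Z : set M := [set m | \dim (S m) = 0%N].

Let ZE m : (m \in Z) = (S m == 0%VS).
Proof. by rewrite -dimv_eq0; apply/idP/eqP; rewrite inE. Qed.

Let nz_esum : (\esum_(m in [set m | S m != 0%VS])
  ((1 + tr m / specnorm (pi_ m *m Pn) ^+ 2) * t m `^ (q - p / 2))%:E =
  \esum_(m in ~` Z) (sel_weight m)%:E)%E.
Proof.
have -> : [set m | S m != 0%VS] = ~` Z.
  by apply/seteqP; split=> m /=; rewrite -dimv_eq0 => /eqP.
apply: eq_esum => m; rewrite /sel_weight -ZE => mZ.
by rewrite ifN //; apply/negP; rewrite inE.
Qed.

Lemma total_weight_le : (\esum_(m in [set: M]) (sel_weight m)%:E <= W%:E)%E.
Proof.
rewrite -WE nz_esum (esumID Z) ?setTI; last first.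
  by move=> m _; rewrite lee_fin sel_weight_ge0.
rewrite leeD2r //; apply: le_trans (esum1_le_counting _ Z).
by apply: le_esum => m mZ; rewrite /sel_weight -ZE mem_set.
Qed.

Lemma sel_weight_le m : sel_weight m <= W.
Proof.
rewrite -lee_fin; apply: le_trans total_weight_le.
exact: (@esum_ge1term _ _ setT).
Qed.

Lemma total_sel_bound :
  (\esum_(m in [set: M]) (selC * (tau * sel_weight m))%:E <= (selC * tau * W)%:E)%E.
Proof.
have c0 : 0 <= selC * tau by rewrite mulr_ge0 ?selC_ge0 // ltW.
under eq_esum do rewrite mulrA.
apply: le_trans (esum_scale_le _ c0 sel_weight_ge0) _.
by rewrite [leRHS]EFinM lee_wpmul2l ?lee_fin ?total_weight_le.
Qed.

(** The sum of the factors needed by null models and by models of small expected noise. *)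
Definition absC : R := bad * (1 + bad `^ (q^-1 * (gam - q))).

Lemma absC_gt0 : 0 < absC.
Proof. by rewrite mulr_gt0 // ltr_wpDr ?powR_ge0. Qed.

(* The contribution of the bad event does not decay with the models; it is paid
   for either by a model of small dimension, whose weight is then bounded below,
   or by the expected noise of the model itself. *)
Lemma bad_absorb m : bad * K `^ q <= t m `^ q + absC * (tau * W).
Proof.
have tW : tau * sel_weight m <= tau * W by rewrite ler_wpM2l ?sel_weight_le // ltW.
have w0 : 0 <= tau * sel_weight m by rewrite mulr_ge0 ?sel_weight_ge0 // ltW.
have L0 : 0 <= bad `^ (q^-1 * (gam - q)) by exact: powR_ge0.
have bL : 0 <= bad * bad `^ (q^-1 * (gam - q)) by rewrite mulr_ge0 // ltW.
have tq0 : 0 <= t m `^ q by exact: powR_ge0.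
have aW : absC * (tau * sel_weight m) <= absC * (tau * W).
  by rewrite ler_wpM2l // ltW // absC_gt0.
have [S0|S0] := boolP (S m == 0%VS).
  have w1 : sel_weight m = 1 by rewrite /sel_weight S0.
  have Kq : K `^ q <= tau.
    apply: (@le_trans _ _ (K `^ gam)); last by rewrite (K_powR N).
    by rewrite ler_powR // (K_ge1 N).
  have bK : bad * K `^ q <= bad * tau by rewrite ler_wpM2l // ltW.
  have bt : 0 <= bad * bad `^ (q^-1 * (gam - q)) * tau by rewrite mulr_ge0 // ltW.
  move: aW; rewrite w1 /absC; lra.
have [tp tD] := sel_pos S0.
(* [lam] makes [(lam * K) ^ q] equal to [bad * K ^ q]. If [t m >= lam * K], the expected noise pays
   alone; below, the negative exponent [q - gam] makes the weight of [m] large enough. *)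
set lam := bad `^ q^-1.
have lam0 : 0 < lam by exact: powR_gt0.
have lamq : lam `^ q = bad.
  by rewrite /lam -powRrM mulVf ?gt_eqF // powRr1 // ltW.
have lamg : lam `^ (gam - q) = bad `^ (q^-1 * (gam - q)) by rewrite /lam -powRrM.
have [Kt|/ltW tK] := leP (lam * K) (t m).
  rewrite -{1}lamq -powRM ?(ltW lam0) ?(ltW K0) //.
  have h : (lam * K) `^ q <= t m `^ q.
    by rewrite ge0_ler_powR ?nnegrE ?(ltW q0) // ?mulr_ge0 // ltW.
  by have : 0 <= absC * (tau * W) by [rewrite mulr_ge0 ?(ltW absC_gt0) //; lra]; lra.
have tg0 : 0 < t m `^ (gam - q) by exact: powR_gt0.
have we : t m `^ (q - gam) <= sel_weight m.
  rewrite /sel_weight (negbTE S0).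
  have -> : t m `^ (q - gam) = t m * t m `^ (q - p / 2).
    rewrite -{2}(powRr1 (ltW tp)) -powRD ?(gt_eqF tp) ?implybT //.
    by congr (_ `^ _); lra.
  by rewrite ler_wpM2r ?powR_ge0 //; lra.
have key : K `^ q <= bad `^ (q^-1 * (gam - q)) * (tau * sel_weight m).
  rewrite -lamg; apply: (@le_trans _ _ (lam `^ (gam - q) * (tau * t m `^ (q - gam)))); last first.
    by rewrite ler_wpM2l ?powR_ge0 // ler_wpM2l // ltW.
  have Kt : K `^ q * K `^ (gam - q) = tau.
    rewrite -powRD ?(gt_eqF K0) ?implybT // -[RHS](K_powR N).
    by congr (_ `^ _); lra.
  have -> : lam `^ (gam - q) * (tau * t m `^ (q - gam)) =
      K `^ q * ((lam * K) `^ (gam - q) / t m `^ (gam - q)).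
    rewrite -{1}Kt.
    rewrite (@powRM _ lam K) ?(ltW lam0) ?(ltW K0) //.
    have -> : t m `^ (q - gam) = (t m `^ (gam - q))^-1.
      by rewrite -(powRN (t m)) (opprB gam).
    move: (lam `^ (gam - q)) (K `^ (gam - q)) (K `^ q) (t m `^ (gam - q)) => a b c z.
    by ring.
  rewrite -[leLHS]mulr1 ler_wpM2l ?powR_ge0 // ler_pdivlMr // mul1r.
  by rewrite ge0_ler_powR ?nnegrE ?subr_ge0 ?(ltW tp) ?mulr_ge0 // ltW.
apply: le_trans (ler_wpM2l (ltW bad_gt0) key) _.
apply: le_trans (ler_wpDl tq0 aW).
by rewrite (mulrA bad) ler_wpM2r // /absC (mulrDr bad) lerDr mulr1 ltW.
Qed.

(** One [selC] for the competing model, one for the sum over all possible selections, and [absC] for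
    the bad event. *)
Definition riskC : R := 2 * selC + absC.

Let powR_sum7 (x1 x2 x3 x4 x5 x6 x7 : R) :
  0 <= x1 -> 0 <= x2 -> 0 <= x3 -> 0 <= x4 -> 0 <= x5 -> 0 <= x6 -> 0 <= x7 ->
  (x1 + x2 + x3 + x4 + x5 + x6 + x7) `^ q <=
  x1 `^ q + x2 `^ q + x3 `^ q + x4 `^ q + x5 `^ q + x6 `^ q + x7 `^ q.
Proof.
move=> *; have sub x y : 0 <= x -> 0 <= y -> (x + y) `^ q <= x `^ q + y `^ q.
  by move=> *; exact: powR_subadd.
by do 5 (apply: le_trans (sub _ _ _ _) _; rewrite ?addr_ge0 // lerD2r); exact: sub.
Qed.

Let Ex_combination_le (A c a1 a2 a3 a4 : R) (f1 f2 f3 f4 : T -> R) :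
  0 <= A -> 0 <= c ->
  measurable_fun setT f1 -> measurable_fun setT f2 ->
  measurable_fun setT f3 -> measurable_fun setT f4 ->
  (forall w, 0 <= f1 w) -> (forall w, 0 <= f2 w) ->
  (forall w, 0 <= f3 w) -> (forall w, 0 <= f4 w) ->
  (Ex P f1 <= a1%:E)%E -> (Ex P f2 <= a2%:E)%E ->
  (Ex P f3 <= a3%:E)%E -> (Ex P f4 <= a4%:E)%E ->
  (Ex P (fun w => A + (f1 w + c * (f2 w + (f3 w + f4 w))))%R <=
   (A + (a1 + c * (a2 + (a3 + a4))))%:E)%E.
Proof.
move=> A0 c0 m1 m2 m3 m4 h1 h2 h3 h4 e1 e2 e3 e4.
have n34 w : 0 <= f3 w + f4 w by rewrite addr_ge0.
have n24 w : 0 <= f2 w + (f3 w + f4 w) by rewrite addr_ge0.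
have nc w : 0 <= c * (f2 w + (f3 w + f4 w)) by rewrite mulr_ge0.
have n1 w : 0 <= f1 w + c * (f2 w + (f3 w + f4 w)) by rewrite addr_ge0.
rewrite ExD //; try by meas.
rewrite ExD //; try by meas.
rewrite ExZ //; try by meas.
rewrite ExD //; try by meas.
rewrite ExD //; try by meas.
by rewrite Ex_cst !EFinD EFinM leeD2l // leeD // lee_wpmul2l ?lee_fin // !EFinD !leeD.
Qed.

Let measurable_loss :
  measurable_fun setT (fun w => sqn (s - pi_ (mhat w) *m Y w) `^ q).
Proof.
apply: (measurableT_comp (measurable_powR q)).
apply: (@measurable_select _ _ _ _ _ mmhat (fun l w => sqn (s - pi_ l *m Y w))) => l.
under eq_fun do rewrite (sqn_loss (piS l)).
apply: measurable_funD; first exact: measurable_cst.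
by apply: measurable_funM; [exact: measurable_cst|exact: measurable_sqn_nvec0].
Qed.

(** The 7 adds 1 for the bias, 1 for the expected noise, 4 for the penalty of [m], and 1 for the
    share of the bad event charged to [t m]. *)
Lemma Ex_loss m : (Ex P (fun w => sqn (s - pi_ (mhat w) *m Y w) `^ q)%R <=
  (oracleC theta `^ q *
    (7 * mean_risk m `^ q + v `^ q * (riskC * (tau * W))))%:E)%E.
Proof.
have X0 := mean_risk_ge0 m; have v0' := ltW v0.
have s20 : 0 <= sigma ^+ 2 by exact: sqr_ge0.
have b0 : 0 <= sqn (s - pi_ m *m s) by exact: sqn_ge0.
have B0 : 0 <= sqn (s - pi *m s) by exact: sqn_ge0.
have vtE : v * t m = sigma ^+ 2 * tr m.
  by move: r r0 => c c0; field; exact: lt0r_neq0.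
have vt0 : 0 <= v * t m by rewrite mulr_ge0 ?t0.
have bX : sqn (s - pi_ m *m s) <= mean_risk m.
  by rewrite /mean_risk -addrA lerDl -vtE addr_ge0 // mulr_ge0.
have vtX : v * t m <= mean_risk m.
  rewrite /mean_risk vtE -addrA addrC -addrA lerDl addr_ge0 //.
  by rewrite mulr_ge0.
have bq : sqn (s - pi_ m *m s) `^ q <= mean_risk m `^ q.
  by rewrite ge0_ler_powR ?nnegrE ?(ltW q0).
have vtq : (v * t m) `^ q <= mean_risk m `^ q.
  by rewrite ge0_ler_powR ?nnegrE ?(ltW q0).
have oc : 0 <= oracleC theta.
  have : 0 <= 8 / theta by rewrite divr_ge0 // ltW.
  by rewrite /oracleC; have := theta0; lra.
have x1p l w : 0 <= xi1 l w by rewrite le_max lexx.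
have x2p l w : 0 <= xi2 l w by rewrite le_max lexx.
have vq0 : 0 <= v `^ q by exact: powR_ge0.
pose A := sqn (s - pi_ m *m s) `^ q + (v * t m) `^ q.
pose f1 w := (t m * V2 w) `^ q.
pose f2 w := xi1 m w `^ q + xi2 m w `^ q.
pose f3 w := xi1 (mhat w) w `^ q + xi2 (mhat w) w `^ q.
pose f4 w := full_noise w `^ q.
have f10 w : 0 <= f1 w by exact: powR_ge0.
have f20 w : 0 <= f2 w by rewrite addr_ge0 ?powR_ge0.
have f30 w : 0 <= f3 w by rewrite addr_ge0 ?powR_ge0.
have f40 w : 0 <= f4 w by exact: powR_ge0.
have A0 : 0 <= A by rewrite addr_ge0 ?powR_ge0.
have mpow (g : T -> R) : measurable_fun setT g -> measurable_fun setT (fun w => g w `^ q).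
  by move=> mg; apply: (measurableT_comp (measurable_powR q)).
have m1 : measurable_fun setT f1.
  by apply: mpow; have h := measurable_sigma2_hat; meas.
have mxi l : measurable_fun setT (fun w => xi1 l w `^ q + xi2 l w `^ q).
  exact: measurable_funD (measurable_xi1 l) (measurable_xi2 l).
have m2 : measurable_fun setT f2 := mxi m.
have m3 : measurable_fun setT f3.
  exact: (@measurable_select _ _ _ _ _ mmhat (fun l w => xi1 l w `^ q + xi2 l w `^ q)).
have m4 : measurable_fun setT f4 by exact: mpow.
have e1 : (Ex P f1 <= (4 * mean_risk m `^ q)%:E)%E := Ex_penalty m.
have e2 : (Ex P f2 <= (selC * (tau * W))%:E)%E.
  apply: le_trans (sel_bound m) _; rewrite lee_fin ler_wpM2l ?selC_ge0 //.
  by rewrite ler_wpM2l ?sel_weight_le // ltW.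
have e3 : (Ex P f3 <= (selC * (tau * W))%:E)%E.
  rewrite mulrA; apply: le_trans total_sel_bound.
  apply: (@Ex_select_le _ _ _ _ _ _ mmhat (fun l w => xi1 l w `^ q + xi2 l w `^ q)).
  - exact: mxi.
  - by move=> l w; rewrite addr_ge0 ?powR_ge0.
  - move=> l; rewrite mulr_ge0 ?selC_ge0 // mulr_ge0 ?sel_weight_ge0 //; exact: ltW.
  - exact: sel_bound.
have e4 : (Ex P f4 <= (bad * K `^ q)%:E)%E := Ex_full_noise.
have mloss := measurable_loss.
have Eg := Ex_combination_le A0 vq0 m1 m2 m3 m4 f10 f20 f30 f40 e1 e2 e3 e4.
pose g w := A + (f1 w + v `^ q * (f2 w + (f3 w + f4 w))).
have mg : measurable_fun setT g.
  apply: measurable_funD; first exact: measurable_cst.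
  apply: measurable_funD => //; apply: measurable_funM; first exact: measurable_cst.
  by apply: measurable_funD => //; exact: measurable_funD.
have lg w : sqn (s - pi_ (mhat w) *m Y w) `^ q <= oracleC theta `^ q * g w.
  apply: (@le_trans _ _ (oracleC theta `^ q * (sqn (s - pi_ m *m s) + v * t m
     + t m * V2 w + v * xi2 m w + v * xi1 (mhat w) w + v * xi2 (mhat w) w
     + v * full_noise w) `^ q)).
    have tV0 : 0 <= t m * V2 w by rewrite mulr_ge0 ?t0 ?sigma2_hat_ge0.
    have S0 : 0 <= sqn (s - pi_ m *m s) + v * t m
     + t m * V2 w + v * xi2 m w + v * xi1 (mhat w) w + v * xi2 (mhat w) w
     + v * full_noise w.
      by rewrite !addr_ge0 //; exact: mulr_ge0.
    rewrite -(powRM _ oc S0) ge0_ler_powR ?nnegrE ?(ltW q0) ?sqn_ge0 ?loss_le //.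
    exact: mulr_ge0.
  rewrite ler_wpM2l ?powR_ge0 //.
  have tV0 : 0 <= t m * V2 w by rewrite mulr_ge0 ?t0 ?sigma2_hat_ge0.
  apply: le_trans (powR_sum7 _ _ _ _ _ _ _) _ => //; try exact: mulr_ge0.
  rewrite (@powRM _ v (xi2 m w)) // (@powRM _ v (xi1 _ w)) // (@powRM _ v (xi2 (mhat w) w)) //.
  rewrite (@powRM _ v (full_noise w)) // /g /A /f1 /f2 /f3 /f4.
  have := mulr_ge0 vq0 (powR_ge0 (xi1 m w) q).
  move: (sqn _ `^ q) ((v * t m) `^ q) ((t m * V2 w) `^ q) => a1 a2 a3.
  move: (xi1 m w `^ q) (xi2 m w `^ q) (xi1 (mhat w) w `^ q)
    (xi2 (mhat w) w `^ q) (full_noise w `^ q) (v `^ q) => y1 y2 y3 y4 y5 c c0.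
  have -> : a1 + a2 + (a3 + c * (y1 + y2 + (y3 + y4 + y5))) =
    a1 + a2 + a3 + c * y2 + c * y3 + c * y4 + c * y5 + c * y1 by ring.
  by rewrite lerDl.
apply: (@Ex_leZ _ _ _ _ _ _ _ g) => //; [exact: powR_ge0|by move=> w; exact: powR_ge0| |].
  move=> w; exact: (addr_ge0 A0 (addr_ge0 (f10 w) (mulr_ge0 vq0
    (addr_ge0 (f20 w) (addr_ge0 (f30 w) (f40 w)))))).
apply: le_trans Eg _; rewrite lee_fin.
have := ler_wpM2l vq0 (bad_absorb m).
rewrite (mulrDr (v `^ q)) -(@powRM _ v) // /A /riskC; move: bq vtq.
move: (sqn _ `^ q) ((v * t m) `^ q) (mean_risk m `^ q) (bad * K `^ q) (v `^ q)
  selC absC (tau * W) => a1 a2 X b c sc ac w h1 h2 h3.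
have -> : c * (sc * w + (sc * w + b)) = c * b + 2 * (c * (sc * w)) by ring.
have -> : c * ((2 * sc + ac) * w) = c * (ac * w) + 2 * (c * (sc * w)) by ring.
by lra.
Qed.

(** The 14 is twice the 7 of [Ex_loss]: the exponent [1 / q >= 1] is not subadditive, and splitting
    a sum under it doubles both terms first. *)
Definition oracle_const : R := (14 * oracleC theta `^ q) `^ q^-1.
Definition weight_const : R := 2 * oracleC theta `^ q * riskC.

Let powR_inv_sum (x y a b c e : R) : 0 <= x -> 0 <= y -> 0 <= a -> 0 <= b ->
  2 * x = a * c `^ q -> 2 * y = b * e `^ q -> 0 <= c -> 0 <= e ->
  (x + y) `^ q^-1 <= a `^ q^-1 * c + e * b `^ q^-1.
Proof.
move=> x0 y0 a0 b0 xE yE c0 e0.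
have qV0 : 0 <= q^-1 by rewrite invr_ge0 ltW.
have root z : 0 <= z -> (z `^ q) `^ q^-1 = z.
  by move=> z0; rewrite -powRrM mulfV ?gt_eqF // powRr1.
have -> : a `^ q^-1 * c = (2 * x) `^ q^-1 by rewrite xE powRM ?powR_ge0 ?root.
have -> : e * b `^ q^-1 = (2 * y) `^ q^-1 by rewrite yE powRM ?powR_ge0 ?root // mulrC.
have [xy|/ltW yx] := leP x y.
  apply: (@le_trans _ _ ((2 * y) `^ q^-1)); last by rewrite lerDr powR_ge0.
  by rewrite ge0_ler_powR ?nnegrE ?addr_ge0 ?mulr_ge0 //; lra.
apply: (@le_trans _ _ ((2 * x) `^ q^-1)); last by rewrite lerDl powR_ge0.
by rewrite ge0_ler_powR ?nnegrE ?addr_ge0 ?mulr_ge0 //; lra.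
Qed.

Lemma weight_ge0 (m : M) : 0 <= W.
Proof. exact: le_trans (sel_weight_ge0 m) (sel_weight_le m). Qed.

Lemma riskC_gt0 : 0 < riskC.
Proof. by rewrite ltr_wpDl ?absC_gt0 // mulr_ge0 ?selC_ge0. Qed.

Lemma risk_bound m :
  ((Ex P (fun w => normn (s - pi_ (mhat w) *m Y w) `^ (2 * q))%R) `^ q^-1 <=
   (oracle_const * (n%:R^-1 * mean_risk m) +
    n%:R^-1 * v * (weight_const * (tau * W)) `^ q^-1)%:E)%E.
Proof.
have W0 := weight_ge0 m; have X0 := mean_risk_ge0 m.
have nV0 : 0 <= n%:R^-1 :> R by rewrite invr_ge0 ltW.
have cq0 : 0 <= oracleC theta `^ q by exact: powR_ge0.
have rC0 := ltW riskC_gt0.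
have tW0 : 0 <= tau * W by rewrite mulr_ge0 // ltW.
have nE w : normn (s - pi_ (mhat w) *m Y w) `^ (2 * q) =
    n%:R^-1 `^ q * sqn (s - pi_ (mhat w) *m Y w) `^ q.
  rewrite -(@powRM _ n%:R^-1) ?sqn_ge0 // -normn_sqr sqr_powR.
  by rewrite ger0_norm ?normn_ge0.
under eq_Ex do rewrite nE.
rewrite ExZ ?powR_ge0 //; last by move=> w; exact: powR_ge0.
set B := oracleC theta `^ q * (7 * mean_risk m `^ q + v `^ q * (riskC * (tau * W))).
have EB : (Ex P (fun w => sqn (s - pi_ (mhat w) *m Y w) `^ q)%R <= B%:E)%E := Ex_loss m.
apply: (@le_trans _ _ ((n%:R^-1 `^ q * B)%:E `^ q^-1)%E).
  apply: gt0_ler_poweR; rewrite ?invr_ge0 ?(ltW q0) //.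
  - by rewrite in_itv /= leey andbT mule_ge0 ?lee_fin ?powR_ge0 // Ex_ge0 // => w; exact: powR_ge0.
  - rewrite in_itv /= leey andbT lee_fin mulr_ge0 ?powR_ge0 // /B mulr_ge0 // addr_ge0 //.
      by rewrite mulr_ge0 ?powR_ge0.
    by rewrite mulr_ge0 ?powR_ge0 // mulr_ge0.
  - by rewrite EFinM lee_wpmul2l ?lee_fin ?powR_ge0.
rewrite poweR_EFin lee_fin.
have v0' := ltW v0.
have -> : n%:R^-1 `^ q * B = 7 * oracleC theta `^ q * (n%:R^-1 * mean_risk m) `^ q
    + oracleC theta `^ q * riskC * (tau * W) * (n%:R^-1 * v) `^ q.
  rewrite (@powRM _ n%:R^-1 (mean_risk m)) // (@powRM _ n%:R^-1 v) // /B.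
  move: (n%:R^-1 `^ q) (oracleC theta `^ q) (mean_risk m `^ q) (v `^ q) riskC (tau * W) => *.
  by ring.
have h1 : 0 <= 14 * oracleC theta `^ q by rewrite mulr_ge0.
have h2 : 0 <= weight_const * (tau * W).
  by rewrite mulr_ge0 // /weight_const mulr_ge0 // mulr_ge0.
apply: powR_inv_sum => //.
- by rewrite mulr_ge0 ?powR_ge0 // mulr_ge0.
- by rewrite mulr_ge0 ?powR_ge0 // mulr_ge0 // mulr_ge0.
- by move: (oracleC theta `^ q) (_ `^ q) => *; ring.
- rewrite /weight_const; move: (oracleC theta `^ q) (_ `^ q) riskC (tau * W) => *; ring.
- by rewrite mulr_ge0.
- by rewrite mulr_ge0.
Qed.

End FiniteWeight.

Lemma Ex_normn_loss m :
  Ex P (fun w => normn (s - pi_ m *m Y w) ^+ 2) =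
  (n%:R^-1 * (sqn (s - pi_ m *m s) + sigma ^+ 2 * tr m))%:E.
Proof.
have s2 : 0 <= sigma ^+ 2 by exact: sqr_ge0.
have nV0 : 0 <= n%:R^-1 :> R by rewrite invr_ge0 ltW.
have ms : measurable_fun setT (fun w => sigma ^+ 2 * sqn ((pi_ m *m Pn) *m e w)).
  by apply: measurable_funM; [exact: measurable_cst|exact: measurable_sqn_nvec0].
have p0 w : 0 <= sigma ^+ 2 * sqn ((pi_ m *m Pn) *m e w) by rewrite mulr_ge0 ?sqn_ge0.
under eq_Ex do rewrite normn_sqr (sqn_loss (piS m)).
have b0 : 0 <= sqn (s - pi_ m *m s) by exact: sqn_ge0.
rewrite ExZ //; last 2 first.
- by apply: measurable_funD; [exact: measurable_cst|].
- by move=> w; rewrite addr_ge0.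
by rewrite ExD // Ex_cst (Ex_sqn_nvecZ N) // (trace_proj (piS m)).
Qed.

End Risk.

(** * Constants, order of the moments and passage to the infimum *)

Section Assembly.
Context (R : realType).

Lemma oracleC_gt0 (theta : R) : 0 < theta -> 0 < oracleC theta.
Proof.
by move=> t0; have : 0 < 8 / theta by [rewrite divr_gt0]; rewrite /oracleC; lra.
Qed.

Lemma oracle_const_gt0 (q theta : R) : 0 < theta -> 0 < oracle_const q theta.
Proof.
by move=> t0; rewrite powR_gt0 // mulr_gt0 // powR_gt0 // oracleC_gt0.
Qed.

Lemma weight_const_gt0 (p q theta : R) k : 0 < theta -> 0 < weight_const p q theta k.
Proof.
move=> t0; rewrite mulr_gt0 ?riskC_gt0 // mulr_gt0 //.
by rewrite powR_gt0 // oracleC_gt0.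
Qed.

(** The predecessor is taken because [noise] uses [k.+1]; the integer part is positive since
    [p > 2]. *)
Definition moment_order (p : R) : nat := (Num.truncn (p / 2)).-1.

Lemma noise_of_moments d (T : measurableType d) (P : probability T R) n
    (X : 'I_n -> {RV P >-> R}) (p tau : R) :
  (0 < n)%N -> 2 < p -> mutually_independent X ->
  (forall i, 'E_P[X i] = 0)%E -> (forall i, 'V_P[X i] = 1)%E ->
  (forall i, 'E_P[fun w => (`|X i w| `^ p)%R] = tau%:E)%E ->
  noise X p tau (moment_order p).
Proof.
move=> n0 p2 indep EX VX mX; split=> //.
- have p0 : 0 <= p / 2 by rewrite divr_ge0 //; lra.
  have := truncn_itv p0; have : (0 < Num.truncn (p / 2))%N by rewrite truncn_gt0; lra.
  rewrite /moment_order; case: (Num.truncn _) => //= k _ /andP[h1 h2].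
  by apply/andP; split; lra.
- by move=> i; have := EX i; rewrite unlock.
- move=> i; have := VX i; rewrite /variance unlock EX /= => <-.
  rewrite unlock /Ex; apply: eq_integral => w _; congr EFin.
  by rewrite !fctE /= subr0 expr2.
- by move=> i; have := mX i; rewrite unlock.
Qed.

(** Solved for [y i], the bounds give one real lower bound of the range. An empty family has infimum
    [+oo], which makes the right-hand side infinite. *)
Lemma le_oracle_inf (I : Type) (x : I -> \bar R) (y : I -> R) (L : \bar R) (C b D : R) :
  0 < C -> (0 <= L)%E -> 0 <= D -> 0 <= b -> (forall i, x i = (y i)%:E) ->
  (forall i, 0 <= y i) ->
  (forall i, (L <= (C * (y i + b) + D)%:E)%E) ->
  (L <= C%:E * (ereal_inf (range x) + b%:E) + D%:E)%E.
Proof.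
move=> C0 L0 D0 b0 xy y0 Ly.
have [[i _]|noI] := pselect (exists i : I, True); last first.
  have -> : range x = set0 by apply/seteqP; split=> // z [j _ _]; apply: noI; exists j.
  by rewrite ereal_inf0 addye // gt0_muley ?lte_fin // addye // leey.
have LE : (fine L)%:E = L.
  by rewrite fineK // ge0_fin_numE // (le_lt_trans (Ly i)) // ltry.
move: Ly; rewrite -LE; move: (fine L) => l Ly.
have h : ((((l - D) / C - b)%:E) <= ereal_inf (range x))%E.
  apply: le_ereal_inf_tmp => _ [j _ <-]; rewrite xy lee_fin.
  have := Ly j; rewrite lee_fin lerBlDr ler_pdivrMr // => h; lra.
have -> : l = C * ((l - D) / C - b + b) + D by field; exact: lt0r_neq0.
by rewrite EFinD EFinM EFinD leeD2r // lee_wpmul2l ?lee_fin ?(ltW C0) // leeD2r.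
Qed.

End Assembly.

Theorem theorem3p2 (R : realType) :
  exists (C : R -> R -> R) (C' C3 : R -> R -> R -> R)
         (kappa : R -> R -> R -> R -> R) (kappa_lim : R -> R -> R -> R),
  forall p q theta : R,
    2 < p -> 0 < theta -> 0 < q -> q <= 1 -> 2 * (q + 1) < p ->
    [/\ 0 < C q theta, 0 < C' p q theta & 0 < C3 p q theta] /\
    [/\ forall x, 0 < kappa p q theta x,
        0 < kappa_lim p q theta
      & kappa p q theta x @[x --> +oo%R] --> kappa_lim p q theta] /\
    forall (n : nat) (Pn : 'M[R]_n) (s : 'cV[R]_n) (sigma tau : R)
      (d : measure_display) (T : measurableType d) (P : probability T R)
      (eps : 'I_n -> {RV P >-> R})
      (M : countType) (S : M -> {vspace 'cV[R]_n}) (pi_ : M -> 'M[R]_n)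
      (V : {vspace 'cV[R]_n}) (pi : 'M[R]_n) (mhat : T -> M),
    let Y w := observation Pn s sigma (\col_i eps i w) in
    Pn != 0 ->
    s \in imspace Pn ->
    0 < sigma ->
    iid eps ->
    (forall i, 'E_P[eps i] = 0)%E ->
    (forall i, 'V_P[eps i] = 1)%E ->
    (forall i, 'E_P[fun w => (`|eps i w| `^ p)%R] = tau%:E)%E ->
    (forall m, (S m <= imspace Pn)%VS) ->
    (forall m, is_orthogonal_projection (S m) (pi_ m)) ->
    (V <= imspace Pn)%VS ->
    is_orthogonal_projection V pi ->
    \tr (Pn^T *m pi *m Pn) <= \tr (Pn^T *m Pn) / 2 ->
    (forall m, measurable (mhat @^-1` [set m])) ->
    (forall w m, criterion Pn pi theta (pi_ (mhat w)) (Y w)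
                 <= criterion Pn pi theta (pi_ m) (Y w)) ->
    ('E_P[fun w => (normn (s - pi_ (mhat w) *m Y w) `^ (2 * q))%R] `^ q^-1
     <= (C q theta)%:E *
          (ereal_inf (range (fun m : M =>
             'E_P[fun w => (normn (s - pi_ m *m Y w) ^+ 2)%R]))
           + (2 * normn (s - pi *m s) ^+ 2)%:E)
        + (specnorm Pn ^+ 2 * sigma ^+ 2)%:E *
          Rn_bar S pi_ Pn s p q sigma tau (C' p q theta) (C3 p q theta)
            (kappa p q theta (\tr (Pn^T *m Pn) / specnorm Pn ^+ 2)%R))%E.
Proof.
(* The bound holds even without the second term of [Rn_bar]. *)
exists (fun q theta => oracle_const q theta), (fun _ _ _ => 1),
  (fun p q theta => weight_const p q theta (moment_order p)), (fun _ _ _ _ => 1),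
  (fun _ _ _ => 1) => p q theta p2 theta0 q0 q1 qp.
have C0 := oracle_const_gt0 q theta0.
have C30 := weight_const_gt0 p q (moment_order p) theta0.
split; first by split.
split; first by split => //; exact: cvg_cst.
move=> n Pn s sigma tau d T P eps M S pi_ V pi mhat Y Pn0 _ sigma0 [indep _] EX VX mX
  SP piS _ piV trV mmhat minimizer.
have n0 : (0 < n)%N.
  have [n0|//] := posnP n; move: Pn0; rewrite (_ : Pn = 0) ?eqxx //.
  by apply/matrixP => i; have := ltn_ord i; rewrite {2}n0.
have N := noise_of_moments n0 p2 indep EX VX mX.
have q01 : 0 < q <= 1 by rewrite q0.
have tau0 : 0 < tau := lt_le_trans ltr01 (tau_ge1 N).
have r0 : 0 < specnorm Pn ^+ 2 by rewrite exprn_gt0 // specnorm_gt0.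
have v0 : 0 < specnorm Pn ^+ 2 * sigma ^+ 2 by rewrite mulr_gt0 // exprn_gt0.
have nV0 : 0 < n%:R^-1 :> R by rewrite invr_gt0 ltr0n.
rewrite /Rn_bar /Rn; set B := normn (s - pi *m s) ^+ 2.
set D2 := (1 * tau `^ q^-1 * _ * _ * _).
have B0 : 0 <= 2 * B by rewrite mulr_ge0 // sqr_ge0.
set x := fun m : M => ('E_P[fun w => (normn (s - pi_ m *m Y w) ^+ 2)%R])%E.
pose y m := n%:R^-1 * (sqn (s - pi_ m *m s) + sigma ^+ 2 * \tr (Pn^T *m pi_ m *m Pn)).
have xE m : x m = (y m)%:E.
  by rewrite /x unlock; exact: (Ex_normn_loss Pn s sigma N piS m).
have y0 m : 0 <= y m.
  rewrite /y mulr_ge0 ?(ltW nV0) // addr_ge0 ?sqn_ge0 // mulr_ge0 ?sqr_ge0 //.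
  by rewrite (trace_proj (piS m)) trace_gram sumr_ge0 // => i _; exact: nsq_ge0.
have inf0 : (0 <= ereal_inf (range x) + (2 * B)%:E)%E.
  rewrite adde_ge0 ?lee_fin //; apply: le_ereal_inf_tmp => _ [m _ <-].
  by rewrite xE lee_fin.
have D20 : 0 <= D2.
  have tp0 : 0 <= tau `^ q^-1 by exact: powR_ge0.
  have np0 : 0 <= normn s ^+ 2 / (specnorm Pn ^+ 2 * sigma ^+ 2) + tau.
    by rewrite addr_ge0 ?(ltW tau0) // divr_ge0 ?sqr_ge0 // ltW.
  by rewrite /D2 mul1r mulr1 mulr_ge0 ?powR_ge0 // mulr_ge0.
set Z := (N0 S + _)%E.
have Z0 : (0 <= Z)%E.
  rewrite adde_ge0 //.
    by apply: le_trans (esum1_le_counting _ _); exact: esum_ge0.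
  apply: esum_ge0 => m /= Sm; rewrite lee_fin.
  have [t0 tD] := sel_pos Pn0 SP piS Sm.
  by rewrite mulr_ge0 ?powR_ge0 // addr_ge0 // (le_trans (ltW t0) tD).
have ELE : ('E_P[fun w => (normn (s - pi_ (mhat w) *m Y w) `^ (2 * q))%R] =
    Ex P (fun w => normn (s - pi_ (mhat w) *m Y w) `^ (2 * q))%R)%E by rewrite unlock.
have L0 : (0 <= 'E_P[fun w => (normn (s - pi_ (mhat w) *m Y w) `^ (2 * q))%R] `^ q^-1)%E.
  exact: poweR_ge0.
have RB := risk_bound N theta0 q01 qp Pn0 sigma0 SP piS piV trV mmhat minimizer.
have C1 : (0 <= (oracle_const q theta)%:E * (ereal_inf (range x) + (2 * B)%:E))%E.
  by rewrite mule_ge0 // lee_fin ltW.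
have qV0 : q^-1 != 0 by rewrite invr_eq0 gt_eqF.
(* An infinite total weight makes the right-hand side infinite; otherwise [risk_bound] applies to
   its real value [W]. *)
move: Z0; case ZE : Z => [W| |] // W0; last first.
  rewrite gt0_muley ?lte_fin ?(mulr_gt0 C30) // poweRyr // gt0_mulye ?lte_fin //.
  rewrite addye // gt0_muley ?lte_fin // addey ?leey // gt_eqF //.
  exact: lt_le_trans C1.
have {}RB := RB W ZE.
rewrite -(EFinM _ W) poweR_EFin -(EFinM _ n%:R^-1) -(EFinD _ D2) -(EFinM (specnorm Pn ^+ 2 * _)).
set D1 := (_ `^ q^-1 / _).
have D10 : 0 <= D1 by rewrite mulr_ge0 ?powR_ge0 // ltW.
have vD0 : 0 <= specnorm Pn ^+ 2 * sigma ^+ 2 * D1 by rewrite mulr_ge0 // ltW.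
have D12 : specnorm Pn ^+ 2 * sigma ^+ 2 * D1 <= specnorm Pn ^+ 2 * sigma ^+ 2 * (D1 + D2).
  by rewrite ler_wpM2l ?(ltW v0) // lerDl.
apply: (@le_trans _ _ ((oracle_const q theta)%:E *
  (ereal_inf (range x) + (2 * B)%:E) + (specnorm Pn ^+ 2 * sigma ^+ 2 * D1)%:E)%E).
  apply: (le_oracle_inf C0 L0 vD0 B0 xE y0) => m.
  rewrite ELE; apply: le_trans (RB m) _; rewrite lee_fin; apply: eq_ler.
  rewrite /D1 /y /B /mean_risk normn_sqr (mulrA _ tau).
  move: (oracle_const q theta) (_ `^ q^-1) (n%:R^-1) (sqn _) (sqn _) (\tr _) => *.
  by ring.
by rewrite leeD2l // lee_fin.
Qed.
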